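(* Assume $g$ satisfies A1, A2, A1* and A3w, that $u\in C^0(\Omega)$ is $g$-convex in a domain $\Omega\subset\mathbb R^n$, and that $g_0=g(\cdot,y_0,z_0)$ is $g$-affine in $\Omega$. Assume also: (i) $\Omega$ is $g$-convex with respect to $(y_0,z_0)$; (ii) for all $y\in Tu(\Omega)$ and all $x\in\Omega$, one has $(x,y,g_0(x))\in\Gamma^*$ and $$\{x\}\times\{g_0(x)\}\times\big[Dg_0(x),\,g_x\big(x,y,g^*(x,y,g_0(x))\big)\big]\subset\mathcal U .$$ Then the sections $$S=S(u,g_0)=\{x\in\Omega: u(x)<g_0(x)\},\qquad \tilde S=\tilde S(u,g_0)=\{x\in\Omega:u(x)\le g_0(x)\}$$ are also $g$-convex with respect to $(y_0,z_0)$.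
   Context: Setting. $\Gamma\subset\mathbb R^n\times\mathbb R^n\times\mathbb R$ is a domain whose projections $I(x,y)=\{z\in\mathbb R: (x,y,z)\in\Gamma\}$ are open intervals. The generating function is $g=g(x,y,z)\in C^2(\Gamma)$ with $g_z<0$ in $\Gamma$. Subscripts denote partial derivatives; $[p_0,p_1]$ is the closed straight segment joining $p_0$ and $p_1$. Set $\mathcal U=\{(x,g(x,y,z),g_x(x,y,z)) : (x,y,z)\in\Gamma\}$ and $\mathcal U(x,u)=\{p\in\mathbb R^n:(x,u,p)\in\mathcal U\}$. A1: for each $(x,u,p)\in\mathcal U$ there is a unique point $(x,y,z)\in\Gamma$ with $g(x,y,z)=u$, $g_x(x,y,z)=p$. One writes $Y(x,u,p)=y$, $Z(x,u,p)=z$. A2: $\det E\ne0$ in $\Gamma$, where $E=g_{x,y}-(g_z)^{-1}g_{x,z}\otimes g_y$. A1*: with $Q:=-g_y/g_z$, for all $(y,z)$ the map $x\mapsto Q(x,y,z)$ is one-to-one on $\{x:(x,y,z)\in\Gamma\}$. A3w: with $A(x,u,p)=g_{xx}(x,Y(x,u,p),Z(x,u,p))$ on $\mathcal U$, for every $\xi\in\mathbb R^n$ and every $(x,u)\in\mathbb R^n\times\mathbb R$ the function $p\mapsto (A(x,u,p)\xi,\xi)$ is convex along line segments in $\mathcal U(x,u)$ orthogonal to $\xi$. Dual function: $g^*$ is defined on $\Gamma^*=\{(x,y,g(x,y,z)):(x,y,z)\in\Gamma\}$ by $g(x,y,g^*(x,y,u))=u$. A set $\Omega\subset\mathbb R^n$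 is $g$-convex with respect to $(y_0,z_0)$ if $\Omega\times\{y_0\}\times\{z_0\}\subset\Gamma$ and $Q(\cdot,y_0,z_0)(\Omega)$ is convex in $\mathbb R^n$. A function $g_0=g(\cdot,y_0,z_0)$ with $\Omega\times\{y_0\}\times\{z_0\}\subset\Gamma$ is called $g$-affine in $\Omega$. A function $u\in C^0(\Omega)$ is $g$-convex in $\Omega$ if for each $x_0\in\Omega$ there is $(y,z)\in\mathbb R^n\times\mathbb R$ with $\Omega\times\{y\}\times\{z\}\subset\Gamma$, $u(x_0)=g(x_0,y,z)$ and $u(x)\ge g(x,y,z)$ for all $x\in\Omega$. The $g$-normal mapping of $u$ at $x_0\in\Omega$ is the set $Tu(x_0)$ of all $y\in\mathbb R^n$ such that, with $z=g^*(x_0,y,u(x_0))$, one has $\Omega\times\{y\}\times\{z\}\subset\Gamma$ and $u(x)\ge g(x,y,z)$ for all $x\in\Omega$; and $Tu(\Omega)=\bigcup_{x\in\Omega}Tu(x)$. *)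

(* Defs.v *)
From HB Require Import structures.
From mathcomp Require Import all_boot all_order all_algebra.
From mathcomp Require Import all_classical all_reals all_analysis.

Set Implicit Arguments.
Unset Strict Implicit.
Unset Printing Implicit Defensive.

Import Order.TTheory GRing.Theory Num.Theory.
Import numFieldNormedType.Exports.

Local Open Scope classical_set_scope.
Local Open Scope ring_scope.

Definition domain (T : topologicalType) (D : set T) : Prop :=
  open D /\ connected D.

(* [D] is meant to be open, so that the derivatives at points of [D] depend on
   the values of [f] on [D] only.  In finite dimension, continuity of all
   directional derivatives is the same as continuity of the partial ones. *)
Definition C1_on (R : realType) (V : normedModType R) (D : set V) (f : V -> R)
    : Prop :=
  forall v : V,
    (forall x, D x -> derivable f x v) /\ {within D, continuous ('D_v f)}.

Definition C2_on (R : realType) (V : normedModType R) (D : set V) (f : V -> R)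
    : Prop :=
  C1_on D f /\ forall v : V, C1_on D ('D_v f).

Definition segment (R : realType) (n : nat) (p0 p1 : 'rV[R]_n)
    : set 'rV[R]_n :=
  [set p | exists2 t : R, 0 <= t <= 1 & p = (1 - t) *: p0 + t *: p1].

Definition dot (R : realType) (n : nat) (v w : 'rV[R]_n) : R :=
  (v *m w^T) 0 0.

Definition grad (R : realType) (n : nat) (f : 'rV[R]_n -> R) (x : 'rV[R]_n)
    : 'rV[R]_n :=
  \row_(i < n) 'D_('e_i) f x.

Section GeneratingFunction.
Context {R : realType} {n : nat}.

(* Points (x, y, z), read as ((x, y), z). *)
Local Notation point := ('rV[R]_n * 'rV[R]_n * R)%type.

Definition dirx (i : 'I_n) : point := ('e_i, 0, 0).
Definition diry (i : 'I_n) : point := (0, 'e_i, 0).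
Definition dirz : point := (0, 0, 1).

Variables (Gamma : set point) (g : point -> R).

Definition g_x (w : point) : 'rV[R]_n := \row_(i < n) 'D_(dirx i) g w.
Definition g_y (w : point) : 'rV[R]_n := \row_(i < n) 'D_(diry i) g w.
Definition g_z (w : point) : R := 'D_dirz g w.

Definition g_xx (w : point) : 'M[R]_n :=
  \matrix_(i < n, j < n) 'D_(dirx i) ('D_(dirx j) g) w.
Definition g_xy (w : point) : 'M[R]_n :=
  \matrix_(i < n, j < n) 'D_(dirx i) ('D_(diry j) g) w.
Definition g_xz (w : point) : 'rV[R]_n :=
  \row_(i < n) 'D_(dirx i) ('D_dirz g) w.

Definition I_fiber (x y : 'rV[R]_n) : set R := [set z | Gamma (x, y, z)].

Definition generating_function : Prop :=
  [/\ domain Gamma,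
      (forall x y, is_interval (I_fiber x y) /\ open (I_fiber x y)),
      C2_on Gamma g &
      forall w, Gamma w -> g_z w < 0].

Definition calU : set ('rV[R]_n * R * 'rV[R]_n) :=
  [set (w.1.1, g w, g_x w) | w in Gamma].

Definition calU_fiber (x : 'rV[R]_n) (u : R) : set 'rV[R]_n :=
  [set p | calU (x, u, p)].

Definition jet_preimage (x : 'rV[R]_n) (u : R) (p : 'rV[R]_n)
    : set ('rV[R]_n * R) :=
  [set yz | [/\ Gamma (x, yz.1, yz.2), g (x, yz.1, yz.2) = u
              & g_x (x, yz.1, yz.2) = p]].

Definition A1 : Prop :=
  forall x u p, calU (x, u, p) -> exists! yz, jet_preimage x u p yz.

(* Under [A1], the unique preimage when (x, u, p) is in [calU]; a junk value
   outside [calU].  The same convention is used for [gstar] and [Gstar]. *)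
Definition Y (x : 'rV[R]_n) (u : R) (p : 'rV[R]_n) : 'rV[R]_n :=
  (xget (0, 0) (jet_preimage x u p)).1.
Definition Z (x : 'rV[R]_n) (u : R) (p : 'rV[R]_n) : R :=
  (xget (0, 0) (jet_preimage x u p)).2.

Definition E (w : point) : 'M[R]_n :=
  g_xy w - (g_z w)^-1 *: ((g_xz w)^T *m g_y w).

Definition A2 : Prop := forall w, Gamma w -> \det (E w) != 0.

Definition Q (w : point) : 'rV[R]_n := - ((g_z w)^-1 *: g_y w).

Definition A1star : Prop :=
  forall (y : 'rV[R]_n) (z : R),
    set_inj [set x | Gamma (x, y, z)] (fun x => Q (x, y, z)).

Definition A (x : 'rV[R]_n) (u : R) (p : 'rV[R]_n) : 'M[R]_n :=
  g_xx (x, Y x u p, Z x u p).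

(* As vectors are rows, (A xi, xi) reads [dot (xi *m A^T) xi]. *)
Definition A3w : Prop :=
  forall (xi x : 'rV[R]_n) (u : R) (p0 p1 : 'rV[R]_n),
    segment p0 p1 `<=` calU_fiber x u -> dot (p1 - p0) xi = 0 ->
    convex_function (segment p0 p1) (fun p => dot (xi *m (A x u p)^T) xi).

Definition Gstar : set point := [set (w.1.1, w.1.2, g w) | w in Gamma].

(* On [Gstar], the value is unique since g_z < 0 and the fibers of [Gamma] are
   intervals. *)
Definition gstar (x y : 'rV[R]_n) (u : R) : R :=
  xget 0 [set z | Gamma (x, y, z) /\ g (x, y, z) = u].

Definition g_convex_set (Omega : set 'rV[R]_n) (y0 : 'rV[R]_n) (z0 : R)
    : Prop :=
  Omega `*` [set y0] `*` [set z0] `<=` Gamma /\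
  convex_set [set Q (x, y0, z0) | x in Omega].

Definition g_affine (Omega : set 'rV[R]_n) (y0 : 'rV[R]_n) (z0 : R)
    (g0 : 'rV[R]_n -> R) : Prop :=
  g0 = (fun x => g (x, y0, z0)) /\
  Omega `*` [set y0] `*` [set z0] `<=` Gamma.

Definition g_convex_function (Omega : set 'rV[R]_n) (u : 'rV[R]_n -> R)
    : Prop :=
  forall x0, Omega x0 -> exists y z,
    [/\ Omega `*` [set y] `*` [set z] `<=` Gamma,
        u x0 = g (x0, y, z) &
        forall x, Omega x -> g (x, y, z) <= u x].

(* Membership of (x0, y, u x0) in [Gstar], implicit in writing
   g^*(x0, y, u(x0)), rules out the junk values of [gstar]. *)
Definition g_normal_map (Omega : set 'rV[R]_n) (u : 'rV[R]_n -> R) (x0 : 'rV[R]_n)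
    : set 'rV[R]_n :=
  [set y | Gstar (x0, y, u x0) /\
    let z := gstar x0 y (u x0) in
    Omega `*` [set y] `*` [set z] `<=` Gamma /\
    forall x, Omega x -> g (x, y, z) <= u x].

Definition g_normal_image (Omega : set 'rV[R]_n) (u : 'rV[R]_n -> R)
    : set 'rV[R]_n :=
  \bigcup_(x in Omega) g_normal_map Omega u x.

End GeneratingFunction.

Definition strict_section (R : realType) (n : nat) (Omega : set 'rV[R]_n)
    (u g0 : 'rV[R]_n -> R) : set 'rV[R]_n :=
  [set x | Omega x /\ u x < g0 x].

Definition weak_section (R : realType) (n : nat) (Omega : set 'rV[R]_n)
    (u g0 : 'rV[R]_n -> R) : set 'rV[R]_n :=
  [set x | Omega x /\ u x <= g0 x].

(* Main.v *)
Require Import Defs.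
From HB Require Import structures.
From mathcomp Require Import all_boot all_order all_algebra.
From mathcomp Require Import all_classical all_reals all_analysis.
From mathcomp Require Import ring lra.
Import Order.TTheory GRing.Theory Num.Theory.
Import numFieldNormedType.Exports.
Local Open Scope classical_set_scope.
Local Open Scope ring_scope.

(* For [y1] in the normal image let h(x) = g^*(x, y1, g0(x)).  The
   sections are intersections of sets {h < z1} or {h <= z1}, so it suffices that h
   is quasi-convex along the segments of Q(., y0, z0).  If it is not, let M be its
   maximum on such a segment: the function F = g(., y1, M) - g(., y0, z0), read in
   the coordinates Q, is nonpositive on the segment and vanishes at the last maximum
   point.  As F is C^1 with nonzero gradient there, touching its zero set by a
   parabola gives a nearby point x' and a line through it on which F <= - c s^2.
   At x', move (y0, z0) in the direction that tilts the gradient of g(., y0, z0)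
   towards that of g(., y1, M) while keeping the line in the zero set to first
   order.  Touching the zero set of the perturbation, of size t, by a parabola
   again gives a point where its Hessian in the contact direction z is at least
   t (B z.z + c |z|^2 / 5), with B the Hessian of F at x', whereas A3w bounds it
   by t (B z.z + o(|z|^2)).  Only strict differentiability and second order
   expansions are used, which is why g in C^2 suffices. *)

Set Implicit Arguments.
Unset Strict Implicit.

(** * Strict differentiability *)

(** The coordinates Q are dictated by the perturbation: moving (y0, z0) with velocity (yd, zd)
    changes g(x, ., .) at the rate g_z (zd - Q.yd), which vanishes on a hyperplane in Q. The yd that
    tilts the gradient by nu, the difference of the gradients of g(., y1, M) and g(., y0, z0), is nu
    E^-T, and up to the factor - g_z this is the gradient of F read in the coordinates Q. So the
    lines tangent to the zero set of F in these coordinates are exactly those on which the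
    perturbation is stationary.

    The obstacle is that A is only continuous: A3w is an inequality between values of A and cannot
    be differentiated along a segment. Using it costs errors o(|z|^2), which mere nonpositivity of F
    could not absorb; the first parabola provides the margin c s^2 that does. Moreover A3w compares
    second derivatives only at a common x, at a common value of u and in a direction orthogonal to
    the difference of the gradients. A touching point on the zero set of the perturbation supplies
    the last two: the values agree there, and the contact direction is tangent to the zero set. *)

Lemma is_derive_quadratic {R : realType} (s a b : R) :
  is_derive s (1 : R) (fun t : R => t * a + t * t * b) (a + 2 * s * b).
Proof.
have H1 := is_derive_id s (1 : R).
have H2 := is_deriveM H1 H1.
have Ha : is_derive s (1 : R) (fun _ : R => a) 0 by exact: is_derive_cst.
have Hb : is_derive s (1 : R) (fun _ : R => b) 0 by exact: is_derive_cst.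
apply: (is_derive_eq (is_deriveD (is_deriveM H1 Ha) (is_deriveM H2 Hb))).
rewrite /GRing.scale /=; ring.
Qed.

Section StrictDifferentiability.
Context {R : realType} {V : normedModType R}.

Lemma is_derive_line (f : V -> R) (x v : V) (s : R) :
  derivable f (x + s *: v) v ->
  is_derive s (1 : R) (fun t => f (x + t *: v)) ('D_v f (x + s *: v)).
Proof.
move=> fv.
have E : (fun h : R => h^-1 *: (((fun t : R => f (x + t *: v)) \o shift s) (h *: (1:R))
           - f (x + s *: v))) =
         (fun h : R => h^-1 *: ((f \o shift (x + s *: v)) (h *: v) - f (x + s *: v))).
  apply/funext => h /=; congr (_ *: (f _ - _)).
  by rewrite [h *: _]mulr1 scalerDl addrCA.
by apply: DeriveDef; rewrite /derivable /derive E.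
Qed.

Lemma mean_value_bound (f df : R -> R) (a b K : R) : a <= b ->
  (forall s, a <= s <= b -> is_derive s (1 : R) f (df s)) ->
  (forall s, a <= s <= b -> `|df s| <= K) ->
  `|f b - f a| <= K * (b - a).
Proof.
move=> ab fd fK.
have [||c] := @MVT_segment R f df a b ab.
- by move=> s; rewrite in_itv/= => /andP[/ltW h1 /ltW h2]; apply: fd; rewrite h1.
- apply: derivable_within_continuous => s; rewrite in_itv/= => h.
  by have [] := fd s h.
rewrite in_itv/= => cab ->; rewrite normrM (ger0_norm (_ : 0 <= b - a)) ?subr_ge0//.
by rewrite ler_wpM2r ?subr_ge0// fK.
Qed.

Lemma C1_on_near (D : set V) (f : V -> R) (x0 v : V) (e : R) :
  open D -> C1_on D f -> D x0 -> 0 < e ->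
  exists2 r, 0 < r & forall x, `|x - x0| < r ->
    D x /\ `|'D_v f x - 'D_v f x0| < e.
Proof.
move=> oD fC1 Dx0 e0; have [_] := fC1 v.
rewrite continuous_open_subspace// => /(_ x0); rewrite inE => /(_ Dx0).
move=> /cvgrPdist_lt /(_ e e0) cf.
have : \forall x \near x0, D x /\ `|'D_v f x - 'D_v f x0| < e.
  near=> x; split; first by near: x; apply: open_nbhs_nbhs.
  by rewrite distrC; near: x.
move=> /nbhs_normP [r /= r0 rP]; exists r => // x xr.
by apply: rP; rewrite /= distrC.
Unshelve. all: by end_near.
Qed.

(** The base point [x] moves as well as the step: continuity of ['D_v f] at [x0] bounds, through the
    mean value theorem, the increments of [f (x + s *: v) - s * 'D_v f x0] in [s] for every [x]
    close to [x0]. All later expansions rest on this uniformity. *)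
Lemma C1_strict_dir (D : set V) (f : V -> R) (x0 v : V) (e : R) :
  open D -> C1_on D f -> D x0 -> 0 < e ->
  exists2 r, 0 < r & forall (x : V) (t : R), `|x - x0| < r -> `|t| < r ->
    `|f (x + t *: v) - f x - t * 'D_v f x0| <= e * `|t|.
Proof.
move=> oD fC1 Dx0 e0; have [r r0 rP] := C1_on_near v oD fC1 Dx0 e0.
have v1 : 0 < 1 + `|v| by rewrite ltr_wpDr.
have v0 : 0 <= `|v| by [].
exists (r / (1 + `|v|)); first by rewrite divr_gt0.
(* It is enough to treat steps [t >= 0], the other ones being steps from
   [x + t v] back to [x]; this is why the bound below is on both ends. *)
have key (x : V) (t : R) : 0 <= t ->
    (forall s, 0 <= s <= t -> `|x + s *: v - x0| < r) ->
    `|f (x + t *: v) - f x - t * 'D_v f x0| <= e * t.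
  move=> t0 xr.
  have := @mean_value_bound (fun s => f (x + s *: v) - s * 'D_v f x0)
    (fun s => 'D_v f (x + s *: v) - 'D_v f x0) 0 t e t0.
  rewrite scale0r addr0 mul0r !subr0; rewrite addrAC; apply.
  - move=> s st; have [Ds _] := rP _ (xr s st).
    have ? := @is_derive_line f x v s ((fC1 v).1 _ Ds).
    apply: is_deriveB; apply: is_derive_eq.
    by rewrite [_ *: _]mulr0 add0r [_ *: _]mulr1.
  - by move=> s st; apply/ltW; have [_] := rP _ (xr s st).
move=> x t xr tr.
have near_x s : `|s| <= `|t| -> `|x + s *: v - x0| < r.
  move=> st; rewrite addrAC (le_lt_trans (ler_normD _ _))// normrZ.
  rewrite (@lt_le_trans _ _ (r / (1 + `|v|) + r / (1 + `|v|) * `|v|))//.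
    by rewrite ltr_leD// ler_wpM2r// (le_trans st)// ltW.
  by rewrite -[X in X + _]mulr1 -mulrDr divfK ?gt_eqF.
have [t0|t0] := leP 0 t.
  rewrite [`|t|]ger0_norm//; apply: key => // s /andP[s0 st].
  by apply: near_x; rewrite !ger0_norm.
rewrite [`|t|]ltr0_norm//.
have -> : f (x + t *: v) - f x - t * 'D_v f x0 =
  - (f x - f (x + t *: v) - (- t) * 'D_v f x0) by ring.
rewrite normrN; have := @key (x + t *: v) (- t).
rewrite scaleNr addrK; apply; first by rewrite oppr_ge0 ltW.
move=> s /andP[s0 st]; rewrite -[x + _ + _]addrA -scalerDl; apply: near_x.
by rewrite !ler0_norm//; lra.
Qed.

(** Telescoping: the step along [b i] starts from [x] moved by the other steps, and strictness of
    the one-direction estimate allows such a moving base point. *)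
Lemma C1_strict_sum (D : set V) (f : V -> R) (x0 : V) (I : Type) (b : I -> V)
    (l : seq I) (e : R) :
  open D -> C1_on D f -> D x0 -> 0 < e ->
  exists2 r, 0 < r & forall (x : V) (t : I -> R),
    `|x - x0| < r -> (forall i, `|t i| < r) ->
    `|f (x + \sum_(i <- l) t i *: b i) - f x - \sum_(i <- l) t i * 'D_(b i) f x0|
      <= e * \sum_(i <- l) `|t i|.
Proof.
move=> oD fC1 Dx0 e0; elim: l => [|i l [r r0 IH]].
  by exists 1 => // x t _ _; rewrite !big_nil addr0 !subrr normr0 mulr0.
have [r1 r10 dir] := C1_strict_dir (b i) oD fC1 Dx0 e0.
pose B := 1 + \sum_(j <- l) `|b j|.
have B0 : 0 < B by rewrite ltr_wpDr// sumr_ge0.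
pose r2 := Num.min r (r1 / 2 / B).
have B1 : 1 <= B by rewrite lerDl sumr_ge0.
have r20 : 0 < r2 by rewrite lt_min r0 !divr_gt0.
have r2B : r2 * B <= r1 / 2 by rewrite -ler_pdivlMr// ge_min lexx orbT.
have r2r : r2 <= r by rewrite ge_min lexx.
have r2r1 : r2 <= r1 / 2 by rewrite (le_trans _ r2B)// ler_peMr// ltW.
exists r2 => // x t xr tr; rewrite !big_cons.
set s := \sum_(j <- l) t j *: b j.
have sr : `|s| <= r1 / 2.
  rewrite (le_trans (ler_norm_sum _ _ _))// (le_trans _ r2B)//.
  rewrite (@le_trans _ _ (r2 * \sum_(j <- l) `|b j|))//.
    rewrite mulr_sumr ler_sum// => j _; rewrite normrZ ler_wpM2r//.
    by rewrite ltW.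
  by rewrite ler_wpM2l ?ltW// ltrDr.
have -> : f (x + (t i *: b i + s)) - f x -
    (t i * 'D_(b i) f x0 + \sum_(j <- l) t j * 'D_(b j) f x0) =
  (f (x + s + t i *: b i) - f (x + s) - t i * 'D_(b i) f x0) +
  (f (x + s) - f x - \sum_(j <- l) t j * 'D_(b j) f x0).
  by rewrite [t i *: _ + s]addrC addrA; ring.
rewrite mulrDr (le_trans (ler_normD _ _))// lerD//.
  apply: dir; last by rewrite (lt_le_trans (tr i))// (le_trans r2r1)//; lra.
  rewrite addrAC (le_lt_trans (ler_normD _ _))//.
  by rewrite [r1]splitr ltr_leD// (lt_le_trans xr).
by apply: IH => [|j]; apply: lt_le_trans r2r.
Qed.

(* Both mixed derivatives are limits of the same second difference quotient. *)
Lemma C2_mixed_derivative (D : set V) (f : V -> R) (x v w : V) :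
  open D -> C2_on D f -> D x -> 'D_v ('D_w f) x = 'D_w ('D_v f) x.
Proof.
move=> oD [fC1 fC2] Dx; apply/eqP; rewrite -subr_eq0.
have quot (a b : V) (e : R) : 0 < e -> exists2 r, 0 < r & forall h, 0 < h < r ->
    `|f (x + h *: a + h *: b) - f (x + h *: a) - f (x + h *: b) + f x
      - h * h * 'D_a ('D_b f) x| <= e * h * h.
  move=> e0; have [r r0 rP] := C1_strict_dir a oD (fC2 b) Dx e0.
  have [r1 r10 rD] := C1_on_near 0 oD fC1 Dx e0.
  pose K := 1 + `|a| + `|b|.
  have K1 : 1 <= K by rewrite /K -addrA lerDl addr_ge0.
  have K0 : 0 < K by rewrite (lt_le_trans _ K1).
  exists (Num.min r r1 / K); first by rewrite divr_gt0// lt_min r0.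
  move=> h /andP[h0]; rewrite ltr_pdivlMr// lt_min => /andP[hr hr1].
  have smallb s : 0 <= s <= h -> `|s *: b| <= h * `|b|.
    by move=> /andP[s0 sh]; rewrite normrZ ger0_norm// ler_wpM2r.
  have a0 : 0 <= `|a| by []. have b0 : 0 <= `|b| by [].
  have small s : 0 <= s <= h -> `|x + s *: b - x| < r /\ D (x + s *: b)
      /\ D (x + h *: a + s *: b).
    move=> sh; have sb := smallb s sh.
    have hK : h * K = h + h * `|a| + h * `|b| by rewrite /K; ring.
    have ha : 0 <= h * `|a| by rewrite mulr_ge0// ltW.
    have xK u : x + u - x = u by rewrite addrC addKr.
    split; first by rewrite xK; lra.
    split; first by apply: (rD _ _).1; rewrite xK; lra.
    apply: (rD _ _).1; rewrite -[x + _ + _]addrA xK.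
    rewrite (le_lt_trans (ler_normD _ _))// normrZ gtr0_norm//; lra.
  (* The second difference is an increment in s of f(x + h a + s b) - f(x + s b), whose derivative
     in s is the increment of ['D_b f] by h a; the strict expansion of ['D_b f] controls it. *)
  have := @mean_value_bound
    (fun s => (f (x + h *: a + s *: b) - f (x + s *: b)) - s * (h * 'D_a ('D_b f) x))
    (fun s => ('D_b f (x + h *: a + s *: b) - 'D_b f (x + s *: b)) - h * 'D_a ('D_b f) x)
    0 h (e * h) (ltW h0).
  rewrite !scale0r !addr0 mul0r !subr0.
  have -> : f (x + h *: a + h *: b) - f (x + h *: b) - h * (h * 'D_a ('D_b f) x) -
     (f (x + h *: a) - f x) = f (x + h *: a + h *: b) - f (x + h *: a) - f (x + h *: b)
     + f x - h * h * 'D_a ('D_b f) x by ring.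
  apply.
  - move=> s sh; have [_ [D1 D2]] := small s sh.
    have ? := @is_derive_line f (x + h *: a) b s ((fC1 b).1 _ D2).
    have ? := @is_derive_line f x b s ((fC1 b).1 _ D1).
    apply: is_deriveB; apply: is_derive_eq.
    by rewrite [_ *: _]mulr0 add0r [_ *: _]mulr1.
  - move=> s sh; have [h1 _] := small s sh.
    rewrite [x + h *: a + _]addrAC.
    have := rP _ h h1; rewrite gtr0_norm// => -> //.
    by rewrite (le_lt_trans _ hr)// ler_peMr// ltW.
rewrite -normr_le0; apply/ler_addgt0Pl => e e0.
have e20 : 0 < e / 2 by rewrite divr_gt0.
have [r r0 rP] := quot v w _ e20; have [r1 r10 rP1] := quot w v _ e20.
pose h := Num.min r r1 / 2.
have h0 : 0 < h by rewrite divr_gt0// lt_min r0.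
have mr : Num.min r r1 <= r by rewrite ge_min lexx.
have mr1 : Num.min r r1 <= r1 by rewrite ge_min lexx orbT.
have h2 : h * 2 = Num.min r r1 by rewrite divfK.
have hr : 0 < h < r by rewrite h0/=; lra.
have hr1 : 0 < h < r1 by rewrite h0/=; lra.
have := rP1 _ hr1; have := rP _ hr.
rewrite [x + h *: w + _]addrAC ['D_w ('D_v f) x]lock.
move=> H1; have -> : f (x + h *: v + h *: w) - f (x + h *: w) - f (x + h *: v) + f x =
  f (x + h *: v + h *: w) - f (x + h *: v) - f (x + h *: w) + f x by ring.
move: H1; set Dl := f _ - f _ - f _ + f _; set a := 'D_v _ _; set b := locked _.
rewrite !ler_norml => /andP[p1 p2] /andP[p3 p4].
have hh : 0 < h * h by rewrite mulr_gt0.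
by apply/andP; split; rewrite -(ler_pM2l hh); lra.
Qed.

End StrictDifferentiability.

(** * Row vectors, quadratic forms and points (x, y, z) *)

Section DotProduct.
Context {R : realType} {n : nat}.
Implicit Types (u v w : 'rV[R]_n) (A B : 'M[R]_n) (a : R).

Lemma dotE v w : dot v w = \sum_i v 0 i * w 0 i.
Proof. by rewrite /dot mxE; apply: eq_bigr => i _; rewrite mxE. Qed.

Lemma dotC v w : dot v w = dot w v.
Proof. by rewrite !dotE; apply: eq_bigr => i _; rewrite mulrC. Qed.

Lemma dotDl u v w : dot (u + v) w = dot u w + dot v w.
Proof. by rewrite /dot mulmxDl mxE. Qed.

Lemma dotZl a v w : dot (a *: v) w = a * dot v w.
Proof. by rewrite /dot -scalemxAl mxE. Qed.

Lemma dotNl v w : dot (- v) w = - dot v w.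
Proof. by rewrite /dot mulNmx mxE. Qed.

Lemma dotDr u v w : dot u (v + w) = dot u v + dot u w.
Proof. by rewrite dotC dotDl !(dotC u). Qed.

Lemma dotZr a v w : dot v (a *: w) = a * dot v w.
Proof. by rewrite dotC dotZl (dotC v). Qed.

Lemma dotNr v w : dot v (- w) = - dot v w.
Proof. by rewrite dotC dotNl (dotC v). Qed.

Lemma dotBl u v w : dot (u - v) w = dot u w - dot v w.
Proof. by rewrite dotDl dotNl. Qed.

Lemma dotBr u v w : dot u (v - w) = dot u v - dot u w.
Proof. by rewrite dotDr dotNr. Qed.

Lemma dot0l v : dot 0 v = 0.
Proof. by rewrite /dot mul0mx mxE. Qed.

Lemma dot_trmx v A w : dot (v *m A^T) w = dot (w *m A) v.
Proof.
rewrite /dot; have -> : v *m A^T *m w^T = (w *m A *m v^T)^T.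
  by rewrite !trmx_mul trmxK mulmxA.
by rewrite mxE.
Qed.

Lemma mulmx_outer u v w : v *m (w^T *m u) = dot v w *: u.
Proof.
rewrite mulmxA; apply/rowP => i; rewrite [RHS]mxE mxE big_ord_recl big_ord0 addr0.
by congr (_ * _); rewrite /dot.
Qed.

Lemma row_coordD v w i : (v + w) 0 i = v 0 i + w 0 i.
Proof. by rewrite mxE. Qed.

Lemma row_coordB v w i : (v - w) 0 i = v 0 i - w 0 i.
Proof. by rewrite !mxE. Qed.

Lemma row_coordN v i : (- v) 0 i = - v 0 i.
Proof. by rewrite mxE. Qed.

Lemma row_coordZ a v i : (a *: v) 0 i = a * v 0 i.
Proof. by rewrite mxE. Qed.

Lemma coord_le_norm v (i : 'I_n) : `|v 0 i| <= `|v|.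
Proof.
rewrite [`|v|]mx_normrE.
exact: (le_bigmax _ (fun ij : 'I_1 * 'I_n => `|v ij.1 ij.2|) (0, i)).
Qed.

Lemma norm_le_coord v a : 0 <= a -> (forall i, `|v 0 i| <= a) -> `|v| <= a.
Proof.
move=> a0 va; rewrite [`|v|]mx_normrE; apply: bigmax_le => // -[i j] _ /=.
by rewrite (ord1 i).
Qed.

Lemma dot_le v w : `|dot v w| <= n%:R * (`|v| * `|w|).
Proof.
rewrite dotE (le_trans (ler_norm_sum _ _ _))//.
rewrite (@le_trans _ _ (\sum_(i < n) `|v| * `|w|))//.
  by apply: ler_sum => i _; rewrite normrM ler_pM// coord_le_norm.
by rewrite sumr_const card_ord mulr_natl.
Qed.

Lemma dot_gt0 v : v != 0 -> 0 < dot v v.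
Proof.
move=> v0; rewrite dotE lt_neqAle; apply/andP; split; last first.
  by apply: sumr_ge0 => i _; rewrite -expr2 sqr_ge0.
apply: contra v0; rewrite eq_sym psumr_eq0; last first.
  by move=> i _; rewrite -expr2 sqr_ge0.
move=> /allP h; apply/eqP/rowP => i; rewrite mxE; apply/eqP.
by have := h i (mem_index_enum i); rewrite mulf_eq0 orbb.
Qed.

Lemma mulmx_entries_le v A a : 0 <= a -> (forall i j, `|A i j| <= a) ->
  `|v *m A| <= n%:R * (`|v| * a).
Proof.
move=> a0 Aa; apply: norm_le_coord => [|j].
  by rewrite mulr_ge0 ?ler0n ?mulr_ge0.
rewrite mxE (le_trans (ler_norm_sum _ _ _))//.
rewrite (@le_trans _ _ (\sum_(i < n) `|v| * a))//.
  by apply: ler_sum => i _; rewrite normrM ler_pM// coord_le_norm.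
by rewrite sumr_const card_ord mulr_natl.
Qed.

Lemma mulmx_bounded A : exists2 K, 0 < K & forall v, `|v *m A| <= K * `|v|.
Proof.
pose a : R := \sum_i \sum_j `|A i j|.
have a0 : 0 <= a by apply: sumr_ge0 => i _; apply: sumr_ge0.
exists (1 + n%:R * a); first by rewrite ltr_wpDr// mulr_ge0// ler0n.
move=> v; rewrite (le_trans (@mulmx_entries_le v A a a0 _))//.
  move=> i j; rewrite /a (bigD1 i)//= (bigD1 j)//= -addrA lerDl.
  by rewrite addr_ge0// sumr_ge0// => k _; rewrite sumr_ge0.
by rewrite mulrDl mul1r [`|v| * a]mulrC mulrA lerDr.
Qed.

Definition qform A v : R := dot (v *m A) v.

Lemma qformE A v : qform A v = dot (v *m A) v.
Proof. by []. Qed.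

Lemma qformB A B v : qform (A - B) v = qform A v - qform B v.
Proof. by rewrite /qform mulmxBr dotDl dotNl. Qed.

Lemma qformZ A a v : qform A (a *: v) = a * a * qform A v.
Proof. by rewrite /qform -scalemxAl dotZl dotZr mulrA. Qed.

Lemma qform_entries_le A a v : 0 <= a -> (forall i j, `|A i j| <= a) ->
  `|qform A v| <= n%:R * n%:R * a * `|v| ^+ 2.
Proof.
move=> a0 Aa; rewrite (le_trans (dot_le _ _))// expr2 !mulrA.
rewrite ler_wpM2r// -!mulrA ler_wpM2l ?ler0n//.
by rewrite (le_trans (mulmx_entries_le v a0 Aa))// ler_wpM2l ?ler0n// mulrC.
Qed.

Lemma qform_sub_le A B a v : 0 <= a -> (forall i j, `|(A - B) i j| <= a) ->
  `|qform A v - qform B v| <= n%:R * n%:R * a * `|v| ^+ 2.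
Proof. by move=> a0 Aa; rewrite -qformB; exact: qform_entries_le. Qed.

Lemma qform_bounded A : exists2 b, 0 < b &
  forall v w, `|qform A (v + w) - qform A v| <= b * (`|v| + `|w|) * `|w|.
Proof.
have [K K0 KP] := mulmx_bounded A.
exists (1 + 2 * (n%:R * K)); first by rewrite ltr_pwDl// !mulr_ge0 ?ler0n// ltW.
move=> v w; rewrite /qform.
have -> : dot ((v + w) *m A) (v + w) - dot (v *m A) v =
    dot (w *m A) (v + w) + dot (v *m A) w.
  by rewrite mulmxDl dotDl dotDr; ring.
have n0 : 0 <= n%:R :> R by [].
have v0 : 0 <= `|v| by []. have w0 : 0 <= `|w| by [].
have h1 : `|dot (w *m A) (v + w)| <= n%:R * (K * `|w| * (`|v| + `|w|)).
  rewrite (le_trans (dot_le _ _))// ler_wpM2l// ler_pM// ler_normD//.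
have h2 : `|dot (v *m A) w| <= n%:R * (K * `|v| * `|w|).
  by rewrite (le_trans (dot_le _ _))// ler_wpM2l// ler_pM.
rewrite (le_trans (ler_normD _ _))//.
have h3 : 0 <= (`|v| + `|w|) * `|w| by rewrite mulr_ge0// addr_ge0.
have h4 : 0 <= n%:R * K * (`|w| * `|w|) by rewrite !mulr_ge0// ltW.
lra.
Qed.

End DotProduct.

Ltac row_ring :=
  apply/rowP => ?; rewrite !(row_coordD, row_coordN, row_coordZ); ring.

Lemma uniform_radius {R : realType} (n : nat) (P : 'I_n -> R -> Prop) :
  (forall i, exists2 r, 0 < r & P i r) ->
  (forall i r r', r' <= r -> P i r -> P i r') ->
  exists2 r, 0 < r & forall i, P i r.
Proof.
move=> ex mono.
have [rr rrP] := choice (fun i => let: ex_intro2 r r0 rP := ex i in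
  ex_intro (fun r => 0 < r /\ P i r) r (conj r0 rP)).
exists (\big[Num.min/1]_i rr i).
  by elim/big_ind: _ => // [a b a0 b0|i _]; [rewrite lt_min a0 | case: (rrP i)].
move=> i; apply: mono (rrP i).2; exact: bigmin_le_cond.
Qed.

Section Points.
Context {R : realType} {n : nat}.
Local Notation point := ('rV[R]_n * 'rV[R]_n * R)%type.
Implicit Types (G : set point) (f : point -> R) (w d : point).

Definition linear_part f w d : R :=
  dot d.1.1 (g_x f w) + dot d.1.2 (g_y f w) + d.2 * g_z f w.

Lemma linear_partZ f w a d : linear_part f w (a *: d) = a * linear_part f w d.
Proof.
case: d => [[x y] z]; rewrite /linear_part -[_ *: _]/(a *: x, a *: y, a * z) /=.
by rewrite !dotZl !mulrDr mulrA.
Qed.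

Lemma normx_le d : `|d.1.1| <= `|d|.
Proof. by rewrite !prod_normE !le_max lexx. Qed.

Lemma normy_le d : `|d.1.2| <= `|d|.
Proof. by rewrite !prod_normE !le_max lexx orbT. Qed.

Lemma normz_le d : `|d.2| <= `|d|.
Proof. by rewrite !prod_normE !le_max lexx orbT. Qed.

Lemma normB_x (a b y : 'rV[R]_n) (z : R) :
  `|((a, y, z) : point) - (b, y, z)| = `|a - b|.
Proof.
rewrite -[(_, _, _) - _]/(a - b, y - y, z - z) !subrr !prod_normE/= !normr0.
by rewrite (max_l (normr_ge0 _)) max_l.
Qed.

Lemma linear_part_bounded f w :
  exists2 C, 0 < C & forall d, `|linear_part f w d| <= C * `|d|.
Proof.
exists (1 + n%:R * `|g_x f w| + n%:R * `|g_y f w| + `|g_z f w|).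
  by rewrite -!addrA ltr_wpDr// !addr_ge0// mulr_ge0.
move=> d; rewrite /linear_part !mulrDl mul1r -[leLHS]add0r -!addrA lerD//.
rewrite (le_trans (ler_normD _ _))// lerD//.
  rewrite (le_trans (dot_le _ _))// mulrAC -mulrA.
  by rewrite ler_wpM2l ?ler0n// ler_wpM2r// normx_le.
rewrite (le_trans (ler_normD _ _))// lerD//.
  rewrite (le_trans (dot_le _ _))// mulrAC -mulrA.
  by rewrite ler_wpM2l ?ler0n// ler_wpM2r// normy_le.
by rewrite normrM mulrC ler_wpM2l// normz_le.
Qed.

Lemma point_lineE (x y : 'rV[R]_n) (z : R) : (x, y, 0) + z *: dirz = (x, y, z) :> point.
Proof.
rewrite -[LHS]/(_, _, _) /= !scaler0 !addr0 add0r.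
by rewrite -[z *: 1]/(z * 1) mulr1.
Qed.

Lemma grad_slice (g : point -> R) x y z :
  grad (fun x => g (x, y, z)) x = g_x g (x, y, z).
Proof.
apply/rowP => i; rewrite !mxE /derive.
congr (lim (_ @[h --> 0^'])%classic); apply/funext => h /=.
by rewrite -[h *: dirx i + _]/(h *: _ + x, h *: 0 + y, h *: 0 + z) !scaler0 !add0r.
Qed.

Lemma sum_dirx (v : 'rV[R]_n) : \sum_i v 0 i *: dirx i = (v, 0, 0) :> point.
Proof.
rewrite [in RHS](row_sum_delta v).
rewrite (@big_morph _ _ (fun v => (v, 0, 0) : point) 0 +%R)//; last first.
  by move=> x y; rewrite -[RHS]/(_, _, _) !addr0.
apply: eq_bigr => i _; rewrite /dirx -[LHS]/(_, _, _).
by rewrite !scaler0.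
Qed.

Lemma sum_diry (v : 'rV[R]_n) : \sum_i v 0 i *: diry i = (0, v, 0) :> point.
Proof.
rewrite [in RHS](row_sum_delta v).
rewrite (@big_morph _ _ (fun v => (0, v, 0) : point) 0 +%R)//; last first.
  by move=> x y; rewrite -[RHS]/(_, _, _) !addr0.
apply: eq_bigr => i _; rewrite /diry -[LHS]/(_, _, _).
by rewrite !scaler0.
Qed.

Lemma point_norm_lt d (r : R) :
  `|d.1.1| < r -> `|d.1.2| < r -> `|d.2| < r -> `|d| < r.
Proof. by rewrite !prod_normE !gt_max => -> -> ->. Qed.

Lemma point_norm_le d (r : R) :
  `|d.1.1| <= r -> `|d.1.2| <= r -> `|d.2| <= r -> `|d| <= r.
Proof. by rewrite !prod_normE !ge_max => -> -> ->. Qed.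

(** [C1_on] speaks of one direction at a time; summing over the 2n + 1 coordinate directions, with e
    shared among them, gives strict differentiability in the full sense. *)
Lemma C1_strict G f w0 (e : R) : open G -> C1_on G f -> G w0 -> 0 < e ->
  exists2 r, 0 < r & forall w w', `|w - w0| < r -> `|w' - w0| < r ->
    `|f w' - f w - linear_part f w0 (w' - w)| <= e * `|w' - w|.
Proof.
move=> oG fC1 Gw0 e0.
pose b (k : 'I_n + 'I_n + unit) : point :=
  match k with inl (inl i) => dirx i | inl (inr i) => diry i | inr _ => dirz end.
pose coord d (k : 'I_n + 'I_n + unit) : R :=
  match k with inl (inl i) => d.1.1 0 i | inl (inr i) => d.1.2 0 i | inr _ => d.2 end.
pose l : seq ('I_n + 'I_n + unit) := [seq inl (inl i) | i <- index_enum 'I_n] ++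
  ([seq inl (inr i) | i <- index_enum 'I_n] ++ [:: inr tt]).
have dec d : \sum_(k <- l) coord d k *: b k = d.
  rewrite /l !big_cat !big_map big_seq1 /= sum_dirx sum_diry.
  case: d => [[x y] z] /=; rewrite -[LHS]/(_, _, _) /= !scaler0 !addr0 !add0r.
  by rewrite -[z *: 1]/(z * 1) mulr1.
have lin d : \sum_(k <- l) coord d k * 'D_(b k) f w0 = linear_part f w0 d.
  rewrite /l !big_cat !big_map big_seq1 /= addrA /linear_part !dotE.
  by congr (_ + _ + _); apply: eq_bigr => i _; rewrite mxE.
have cd d k : `|coord d k| <= `|d|.
  case: k => [[i|i]|[]] /=; last exact: normz_le.
    by rewrite (le_trans (coord_le_norm _ _))// normx_le.
  by rewrite (le_trans (coord_le_norm _ _))// normy_le.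
pose N : R := 1 + (size l)%:R.
have N0 : 0 < N by rewrite ltr_wpDr// ler0n.
have [r r0 rP] := C1_strict_sum b l oG fC1 Gw0 (divr_gt0 e0 N0).
exists (r / 2); first by rewrite divr_gt0.
move=> w w' wr wr'.
have dr : `|w' - w| < r.
  rewrite (_ : w' - w = (w' - w0) - (w - w0)); last by rewrite opprB addrA subrK.
  by rewrite (le_lt_trans (ler_normB _ _))// [r]splitr ltrD.
have ww : w + (w' - w) = w' by rewrite addrC subrK.
have := rP w (coord (w' - w)); rewrite dec lin ww => h.
rewrite (le_trans (h _ _))//.
- by rewrite (lt_trans wr)//; lra.
- by move=> k; rewrite (le_lt_trans (cd _ _)).
rewrite (@le_trans _ _ (e / N * (`|w' - w| * N)))//; last first.
  by rewrite [_ * N]mulrC mulrA divfK ?gt_eqF.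
rewrite ler_wpM2l//; first by rewrite divr_ge0// ltW.
rewrite (@le_trans _ _ (\sum_(k <- l) `|w' - w|))//; first exact: ler_sum.
rewrite big_const_seq count_predT iter_addr addr0 -mulr_natr.
by rewrite ler_wpM2l// lerDr.
Qed.

(** Linearity in [v] is not part of [C1_on]. It follows by comparing, on a common small step t v,
    the full strict expansion with the one in the single direction [v]. *)
Lemma derive_linear_part G f w v : open G -> C1_on G f -> G w ->
  'D_v f w = linear_part f w v.
Proof.
move=> oG fC1 Gw; apply/eqP; rewrite -subr_eq0 -normr_le0.
apply/ler_addgt0Pl => e e0; rewrite addr0.
have v1 : 0 < 2 * (1 + `|v|) by rewrite mulr_gt0// ltr_wpDr.
have v0 : 0 <= `|v| by [].
have [r r0 rP] := C1_strict oG fC1 Gw (divr_gt0 e0 v1).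
have [r1 r10 rP1] := C1_strict_dir v oG fC1 Gw (divr_gt0 e0 (ltr0Sn _ 1)).
pose t := Num.min (r1 / 2) (r / (2 * (1 + `|v|))).
have t0 : 0 < t by rewrite lt_min !divr_gt0.
have tr1 : t <= r1 / 2 by rewrite ge_min lexx.
have tr : t * (2 * (1 + `|v|)) <= r by rewrite -ler_pdivlMr// ge_min lexx orbT.
have wv : w + t *: v - w = t *: v by rewrite addrC addKr.
have tv0 : 0 <= t * `|v| by rewrite mulr_ge0// ltW.
have tx : t * `|v| + t = t * (1 + `|v|) by ring.
have := rP w (w + t *: v); rewrite subrr normr0 wv normrZ (gtr0_norm t0) linear_partZ.
move=> /(_ r0)/(_ _)/[!ler_norml] h1.
have {h1}/andP[h1 h2] := h1 ltac:(lra).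
have := rP1 w t; rewrite subrr normr0 (gtr0_norm t0) ler_norml.
move=> /(_ r10 ltac:(lra)) /andP[h3 h4].
have et : e / (2 * (1 + `|v|)) * (t * `|v|) <= e / 2 * t.
  have -> : e / 2 * t = e / (2 * (1 + `|v|)) * (t * (1 + `|v|)).
    by field; rewrite gt_eqF// ltr_wpDr.
  by rewrite ler_wpM2l//; [rewrite divr_ge0// ltW | lra].
by apply/andP; split; rewrite -(ler_pM2l t0); lra.
Qed.

End Points.

(* Otherwise unification compares distinct directions by computing with the
   underlying matrices. *)
Local Opaque dirx diry dirz dot qform.

(** * Expansions of the generating function *)

Section GeneratingFunction.
Context {R : realType} {n : nat}.
Local Notation point := ('rV[R]_n * 'rV[R]_n * R)%type.
Context (Gamma : set point) (g : point -> R).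
Hypothesis Gamma_open : open Gamma.
Hypothesis g_C2 : C2_on Gamma g.
Implicit Types (w d : point) (x y p : 'rV[R]_n) (z a e : R).

Lemma g_strict w0 e : Gamma w0 -> 0 < e ->
  exists2 r, 0 < r & forall w w', `|w - w0| < r -> `|w' - w0| < r ->
    `|g w' - g w - linear_part g w0 (w' - w)| <= e * `|w' - w|.
Proof. by move=> Gw; apply: C1_strict Gamma_open g_C2.1 Gw. Qed.

Definition gx_linear_part w d : 'rV[R]_n :=
  d.1.1 *m g_xx g w + d.1.2 *m (g_xy g w)^T + d.2 *: g_xz g w.

(** [g_xy] and [g_xz] differentiate in x last, whereas the differential of ['D_(dirx j) g]
    differentiates in y and z last: the symmetry of second derivatives reconciles the two. *)
Lemma linear_part_dirx w d (j : 'I_n) : Gamma w ->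
  linear_part ('D_(dirx j) g) w d = gx_linear_part w d 0 j.
Proof.
move=> Gw; rewrite /linear_part /gx_linear_part 3!mxE !dotE ![(_ *m _) _ _]mxE.
congr (_ + _ + _).
- by apply: eq_bigr => i _; rewrite [g_x _ _ _ _]mxE [g_xx _ _ _ _]mxE.
- apply: eq_bigr => i _; rewrite [g_y _ _ _ _]mxE [_^T _ _]mxE [g_xy _ _ _ _]mxE.
  exact: (congr1 ( *%R (d.1.2 0 i)) (C2_mixed_derivative _ _ Gamma_open g_C2 Gw)).
- rewrite row_coordZ [g_xz _ _ _ _]mxE /g_z.
  exact: (congr1 ( *%R d.2) (C2_mixed_derivative _ _ Gamma_open g_C2 Gw)).
Qed.

Lemma gx_strict w0 e : Gamma w0 -> 0 < e ->
  exists2 r, 0 < r & forall w w', `|w - w0| < r -> `|w' - w0| < r ->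
    `|g_x g w' - g_x g w - gx_linear_part w0 (w' - w)| <= e * `|w' - w|.
Proof.
move=> Gw e0.
have [i|i r r' rr' h w w' wr wr'|r r0 rP] := @uniform_radius R n
    (fun j r => forall w w', `|w - w0| < r -> `|w' - w0| < r ->
      `|'D_(dirx j) g w' - 'D_(dirx j) g w - linear_part ('D_(dirx j) g) w0 (w' - w)|
       <= e * `|w' - w|).
- exact: C1_strict Gamma_open (g_C2.2 _) Gw e0.
- by apply: h; apply: lt_le_trans rr'.
exists r => // w w' wr wr'; apply: norm_le_coord => [|i].
  by rewrite mulr_ge0// ltW.
have := rP i w w' wr wr'; rewrite linear_part_dirx//.
by rewrite !row_coordB ![g_x _ _ _ _]mxE.
Qed.

Lemma Gamma_near w0 : Gamma w0 ->
  exists2 r, 0 < r & forall w, `|w - w0| < r -> Gamma w.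
Proof.
move=> Gw; have [r r0 rP] := C1_on_near 0 Gamma_open g_C2.1 Gw ltr01.
by exists r => // w /rP[].
Qed.

Lemma gxx_near w0 e : Gamma w0 -> 0 < e ->
  exists2 r, 0 < r & forall w, `|w - w0| < r ->
    forall i j, `|(g_xx g w - g_xx g w0) i j| <= e.
Proof.
move=> Gw e0.
have [i|i r r' rr' h w wr j|r r0 rP] := @uniform_radius R n
    (fun i r => forall w, `|w - w0| < r -> forall j, `|(g_xx g w - g_xx g w0) i j| <= e).
- have [j|j r r' rr' h w wr|r r0 rP] := @uniform_radius R n
    (fun j r => forall w, `|w - w0| < r -> `|(g_xx g w - g_xx g w0) i j| <= e).
  + have [r r0 rP] := C1_on_near (dirx i) Gamma_open (g_C2.2 (dirx j)) Gw e0.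
    by exists r => // w wr; have [_ /ltW] := rP w wr; rewrite !mxE.
  + by apply: h; apply: lt_le_trans rr'.
  + by exists r => // w wr j; apply: rP.
- by apply: h; apply: lt_le_trans rr'.
- by exists r => // w wr i j; apply: rP.
Qed.

(** The remainder along x + s v has as derivative in s the product of v with the increment of [g_x]
    minus its linear part, which is small by strict differentiability. Dividing e by 1 + n pays for
    the factor n in [dot_le]. *)
Lemma taylor_x x y z e : Gamma (x, y, z) -> 0 < e ->
  exists2 r, 0 < r & forall v : 'rV[R]_n, `|v| < r ->
    `|g (x + v, y, z) - g (x, y, z) - dot v (g_x g (x, y, z))
      - qform (g_xx g (x, y, z)) v / 2| <= e * `|v| ^+ 2.
Proof.
move=> Gw e0; set w := (x, y, z).
have N0 : 0 < 1 + n%:R :> R by rewrite ltr_wpDr// ler0n.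
have [r r0 rP] := gx_strict Gw (divr_gt0 e0 N0).
have [r1 r10 rG] := Gamma_near Gw.
exists (Num.min r r1); first by rewrite lt_min r0.
move=> v; rewrite lt_min => /andP[dr dr1].
pose ws (s : R) : point := w + s *: ((v, 0, 0) : point).
have wsE s : ws s = (x + s *: v, y, z).
  by rewrite /ws -[LHS]/(_, _, _) /= !scaler0 !addr0.
have wsB s : ws s - w = (s *: v, 0, 0).
  by rewrite /ws addrC addKr -[LHS]/(_, _, _) !scaler0.
have nws s : 0 <= s <= 1 -> `|ws s - w| <= `|v|.
  move=> /andP[s0 s1]; rewrite wsB; apply: point_norm_le => //=; rewrite ?normr0//.
  by rewrite normrZ ger0_norm// ler_piMl.
have := @mean_value_bound R
  (fun s => g (ws s) - (s * dot v (g_x g w) + s * s * (qform (g_xx g w) v / 2)))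
  (fun s => dot v (g_x g (ws s) - g_x g w - gx_linear_part w (ws s - w)))
  0 1 (e * `|v| ^+ 2) ler01.
rewrite !wsE !scale1r !scale0r !addr0 !mul1r !mul0r !addr0 !subr0 mulr1 opprD !addrA.
rewrite [_ - _ - g (x, y, z)]addrAC [_ - _ - g (x, y, z)]addrAC; apply.
- move=> s s01.
  have Gs : Gamma (ws s) by apply: rG; rewrite (le_lt_trans (nws s s01)).
  have Hd := @is_derive_line R _ g w (v, 0, 0) s ((g_C2.1 _).1 _ Gs).
  have dE : 'D_(v, 0, 0) g (ws s) = dot v (g_x g (ws s)).
    rewrite (derive_linear_part _ Gamma_open g_C2.1 Gs) /linear_part /=.
    by rewrite dot0l mul0r !addr0.
  have {}Hd : is_derive s (1 : R) (fun t => g (ws t)) (dot v (g_x g (ws s))).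
    by rewrite -dE.
  have Hq := is_derive_quadratic s (dot v (g_x g w)) (qform (g_xx g w) v / 2).
  apply: (is_derive_eq (is_deriveB Hd Hq)).
  have -> : gx_linear_part w (ws s - w) = s *: (v *m g_xx g w).
    by rewrite wsB /gx_linear_part /= mul0mx scale0r !addr0 -scalemxAl.
  by rewrite !dotBr dotZr [dot v (v *m _)]dotC -qformE; field.
- move=> s s01; rewrite (le_trans (dot_le _ _))//.
  have ws0 : `|w - w| < r by rewrite subrr normr0.
  have := rP w (ws s) ws0 (le_lt_trans (nws s s01) dr).
  move=> /le_trans/(_ (ler_wpM2l _ (nws s s01))) h.
  rewrite (@le_trans _ _ (n%:R * (`|v| * (e / (1 + n%:R) * `|v|))))//.
    rewrite ler_wpM2l ?ler0n// ler_wpM2l// h// divr_ge0//.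
    exact: ltW.
  have -> : n%:R * (`|v| * (e / (1 + n%:R) * `|v|)) =
      (n%:R / (1 + n%:R)) * (e * `|v| ^+ 2).
    by field; rewrite gt_eqF.
  rewrite ler_piMl ?mulr_ge0 ?exprn_ge0// ?(ltW e0)//.
  by rewrite ler_pdivrMr// mul1r lerDr.
Qed.
Lemma taylor_x_sub x ya za yb zb e : Gamma (x, ya, za) -> Gamma (x, yb, zb) -> 0 < e ->
  exists2 r, 0 < r & forall v : 'rV[R]_n, `|v| < r ->
    `|g (x + v, ya, za) - g (x + v, yb, zb) - (g (x, ya, za) - g (x, yb, zb))
      - dot v (g_x g (x, ya, za) - g_x g (x, yb, zb))
      - qform (g_xx g (x, ya, za) - g_xx g (x, yb, zb)) v / 2| <= e * `|v| ^+ 2.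
Proof.
move=> Ga Gb e0; have e20 : 0 < e / 2 by rewrite divr_gt0.
have [r r0 rP] := taylor_x Ga e20; have [r1 r10 rP1] := taylor_x Gb e20.
exists (Num.min r r1); first by rewrite lt_min r0.
move=> v; rewrite lt_min => /andP[vr vr1].
have arith (a1 a0 ga ha b1 b0 gb hb c : R) : `|a1 - a0 - ga - ha / 2| <= c / 2 ->
    `|b1 - b0 - gb - hb / 2| <= c / 2 ->
    `|a1 - b1 - (a0 - b0) - (ga - gb) - (ha - hb) / 2| <= c.
  by rewrite !ler_norml => /andP[h1 h2] /andP[h3 h4]; apply/andP; split; lra.
have := rP v vr; rewrite [e / 2 * _]mulrAC => ha.
have := rP1 v vr1; rewrite [e / 2 * _]mulrAC => hb.
by rewrite qformB dotBr; exact: (arith _ _ _ _ _ _ _ _ _ ha hb).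
Qed.

End GeneratingFunction.

(** * Contraction and touching arguments *)

Section Contraction.
Context {R : realType}.

Lemma lipschitz_at_continuous (V W : normedModType R) (f : V -> W) (v : V) (r C : R) :
  0 < r -> 0 < C -> (forall v', `|v' - v| < r -> `|f v' - f v| <= C * `|v' - v|) ->
  {for v, continuous f}.
Proof.
move=> r0 C0 rP; apply/cvgrPdist_lt => e e0; near=> v'.
have vr : `|v - v'| < r by near: v'; apply: cvgr_dist_lt => //; exact: cvg_id.
rewrite distrC (le_lt_trans (rP v' _))// 1?distrC//.
rewrite mulrC -ltr_pdivlMr//; near: v'.
by apply: cvgr_dist_lt; rewrite ?divr_gt0//; exact: cvg_id.
Unshelve. all: by end_near.
Qed.

Lemma lipschitz_within_continuous (V W : normedModType R) (K : set V)
    (f : V -> W) (C : R) :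
  (forall v v', K v -> K v' -> `|f v - f v'| <= C * `|v - v'|) ->
  {within K, continuous f}.
Proof.
move=> fL; apply/subspace_continuousP => v Kv.
apply/cvgrPdist_lt => e e0.
have C0 : 0 < 1 + `|C| by rewrite ltr_wpDr.
rewrite near_withinE; near=> v' => Kv'.
rewrite (le_lt_trans (fL v v' Kv Kv'))//.
rewrite (@le_lt_trans _ _ ((1 + `|C|) * `|v - v'|))//.
  by rewrite ler_wpM2r// (le_trans (ler_norm C))// lerDr.
rewrite mulrC -ltr_pdivlMr//; near: v'.
by apply: cvgr_dist_lt; rewrite ?divr_gt0//; exact: cvg_id.
Unshelve. all: by end_near.
Qed.

Lemma closed_ball_rV_compact m (v0 : 'rV[R]_m) (r : R) : compact [set v | `|v - v0| <= r].
Proof.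
have [r0|r0] := leP 0 r; last first.
  rewrite (_ : [set _ | _] = set0); first exact: compact0.
  by apply/seteqP; split=> // v /=; rewrite leNgt (lt_le_trans r0).
have -> : [set v : 'rV[R]_m | `|v - v0| <= r] =
    [set v | forall i, `[v0 ord0 i - r, v0 ord0 i + r]%classic (v ord0 i)].
  apply/seteqP; split=> v /=.
    move=> vr i; have := le_trans (coord_le_norm (v - v0) i) vr.
    by rewrite row_coordB in_itv/= ler_distl.
  move=> h; apply: norm_le_coord => // i; have := h i.
  by rewrite row_coordB in_itv/= ler_distl.
apply: (@rV_compact _ _ (fun i => `[v0 ord0 i - r, v0 ord0 i + r]%classic)) => i.
exact: segment_compact.
Qed.

(** The Newton map v + T (q - F v) is a 1/2-contraction of the compact ball into itself. Its fixed
    point is found as a minimiser of |Phi v - v|, a quantity that Phi would halve, rather than by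
    iteration. [T] stands for an inverse of the differential of [F]. *)
Lemma contraction_solve (V W : normedModType R) (F : V -> W)
    (T : W -> V) (v0 : V) (r : R) (q : W) :
  0 <= r -> compact [set v : V | `|v - v0| <= r] ->
  {morph T : a b / a - b} -> (forall w, T w = 0 -> w = 0) ->
  (forall v v', `|v - v0| <= r -> `|v' - v0| <= r ->
    `|v' - v - T (F v' - F v)| <= `|v' - v| / 2) ->
  `|T (q - F v0)| <= r / 2 ->
  exists2 v, `|v - v0| <= r & F v = q.
Proof.
move=> r0 cK TB T0 contr Tq.
pose Phi v := v + T (q - F v).
have PhiB v v' : Phi v' - Phi v = v' - v - T (F v' - F v).
  rewrite /Phi opprD addrACA -[T _ - T _]TB; congr (_ + _).
  have T00 : T 0 = 0 by rewrite -(subrr 0) TB subrr.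
  have TN a : T (- a) = - T a by rewrite -[- a]sub0r TB T00 sub0r.
  by rewrite -TN; congr (T _); rewrite !opprB addrC addrA subrK.
have PhiL v v' : `|v - v0| <= r -> `|v' - v0| <= r ->
    `|Phi v' - Phi v| <= `|v' - v| / 2.
  by move=> vr vr'; rewrite PhiB contr.
have v0r : `|v0 - v0| <= r by rewrite subrr normr0.
have Phir v : `|v - v0| <= r -> `|Phi v - v0| <= r.
  move=> vr; rewrite -(subrK (Phi v0) (Phi v)) -addrA.
  rewrite (le_trans (ler_normD _ _))// [r]splitr lerD//.
    by rewrite (le_trans (PhiL _ _ v0r vr))// ler_pM2r.
  by rewrite /Phi addrC addKr.
have PhiE v : Phi v - v = T (q - F v) by rewrite /Phi addrC addKr.
have [||v] := @compact_EVT_min _ R (fun v => `|Phi v - v|) _ _ cK.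
- by exists v0; rewrite /= v0r.
- apply: (@lipschitz_within_continuous _ _ _ _ (3 / 2)) => v v' vr vr'.
  rewrite (le_trans (ler_dist_dist _ _))//.
  have -> : Phi v - v - (Phi v' - v') = (Phi v - Phi v') - (v - v').
    by rewrite !opprB addrACA [RHS]addrACA; congr (_ + _); exact: addrC.
  by rewrite (le_trans (ler_normB _ _))//; have := PhiL _ _ vr' vr; lra.
rewrite inE /= => vr min; exists v => //.
have := min (Phi v); rewrite inE /= => /(_ (Phir v vr)).
move=> /le_trans/(_ (PhiL _ _ vr (Phir v vr))) h.
have : `|Phi v - v| <= 0 by move: h; lra.
rewrite normr_le0 PhiE => /eqP/T0/eqP; rewrite subr_eq0 => /eqP->.
by [].
Qed.

(* Maximise [b - p s] over the part of a box where [k <= 0]: the translate of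
   the graph of [p] through a maximiser lies in [k >= 0]. *)
Lemma touching_graph (k : R * R -> R) (p : R -> R) (s0 s1 rho eta : R) :
  s0 < s1 -> 0 < rho -> continuous p ->
  (forall s b, s0 <= s <= s1 -> `|b| <= rho -> {for (s, b), continuous k}) ->
  (exists s b, [/\ s0 <= s <= s1, `|b| <= rho, k (s, b) <= 0 & eta <= b - p s]) ->
  (forall b, `|b| <= rho -> k (s0, b) <= 0 -> b - p s0 < eta) ->
  (forall b, `|b| <= rho -> k (s1, b) <= 0 -> b - p s1 < eta) ->
  (forall s, s0 <= s <= s1 -> 0 < k (s, rho)) ->
  (forall s, s0 <= s <= s1 -> - rho - p s < eta) ->
  exists s b, [/\ s0 < s < s1, `|b| < rho, k (s, b) = 0 &
    \forall t \near s, 0 <= k (t, b + p t - p s)].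
Proof.
move=> s01 rho0 pc kc [sa [ba [sa01 barho kab etab]]] left right top bottom.
pose box := `[s0, s1]%classic `*` `[- rho, rho]%classic.
pose D := [set sb : R * R | box sb /\ k sb <= 0].
have boxP s b : box (s, b) <-> s0 <= s <= s1 /\ `|b| <= rho.
  by rewrite /box /= !in_itv/= ler_norml.
have cbox : compact box by apply: compact_setX; apply: segment_compact.
have cD : compact D.
  apply: (subclosed_compact _ cbox) => [|sb []//].
  move=> [s b] clD.
  have bx : box (s, b).
    have clb : closed box by apply: compact_closed.
    by apply: clb => B /clD [sb' [[h _] h']]; exists sb'.
  split=> //; rewrite leNgt; apply/negP => k0.
  have /boxP[ss bb] := bx.
  have kpos : \forall sb \near (s, b), 0 < k sb.
    exact: (cvgr_gt (k (s, b)) (kc _ _ ss bb)).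
  by have [sb' [[_ k1] k2]] := clD _ kpos; move: k1; rewrite leNgt k2.
have [||[s b]] := @compact_EVT_max _ R (fun sb => sb.2 - p sb.1) _ _ cD.
- by exists (sa, ba); split=> //; apply/boxP.
- apply: continuous_subspaceT => sb; apply: cvgB; first exact: cvg_snd.
  by apply: continuous_comp; [exact: cvg_fst | exact: pc].
rewrite inE => -[/boxP[ss bb] ksb] max.
have key t c : s0 <= t <= s1 -> `|c| <= rho -> b - p s < c - p t -> 0 < k (t, c).
  move=> tt cc; rewrite !ltNge; apply: contra => ktc.
  by apply: (max (t, c)); rewrite inE; split=> //; apply/boxP.
have etas : eta <= b - p s.
  rewrite (le_trans etab)//; apply: (max (sa, ba)).
  by rewrite inE; split=> //; apply/boxP.
(* If k were negative at (t, c), raising c by a small d would keep k negative while strictly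
   increasing the maximised quantity. *)
have key' t c : s0 <= t <= s1 -> `|c| < rho -> b - p s <= c - p t -> 0 <= k (t, c).
  move=> tt cc bc; rewrite leNgt; apply/negP => kneg.
  have : \forall sb \near (t, c), k sb < 0.
    exact: (cvgr_lt (k (t, c)) (kc _ _ tt (ltW cc))).
  move=> /nbhs_normP[r /= r0 rP].
  pose d := Num.min r (rho - c) / 2.
  have crho : c < rho by rewrite (le_lt_trans _ cc)// ler_norm.
  have d0 : 0 < d by rewrite divr_gt0// lt_min r0 subr_gt0.
  have dr : d * 2 <= r by rewrite divfK// ge_min lexx.
  have dc : d * 2 <= rho - c by rewrite divfK// ge_min lexx orbT.
  have kp : 0 < k (t, c + d).
    apply: key => //; last by lra.
    by move: cc; rewrite ltr_norml ler_norml => /andP[c1 c2]; apply/andP; split; lra.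
  have kn : k (t, c + d) < 0.
    apply: rP => /=; rewrite -[(t, c) - _]/(t - t, c - (c + d)).
    rewrite prod_normE /= subrr normr0 opprD addrA subrr sub0r normrN gt_max r0/=.
    by rewrite gtr0_norm//; lra.
  by move: kp; rewrite ltNge ltW.
have s0s : s0 < s.
  rewrite lt_neqAle; have /andP[-> _] := ss; rewrite andbT; apply/eqP => ss0.
  by move: etas; rewrite leNgt -ss0 left// ss0.
have ss1 : s < s1.
  rewrite lt_neqAle; have /andP[_ ->] := ss; rewrite andbT; apply/eqP => ss1.
  by move: etas; rewrite leNgt ss1 right// -ss1.
have brho : `|b| < rho.
  move: bb; rewrite ler_norml ltr_norml => /andP[b1 b2]; apply/andP; split.
    by have := bottom s ss; lra.
  rewrite lt_neqAle b2 andbT; apply/eqP => bE.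
  by have := top s ss; rewrite -bE ltNge ksb.
exists s, b; split=> //; first by rewrite s0s.
  by apply/eqP; rewrite eq_le ksb key'.
have pnear : \forall t \near s, `|b + p t - p s| < rho.
  have bp : (fun t => b + p t - p s) @ s --> b.
    rewrite -[X in _ --> X](addrK (p s)); apply: cvgB; last exact: cvg_cst.
    by apply: cvgD; [exact: cvg_cst | exact: pc].
  exact: (cvgr_norm_lt b bp).
near=> t; apply: key'.
- by apply/andP; split; apply: ltW; near: t; [exact: lt_nbhsr | exact: lt_nbhsl].
- by near: t.
- by rewrite addrAC addrK lexx.
Unshelve. all: by end_near.
Qed.

End Contraction.

(** * Monotonicity in z and local inversion of Q *)

Section InverseQ.
Context {R : realType} {n : nat}.
Local Notation point := ('rV[R]_n * 'rV[R]_n * R)%type.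
Context (Gamma : set point) (g : point -> R).
Hypothesis Gamma_open : open Gamma.
Hypothesis g_C2 : C2_on Gamma g.
Hypothesis fiber_itv : forall x y, is_interval (I_fiber Gamma x y).
Hypothesis gz_lt0 : forall w, Gamma w -> g_z g w < 0.
Implicit Types (w d : point) (x y p X v : 'rV[R]_n) (z a e : R).

Lemma g_decreasing x y z z' : Gamma (x, y, z) -> Gamma (x, y, z') -> z < z' ->
  g (x, y, z') < g (x, y, z).
Proof.
move=> Gz Gz' zz'.
have Gs s : z <= s <= z' -> Gamma (x, y, s).
  by move=> sz; apply: (fiber_itv Gz Gz').
have dg s : z <= s <= z' ->
    is_derive s (1 : R) (fun t => g (x, y, t)) (g_z g (x, y, s)).
  move=> sz; have H : derivable g ((x, y, 0) + s *: dirz) dirz.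
    by rewrite point_lineE; apply: (g_C2.1 _).1; apply: Gs.
  have := is_derive_line H; rewrite point_lineE.
  by rewrite (_ : (fun t => g _) = fun t => g (x, y, t))//;
    apply/funext => t; rewrite point_lineE.
have [||c] := @MVT_segment R (fun t => g (x, y, t)) (fun t => g_z g (x, y, t))
    z z' (ltW zz').
- by move=> s; rewrite in_itv/= => /andP[/ltW h1 /ltW h2]; apply: dg; rewrite h1.
- apply: derivable_within_continuous => s; rewrite in_itv/= => h.
  by have [] := dg s h.
rewrite in_itv/= => cz h; rewrite -subr_lt0 h nmulr_rlt0 ?subr_gt0//.
exact/gz_lt0/Gs.
Qed.

Lemma g_ltE x y z z' : Gamma (x, y, z) -> Gamma (x, y, z') ->
  (g (x, y, z') < g (x, y, z)) = (z < z').
Proof.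
move=> Gz Gz'; apply/idP/idP; last exact: g_decreasing.
apply: contraTT; rewrite -!leNgt le_eqVlt => /orP[/eqP->//|zz'].
by apply/ltW/g_decreasing.
Qed.

Lemma g_inj x y z z' : Gamma (x, y, z) -> Gamma (x, y, z') ->
  g (x, y, z) = g (x, y, z') -> z = z'.
Proof.
by move=> Gz Gz' gE; apply/eqP; rewrite eq_le !leNgt -(g_ltE Gz Gz') -(g_ltE Gz' Gz) gE ltxx.
Qed.

Lemma gstarP x y a : Gstar Gamma g (x, y, a) ->
  Gamma (x, y, gstar Gamma g x y a) /\ g (x, y, gstar Gamma g x y a) = a.
Proof.
move=> [[[x' y'] z] Gw] /= [<- <- <-].
apply: (@xgetPex _ 0 [set z' | Gamma (x', y', z') /\ g (x', y', z') = g (x', y', z)]).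
by exists z.
Qed.

Lemma gstarK x y z : Gamma (x, y, z) -> gstar Gamma g x y (g (x, y, z)) = z.
Proof.
move=> Gw; have [|G' gE] := @gstarP x y (g (x, y, z)); first by exists (x, y, z).
exact: g_inj G' Gw gE.
Qed.

Lemma g_lipschitz w0 : Gamma w0 -> exists C r, [/\ 0 < C, 0 < r &
  forall w w', `|w - w0| < r -> `|w' - w0| < r -> `|g w' - g w| <= C * `|w' - w|].
Proof.
move=> Gw; have [r r0 rP] := g_strict Gamma_open g_C2 Gw ltr01.
have [C C0 CP] := linear_part_bounded g w0.
exists (1 + C), r; split=> //; first exact: addr_gt0.
move=> w w' wr wr'; have := rP w w' wr wr'; have := CP (w' - w).
rewrite mulrDl; move: (linear_part _ _ _) => l; rewrite mul1r => h1 h2.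
by rewrite -(subrK l (g w' - g w)) (le_trans (ler_normD _ _))// lerD.
Qed.

Lemma g_continuous w : Gamma w -> {for w, continuous g}.
Proof.
move=> Gw; have [C [r [C0 r0 rP]]] := g_lipschitz Gw.
apply: (lipschitz_at_continuous r0 C0) => w' w'r; apply: rP => //.
by rewrite subrr normr0.
Qed.

Lemma g_continuous_comp (T : topologicalType) (f : T -> 'rV[R]_n) y z (t : T) :
  {for t, continuous f} -> Gamma (f t, y, z) ->
  {for t, continuous (fun s => g (f s, y, z))}.
Proof.
move=> cf Gt; apply: (continuous_comp (f := fun s => (f s, y, z)) (g := g)).
  have h1 : (f s, y) @[s --> t] --> (f t, y) by apply: (cvg_pair cf (cvg_cst _)).
  exact: (cvg_pair h1 (cvg_cst _)).
exact: g_continuous.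
Qed.

Lemma gy_gz_strict_x x y z e : Gamma (x, y, z) -> 0 < e ->
  exists2 r, 0 < r & forall x1 x2, `|x1 - x| < r -> `|x2 - x| < r ->
    `|g_y g (x2, y, z) - g_y g (x1, y, z) - (x2 - x1) *m g_xy g (x, y, z)|
      <= e * `|x2 - x1| /\
    `|g_z g (x2, y, z) - g_z g (x1, y, z) - dot (x2 - x1) (g_xz g (x, y, z))|
      <= e * `|x2 - x1|.
Proof.
move=> Gw e0; set w := (x, y, z).
have [r r0 rP] := C1_strict Gamma_open (g_C2.2 dirz) Gw e0.
have [i|i s s' ss' h w1 w2 wr wr'|r1 r10 rP1] := @uniform_radius R n
    (fun j r => forall w1 w2, `|w1 - w| < r -> `|w2 - w| < r ->
      `|'D_(diry j) g w2 - 'D_(diry j) g w1 - linear_part ('D_(diry j) g) w (w2 - w1)|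
       <= e * `|w2 - w1|).
- exact: C1_strict Gamma_open (g_C2.2 _) Gw e0.
- by apply: h; apply: lt_le_trans ss'.
exists (Num.min r r1); first by rewrite lt_min r0.
move=> x1 x2; rewrite !lt_min => /andP[x1r x1r1] /andP[x2r x2r1].
have lE f : linear_part f w ((x2, y, z) - (x1, y, z)) = dot (x2 - x1) (g_x f w).
  by rewrite /linear_part -[(_, _, _) - _]/(x2 - x1, y - y, z - z) /= !subrr
    dot0l mul0r !addr0.
split.
- apply: norm_le_coord => [|i]; first by rewrite mulr_ge0// ltW.
  have := rP1 i (x1, y, z) (x2, y, z); rewrite !normB_x lE => /(_ x1r1 x2r1).
  rewrite !row_coordB ![g_y _ _ _ _]mxE dotE [(_ *m _) _ _]mxE.
  rewrite (_ : \sum_j (x2 - x1) 0 j * g_x _ _ _ _ = \sum_j (x2 - x1) 0 j * g_xy g w j i)//.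
  by apply: eq_bigr => j _; rewrite [g_x _ _ _ _]mxE [g_xy _ _ _ _]mxE.
- have := rP (x1, y, z) (x2, y, z); rewrite !normB_x lE => /(_ x1r x2r).
  by rewrite /g_z (_ : g_x _ w = g_xz g w)//; apply/rowP => i; rewrite !mxE.
Qed.

(** The equation Q = X cleared of its denominator: [QF] is g_z (X - Q), and for X = Q at the base
    point its differential in x is [E]. This is how A2 enters, and no quotient has to be
    differentiated. *)
Definition QF (y : 'rV[R]_n) (z : R) X x : 'rV[R]_n :=
  g_y g (x, y, z) + g_z g (x, y, z) *: X.

Lemma QFE y z X x : Gamma (x, y, z) ->
  QF y z X x = g_z g (x, y, z) *: (X - Q g (x, y, z)).
Proof.
move=> Gw; rewrite /QF /Q opprK scalerDr scalerA divff ?scale1r; first exact: addrC.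
by rewrite lt_eqF// gz_lt0.
Qed.

Lemma mulmx_E w v : Gamma w ->
  v *m E g w = v *m g_xy g w + dot v (g_xz g w) *: Q g w.
Proof.
move=> Gw; rewrite /E /Q mulmxBr; congr (_ + _).
by rewrite -scalemxAr mulmx_outer scalerN !scalerA mulrC.
Qed.

Lemma QF_strict x y z e : Gamma (x, y, z) -> 0 < e ->
  exists2 r, 0 < r & forall x1 x2 X, `|x1 - x| < r -> `|x2 - x| < r ->
    `|X - Q g (x, y, z)| < r ->
    `|QF y z X x2 - QF y z X x1 - (x2 - x1) *m E g (x, y, z)| <= e * `|x2 - x1|.
Proof.
move=> Gw e0; set w := (x, y, z).
pose K := 3 + `|Q g w| + n%:R * `|g_xz g w|.
have K0 : 0 < K by rewrite /K -addrA ltr_pwDl// addr_ge0// mulr_ge0.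
have eK : 0 < e / K by rewrite divr_gt0.
have [r r0 rP] := gy_gz_strict_x Gw eK.
exists (Num.min r (Num.min 1 (e / K))); first by rewrite !lt_min r0 ltr01 eK.
move=> x1 x2 X; rewrite !lt_min => /andP[x1r _] /andP[x2r _] /and3P[_ X1 XK].
have [hy hz] := rP x1 x2 x1r x2r.
set d := x2 - x1 in hy hz *.
have -> : QF y z X x2 - QF y z X x1 - d *m E g w =
  (g_y g (x2, y, z) - g_y g (x1, y, z) - d *m g_xy g w) +
  (g_z g (x2, y, z) - g_z g (x1, y, z) - dot d (g_xz g w)) *: X +
  dot d (g_xz g w) *: (X - Q g w).
  rewrite mulmx_E// /QF !scalerBl scalerBr.
  by row_ring.
have XN : `|X| <= 1 + `|Q g w|.
  by rewrite -(subrK (Q g w) X) (le_trans (ler_normD _ _))// lerD// ltW.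
rewrite (le_trans (ler_normD _ _))//.
have -> : e * `|d| = (e / K * `|d| + e / K * `|d| * (1 + `|Q g w|)) +
    (1 + n%:R * `|g_xz g w|) * (e / K * `|d|).
  by rewrite /K; field; rewrite gt_eqF// -addrA ltr_pwDl// addr_ge0// mulr_ge0.
have ed : 0 <= e / K * `|d| by rewrite mulr_ge0// ltW.
apply: lerD.
  rewrite (le_trans (ler_normD _ _))// lerD// normrZ ler_pM//.
rewrite normrZ (@le_trans _ _ (n%:R * (`|d| * `|g_xz g w|) * (e / K)))//.
  by rewrite ler_pM// ?dot_le// ltW.
rewrite mulrDl mul1r (@le_trans _ _ (n%:R * `|g_xz g w| * (e / K * `|d|)))//.
  rewrite le_eqVlt; apply/orP; left; apply/eqP; ring.
by rewrite lerDr.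
Qed.

(** [contraction_solve] is applied to QF = 0, with the inverse of [E] at the base point as
    approximate inverse; the target X enters only as a parameter of [QF]. *)
Lemma Q_solve x y z e : Gamma (x, y, z) -> \det (E g (x, y, z)) != 0 -> 0 < e ->
  exists2 r, 0 < r & forall X, `|X - Q g (x, y, z)| < r ->
    exists x', [/\ `|x' - x| < e, Gamma (x', y, z) & Q g (x', y, z) = X].
Proof.
move=> Gw dE e0; set w := (x, y, z).
have uE : E g w \in unitmx by rewrite unitmxE unitfE.
have [K K0 KP] := mulmx_bounded (invmx (E g w)).
have [r r0 rP] := QF_strict Gw (divr_gt0 (divr_gt0 ltr01 (ltr0Sn _ 1)) K0).
have [r1 r10 rG] := Gamma_near Gamma_open g_C2 Gw.
pose s := Num.min (Num.min r r1) e / 2.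
have s0 : 0 < s by rewrite divr_gt0// !lt_min r0 r10.
have sr : s < r by rewrite ltr_pdivrMr// (@le_lt_trans _ _ r) ?ge_min ?lexx//; lra.
have sr1 : s < r1.
  by rewrite ltr_pdivrMr// (@le_lt_trans _ _ r1) ?ge_min ?lexx ?orbT//; lra.
have se : s < e.
  by rewrite ltr_pdivrMr// (@le_lt_trans _ _ e) ?ge_min ?lexx ?orbT//; lra.
have gz0 : 0 < `|g_z g w| by rewrite normr_gt0 lt_eqF// gz_lt0.
exists (Num.min r (s / 2 / (K * `|g_z g w|))).
  by rewrite lt_min r0 /=; apply: divr_gt0; [exact: divr_gt0 | exact: mulr_gt0].
move=> X; rewrite lt_min => /andP[Xr Xs].
have TB : {morph (fun v => v *m invmx (E g w)) : a b / a - b}.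
  by move=> a b; rewrite mulmxBl.
have T0 v : v *m invmx (E g w) = 0 -> v = 0.
  by move=> h; rewrite -[v](mulmxKV uE) h mul0mx.
have contr x1 x2 : `|x1 - x| <= s -> `|x2 - x| <= s ->
    `|x2 - x1 - (QF y z X x2 - QF y z X x1) *m invmx (E g w)| <= `|x2 - x1| / 2.
  move=> x1s x2s.
  have h := rP x1 x2 X (le_lt_trans x1s sr) (le_lt_trans x2s sr) Xr.
  have -> : x2 - x1 - (QF y z X x2 - QF y z X x1) *m invmx (E g w) =
      - ((QF y z X x2 - QF y z X x1 - (x2 - x1) *m E g w) *m invmx (E g w)).
    by rewrite [in RHS]mulmxBl (mulmxK uE) opprB.
  rewrite normrN (le_trans (KP _))// (le_trans (ler_wpM2l (ltW K0) h))//.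
  by rewrite le_eqVlt; apply/orP; left; apply/eqP; field; rewrite gt_eqF.
have Tq : `|(0 - QF y z X x) *m invmx (E g w)| <= s / 2.
  rewrite (le_trans (KP _))// sub0r normrN QFE// normrZ mulrA mulrC.
  by rewrite -ler_pdivlMr ?mulr_gt0// ltW.
have [x' xs QF0] := contraction_solve (ltW s0) (@closed_ball_rV_compact R n x s) TB T0 contr Tq.
have Gx' : Gamma (x', y, z).
  by apply: rG; rewrite normB_x (le_lt_trans xs).
exists x'; split=> //; first exact: le_lt_trans se.
move: QF0; rewrite QFE// => /eqP; rewrite scaler_eq0 lt_eqF ?gz_lt0//=.
by rewrite subr_eq0 => /eqP.
Qed.

(** Strict differentiability of the inverse of Q: for X1 = Q(x1), [QF] vanishes at x1 and equals -
    g_z (X2 - X1) at x2, so x2 - x1 is about - g_z (X2 - X1) E^-1. *)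
Lemma Q_inverse_strict x y z e : Gamma (x, y, z) -> \det (E g (x, y, z)) != 0 ->
  0 < e -> exists2 r, 0 < r & forall x1 x2, `|x1 - x| < r -> `|x2 - x| < r ->
    `|Q g (x1, y, z) - Q g (x, y, z)| < r ->
    `|x2 - x1 + g_z g (x, y, z) *:
       ((Q g (x2, y, z) - Q g (x1, y, z)) *m invmx (E g (x, y, z)))|
     <= e * `|Q g (x2, y, z) - Q g (x1, y, z)|.
Proof.
move=> Gw dE e0; set w := (x, y, z).
have uE : E g w \in unitmx by rewrite unitmxE unitfE.
have [K K0 KP] := mulmx_bounded (invmx (E g w)).
pose c := 1 + `|g_z g w|.
have c0 : 0 < c by rewrite ltr_pwDl.
(* [e2] bounds the variation of g_z. The first bound on [e1] absorbs K e1 |d| into |d| / 2 and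
   yields |d| <= 2 c K |D|; the second then makes K e1 |d| at most e / 2 |D|. *)
pose e2 := Num.min 1 (e / (2 * K)).
pose e1 := Num.min (1 / (2 * K)) (e / (4 * K * K * c)).
have e20 : 0 < e2 by rewrite lt_min ltr01 divr_gt0// mulr_gt0.
have e10 : 0 < e1 by rewrite lt_min !divr_gt0// !mulr_gt0.
have e21 : e2 <= 1 by rewrite ge_min lexx.
have e2K : e2 * (2 * K) <= e by rewrite -ler_pdivlMr ?mulr_gt0// ge_min lexx orbT.
have e1K : e1 * (2 * K) <= 1 by rewrite -ler_pdivlMr ?mulr_gt0// ge_min lexx.
have e1e : e1 * (4 * K * K * c) <= e.
  by rewrite -ler_pdivlMr ?mulr_gt0// ge_min lexx orbT.
have [r r0 rP] := QF_strict Gw e10.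
have [r1 r10 rG] := Gamma_near Gamma_open g_C2 Gw.
have [r2 r20 rz] := C1_on_near dirz Gamma_open g_C2.1 Gw e20.
exists (Num.min r (Num.min r1 r2)); first by rewrite !lt_min r0 r10.
move=> x1 x2; rewrite !lt_min => /and3P[x1r x1r1 x1r2] /and3P[x2r x2r1 x2r2].
move=> /and3P[Xr _ _].
have Gx1 : Gamma (x1, y, z) by apply: rG; rewrite normB_x.
have Gx2 : Gamma (x2, y, z) by apply: rG; rewrite normB_x.
have gz2 : `|g_z g (x2, y, z) - g_z g w| <= e2.
  by have [|_ /ltW //] := rz (x2, y, z); rewrite normB_x.
have q1 : QF y z (Q g (x1, y, z)) x1 = 0 by rewrite (QFE _ Gx1) subrr scaler0.
have := rP x1 x2 _ x1r x2r Xr; rewrite q1 (QFE _ Gx2) [X in `|X - _|]subr0.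
move: (g_z g (x2, y, z)) gz2 {q1 Xr} => a az2.
move: (Q g (x1, y, z)) (Q g (x2, y, z)) => X1 X2.
set d := x2 - x1; set D := X2 - X1.
rewrite -(opprB X2 X1) -/D scalerN -opprD normrN => h.
have dE' : d + g_z g w *: (D *m invmx (E g w)) =
    (a *: D + d *m E g w) *m invmx (E g w) - (a - g_z g w) *: (D *m invmx (E g w)).
  by rewrite [(a *: D + _) *m _]mulmxDl (mulmxK uE) -scalemxAl; row_ring.
have h1 : `|d + g_z g w *: (D *m invmx (E g w))| <= K * (e1 * `|d|) + e2 * (K * `|D|).
  rewrite dE' (le_trans (ler_normB _ _))// lerD//.
    by rewrite (le_trans (KP _))// ler_wpM2l// ltW.
  by rewrite normrZ ler_pM.
have h2 : `|d| <= K * (e1 * `|d|) + e2 * (K * `|D|) + `|g_z g w| * (K * `|D|).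
  rewrite -[d in leLHS](addrK (g_z g w *: (D *m invmx (E g w)))).
  rewrite (le_trans (ler_normB _ _))// lerD// normrZ.
  by rewrite ler_wpM2l.
have D0 : 0 <= `|D| by [].
have d0 : 0 <= `|d| by [].
have KD : 0 <= K * `|D| by rewrite mulr_ge0// ltW.
have h3 : K * (e1 * `|d|) <= `|d| / 2.
  have := ler_wpM2r d0 e1K; lra.
have h4 : e2 * (K * `|D|) <= K * `|D| by rewrite ler_piMl.
have h5 : `|d| <= 2 * (c * (K * `|D|)) by move: h2 h3 h4; rewrite /c; lra.
rewrite (le_trans h1)//.
have h6 : K * (e1 * `|d|) <= e / 2 * `|D|.
  have := ler_wpM2l (mulr_ge0 (ltW K0) (ltW e10)) h5.
  have := ler_wpM2r D0 e1e; lra.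
have := ler_wpM2r D0 e2K; lra.
Qed.

End InverseQ.

(** * Local inversion of the jet map (y, z) -> (g_x, g) *)

Section Jets.
Context {R : realType} {n : nat}.
Local Notation point := ('rV[R]_n * 'rV[R]_n * R)%type.
Context (Gamma : set point) (g : point -> R).
Hypothesis Gamma_open : open Gamma.
Hypothesis g_C2 : C2_on Gamma g.
Hypothesis gz_lt0 : forall w, Gamma w -> g_z g w < 0.
Hypothesis g_A1 : A1 Gamma g.
Hypothesis g_A2 : A2 Gamma g.
Implicit Types (w d : point) (x y p v : 'rV[R]_n) (z a e : R).

(** Inverse of the differential of (y, z) |-> (g_x, g) at fixed x. Eliminating dz, possible as g_z
    is nonzero, leaves the Schur complement [(E g w)^T] acting on dy. *)
Let jet_inverse w (q : 'rV[R]_n * R) : 'rV[R]_n * R :=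
  let dy := (q.1 - ((g_z g w)^-1 * q.2) *: g_xz g w) *m invmx (E g w)^T in
  (dy, (g_z g w)^-1 * (q.2 - dot dy (g_y g w))).

Lemma mulmx_trE w v : v *m (E g w)^T =
  v *m (g_xy g w)^T - ((g_z g w)^-1 * dot v (g_y g w)) *: g_xz g w.
Proof.
rewrite /E [(_ - _)^T]linearB /= mulmxBr; congr (_ - _).
by rewrite [(_ *: _)^T]linearZ /= trmx_mul trmxK -scalemxAr mulmx_outer scalerA.
Qed.

Lemma jet_inverseK w (v : 'rV[R]_n * R) : Gamma w ->
  jet_inverse w (gx_linear_part g w (0, v.1, v.2), linear_part g w (0, v.1, v.2)) = v.
Proof.
move=> Gw; case: v => dy dz; have gz0 : g_z g w != 0 by rewrite lt_eqF// gz_lt0.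
have uE : (E g w)^T \in unitmx by rewrite unitmx_tr unitmxE unitfE g_A2.
rewrite /jet_inverse /gx_linear_part /linear_part /= mul0mx dot0l !add0r.
have -> : dy *m (g_xy g w)^T + dz *: g_xz g w -
    ((g_z g w)^-1 * (dot dy (g_y g w) + dz * g_z g w)) *: g_xz g w = dy *m (E g w)^T.
  rewrite mulmx_trE mulrDr mulrCA mulVf// mulr1 scalerDl.
  by rewrite [X in _ - X]addrC opprD addrA addrK.
by rewrite (mulmxK uE) addrAC subrr add0r mulrCA mulVf// mulr1.
Qed.

Lemma jet_inverseB w : {morph jet_inverse w : a b / a - b}.
Proof.
move=> [a1 a2] [b1 b2]; rewrite /jet_inverse -[RHS]/(_ - _, _ - _) /=.
have -> : (a1 - b1 - ((g_z g w)^-1 * (a2 - b2)) *: g_xz g w) *m invmx (E g w)^T =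
    (a1 - ((g_z g w)^-1 * a2) *: g_xz g w) *m invmx (E g w)^T -
    (b1 - ((g_z g w)^-1 * b2) *: g_xz g w) *m invmx (E g w)^T.
  by rewrite -mulmxBl; congr (_ *m _); row_ring.
rewrite dotDl dotNl; congr (_, _).
move: (dot _ _) (dot _ _) => c1 c2; ring.
Qed.

Lemma jet_inverse_eq0 w q : Gamma w -> jet_inverse w q = 0 -> q = 0.
Proof.
move=> Gw; case: q => p a; have gz0 : (g_z g w)^-1 != 0.
  by rewrite invr_eq0 lt_eqF// gz_lt0.
have uE : (E g w)^T \in unitmx by rewrite unitmx_tr unitmxE unitfE g_A2.
rewrite /jet_inverse /= => -[]; set dy := _ *m _ => dy0.
rewrite dy0 dot0l subr0 => /eqP; rewrite mulf_eq0 (negbTE gz0)/= => /eqP a0.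
by move: dy0; rewrite /dy a0 mulr0 scale0r subr0 => h; rewrite -[p](mulmxKV uE) h mul0mx.
Qed.

Lemma jet_inverse_bounded w :
  exists2 K, 0 < K & forall q, `|jet_inverse w q| <= K * `|q|.
Proof.
have [K K0 KP] := mulmx_bounded (invmx (E g w)^T).
pose c : R := `|(g_z g w)^-1|; pose a : R := 1 + c * `|g_xz g w|.
have c0 : 0 <= c by exact: normr_ge0.
have a0 : 0 < a by rewrite ltr_pwDl// mulr_ge0.
pose b : R := 1 + n%:R * `|g_y g w| * (K * a).
have b0 : 0 < b by rewrite ltr_pwDl// !mulr_ge0// ltW.
exists (K * a + c * b); first by rewrite ltr_pwDl ?mulr_gt0// mulr_ge0// ltW.
move=> [p s]; set N := `|(p, s)|.
have pN : `|p| <= N by rewrite /N prod_normE le_max lexx.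
have sN : `|s| <= N by rewrite /N prod_normE le_max lexx orbT.
have N0 : 0 <= N by exact: le_trans (normr_ge0 p) pN.
rewrite /jet_inverse /=; set dy := _ *m _.
have dyN : `|dy| <= K * a * N.
  rewrite (le_trans (KP _))// -mulrA ler_wpM2l ?(ltW K0)//.
  rewrite (le_trans (ler_normB _ _))// /a mulrDl mul1r lerD// normrZ normrM.
  by rewrite -[`|(g_z g w)^-1|]/c mulrAC ler_wpM2l// mulr_ge0.
rewrite prod_normE ge_max /= mulrDl; apply/andP; split.
  by rewrite (le_trans dyN)// lerDl !mulr_ge0// ltW.
rewrite normrM -[`|(g_z g w)^-1|]/c (@le_trans _ _ (c * b * N))//; last first.
  by rewrite lerDr !mulr_ge0// ltW.
rewrite -mulrA ler_wpM2l// (le_trans (ler_normB _ _))// /b mulrDl mul1r lerD//.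
rewrite (le_trans (dot_le _ _))// -!mulrA ler_wpM2l ?ler0n// mulrC ler_wpM2l//.
by rewrite !mulrA.
Qed.

Lemma gx_lipschitz w0 : Gamma w0 -> exists C r, [/\ 0 < C, 0 < r &
  forall w w', `|w - w0| < r -> `|w' - w0| < r ->
    `|g_x g w' - g_x g w| <= C * `|w' - w|].
Proof.
move=> Gw; have [r r0 rP] := gx_strict Gamma_open g_C2 Gw ltr01.
have [A A0 AP] := mulmx_bounded (g_xx g w0).
have [B B0 BP] := mulmx_bounded (g_xy g w0)^T.
exists (1 + (A + B + `|g_xz g w0|)), r; split=> //.
  by rewrite addr_gt0// -addrA addr_gt0// ltr_pwDl.
move=> w w' wr wr'; have := rP w w' wr wr'.
rewrite mul1r mulrDl mul1r => h.
rewrite -(subrK (gx_linear_part g w0 (w' - w)) (g_x g w' - g_x g w)).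
rewrite (le_trans (ler_normD _ _))// lerD// /gx_linear_part.
move: (w' - w) => d; rewrite !mulrDl.
rewrite (le_trans (ler_normD _ _))// lerD//; last first.
  by rewrite normrZ mulrC ler_wpM2l// normz_le.
rewrite (le_trans (ler_normD _ _))// lerD//.
  by rewrite (le_trans (AP _))// ler_wpM2l ?normx_le// ltW.
by rewrite (le_trans (BP _))// ler_wpM2l ?normy_le// ltW.
Qed.

(** Here x is a parameter: the approximate inverse taken at [w] serves all nearby x. In particular
    [calU] is open, and the preimage stays close to (y0, z0). *)
Lemma jet_solve x0 y0 z0 e : Gamma (x0, y0, z0) -> 0 < e ->
  exists2 r, 0 < r & forall x a p, `|x - x0| < r -> `|a - g (x0, y0, z0)| < r ->
    `|p - g_x g (x0, y0, z0)| < r ->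
    exists y z, [/\ Gamma (x, y, z), `|(x, y, z) - (x0, y0, z0)| < e,
      g (x, y, z) = a & g_x g (x, y, z) = p].
Proof.
move=> Gw e0; set w := (x0, y0, z0).
have [K K0 KP] := jet_inverse_bounded w.
have eK : 0 < 1 / 2 / K by rewrite !divr_gt0.
have [r r0 rP] := gx_strict Gamma_open g_C2 Gw eK.
have [r1 r10 rP1] := g_strict Gamma_open g_C2 Gw eK.
have [r2 r20 rG] := Gamma_near Gamma_open g_C2 Gw.
have [s [s0 [sr sr1] [sr2 se]]] : exists s, [/\ 0 < s, s < r /\ s < r1 & s < r2 /\ s < e].
  exists (Num.min (Num.min r r1) (Num.min r2 e) / 2).
  have m0 : 0 < Num.min (Num.min r r1) (Num.min r2 e) by rewrite !lt_min r0 r10 r20.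
  have m1 : Num.min (Num.min r r1) (Num.min r2 e) <= r by rewrite !ge_min lexx.
  have m2 : Num.min (Num.min r r1) (Num.min r2 e) <= r1 by rewrite !ge_min lexx ?orbT.
  have m3 : Num.min (Num.min r r1) (Num.min r2 e) <= r2 by rewrite !ge_min lexx ?orbT.
  have m4 : Num.min (Num.min r r1) (Num.min r2 e) <= e by rewrite !ge_min lexx ?orbT.
  by split; [|split|split]; lra.
have nB x (v v' : 'rV[R]_n * R) : `|(x, v.1, v.2) - (x, v'.1, v'.2) : point| = `|v - v'|.
  rewrite -[(_, _, _) - _]/(x - x, v.1 - v'.1, v.2 - v'.2) subrr !prod_normE/= normr0.
  by rewrite (max_r (normr_ge0 _)).
have nBx x (v : 'rV[R]_n * R) : `|x - x0| < s -> `|v - (y0, z0)| <= s ->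
    `|(x, v.1, v.2) - w| <= s.
  move=> xs; rewrite prod_normE ge_max /= => /andP[v1 v2].
  by apply: point_norm_le => //=; exact: ltW.
pose F x (v : 'rV[R]_n * R) := (g_x g (x, v.1, v.2), g (x, v.1, v.2)).
have contr x (v v' : 'rV[R]_n * R) : `|x - x0| < s ->
    `|v - (y0, z0)| <= s -> `|v' - (y0, z0)| <= s ->
    `|v' - v - jet_inverse w (F x v' - F x v)| <= `|v' - v| / 2.
  move=> xs vs vs'.
  have ws := nBx x v xs vs; have ws' := nBx x v' xs vs'.
  have := rP _ _ (le_lt_trans ws sr) (le_lt_trans ws' sr).
  have := rP1 _ _ (le_lt_trans ws sr1) (le_lt_trans ws' sr1).
  rewrite !nB.
  have dE : (x, v'.1, v'.2) - (x, v.1, v.2) = (0, (v' - v).1, (v' - v).2) :> point.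
    by rewrite -[LHS]/(x - x, v'.1 - v.1, v'.2 - v.2) subrr.
  rewrite dE => h1 h2.
  rewrite -[X in X - jet_inverse _ _](jet_inverseK _ Gw) -jet_inverseB -normrN.
  rewrite (le_trans (_ : _ <= K * (1 / 2 / K * `|v' - v|)))//; last first.
    by rewrite le_eqVlt; apply/orP; left; apply/eqP; field; rewrite gt_eqF.
  rewrite normrN (le_trans (KP _))// ler_wpM2l ?(ltW K0)// distrC.
  by rewrite prod_normE ge_max /= h1 h2.
have [C1 [r3 [C10 r30 rP3]]] := gx_lipschitz Gw.
have [C2 [r4 [C20 r40 rP4]]] := g_lipschitz Gamma_open g_C2 Gw.
pose D := 2 * K * (1 + C1 + C2).
have D0 : 0 < D by rewrite !mulr_gt0// !addr_gt0.
exists (Num.min (Num.min r3 r4) (Num.min s (s / D))).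
  by rewrite !lt_min r30 r40 s0 divr_gt0.
move=> x a p; rewrite !lt_min => /andP[/andP[xr3 xr4] /andP[xs xD]].
move=> /andP[_ /andP[_ aD]] /andP[_ /andP[_ pD]].
have w0 (t : R) : 0 < t -> `|w - w| < t by rewrite subrr normr0.
have hx : `|g_x g (x, y0, z0) - g_x g w| <= C1 * (s / D).
  rewrite (le_trans (rP3 w (x, y0, z0) (w0 _ r30) _))// normB_x//.
  by rewrite ler_wpM2l ?(ltW C10)// ltW.
have h : `|g (x, y0, z0) - g w| <= C2 * (s / D).
  rewrite (le_trans (rP4 w (x, y0, z0) (w0 _ r40) _))// normB_x//.
  by rewrite ler_wpM2l ?(ltW C20)// ltW.
have sD : 0 <= s / D by rewrite divr_ge0// ltW.
have Tq : `|jet_inverse w ((p, a) - F x (y0, z0))| <= s / 2.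
  rewrite (le_trans (KP _))//.
  have -> : s / 2 = K * ((1 + C1 + C2) * (s / D)).
    by rewrite /D; field; rewrite !gt_eqF// !addr_gt0.
  have c1 : 0 <= C1 * (s / D) by rewrite mulr_ge0// ltW.
  have c2 : 0 <= C2 * (s / D) by rewrite mulr_ge0// ltW.
  rewrite ler_wpM2l ?(ltW K0)// prod_normE ge_max /= !mulrDl mul1r.
  move: (s / D) aD pD hx h c1 c2 sD {xD} => t aD pD hx h c1 c2 t0.
  apply/andP; split.
    have -> : p - g_x g (x, y0, z0) = (p - g_x g w) - (g_x g (x, y0, z0) - g_x g w).
      by rewrite opprB addrA subrK.
    by rewrite (le_trans (ler_normB _ _))//; lra.
  have -> : a - g (x, y0, z0) = (a - g w) - (g (x, y0, z0) - g w) by ring.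
  by rewrite (le_trans (ler_normB _ _))//; lra.
have cball : compact [set v : 'rV[R]_n * R | `|v - (y0, z0)| <= s].
  have -> : [set v : 'rV[R]_n * R | `|v - (y0, z0)| <= s] =
      [set y | `|y - y0| <= s] `*` `[z0 - s, z0 + s]%classic.
    apply/seteqP; split=> -[y z] /=; rewrite prod_normE ge_max /= in_itv/= -ler_distl.
      by move/andP.
    by move=> [-> ->].
  by apply: compact_setX; [exact: closed_ball_rV_compact | exact: segment_compact].
have [[y z] vs [pE aE]] := contraction_solve (ltW s0) cball (@jet_inverseB w)
  (fun q => @jet_inverse_eq0 w q Gw) (fun u u' => @contr x u u' xs) Tq.
have ws := nBx x (y, z) xs vs.
exists y, z; split=> //; last exact: le_lt_trans se.
by apply: rG; exact: le_lt_trans sr2.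
Qed.

Lemma YZ_jet x y z : Gamma (x, y, z) ->
  let w := (x, y, z) in
  (Y Gamma g x (g w) (g_x g w), Z Gamma g x (g w) (g_x g w)) = (y, z).
Proof.
move=> Gw /=; set w := (x, y, z).
have Uw : calU Gamma g (x, g w, g_x g w) by exists w.
have [yz [_ uniq]] := g_A1 Uw.
have Jw : jet_preimage Gamma g x (g w) (g_x g w) (y, z) by split.
have := @xgetPex _ (0, 0) (jet_preimage Gamma g x (g w) (g_x g w)).
move=> /(_ (ex_intro _ _ Jw)) /uniq; rewrite (uniq _ Jw) => ->.
by rewrite /Y /Z -surjective_pairing.
Qed.

Lemma A_jet x y z : Gamma (x, y, z) ->
  A Gamma g x (g (x, y, z)) (g_x g (x, y, z)) = g_xx g (x, y, z).
Proof. by move=> Gw; rewrite /A; have [-> ->] := YZ_jet Gw. Qed.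

(** [A] is evaluated at the preimage chosen by [Y] and [Z]; by A1 it is the nearby one given by
    [jet_solve], so the continuity of [g_xx] passes to [A]. *)
Lemma A_near x0 y0 z0 e : Gamma (x0, y0, z0) -> 0 < e ->
  exists2 r, 0 < r & forall x a p, `|x - x0| < r -> `|a - g (x0, y0, z0)| < r ->
    `|p - g_x g (x0, y0, z0)| < r -> calU Gamma g (x, a, p) /\
    forall i j, `|(A Gamma g x a p - g_xx g (x0, y0, z0)) i j| <= e.
Proof.
move=> Gw e0; have [r r0 rP] := gxx_near Gamma_open g_C2 Gw e0.
have [r1 r10 rP1] := jet_solve Gw r0.
exists r1 => // x a p xr ar pr; have [y [z [Gyz wr gE gxE]]] := rP1 x a p xr ar pr.
rewrite -gE -gxE; split; first by exists (x, y, z).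
by rewrite A_jet//; apply: rP.
Qed.

(** A tube argument: every jet of the segment is interior to [calU], and compactness of [0, 1] makes
    the margin uniform. It carries the segment hypothesis, known at one point, to the nearby points
    and gradients met in the contact argument. *)
Lemma segment_near x0 a0 p0 v0 :
  (forall t, 0 <= t <= 1 -> calU Gamma g (x0, a0, p0 + t *: v0)) ->
  exists2 r, 0 < r & forall x a p v, `|x - x0| < r -> `|a - a0| < r ->
    `|p - p0| < r -> `|v - v0| < r ->
    forall t, 0 <= t <= 1 -> calU Gamma g (x, a, p + t *: v).
Proof.
move=> seg; pose P (r t : R) := forall x a p v, `|x - x0| < r -> `|a - a0| < r ->
    `|p - p0| < r -> `|v - v0| < r -> calU Gamma g (x, a, p + t *: v).
have := (compact_near_coveringP _).1 (@segment_compact R 0 1) R (0 : R)^'+ P _.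
case.
  move=> t; rewrite /= in_itv/= => t01.
  have [[[x y] z] Gw [xE aE pE]] := seg t t01.
  have [r r0 rP] := A_near Gw ltr01.
  have v1 : 0 < 4 * (1 + `|v0|) by rewrite mulr_gt0// ltr_pwDl.
  have v00 : 0 <= `|v0| by [].
  near=> t' s; rewrite /P => x' a' p' v'.
  rewrite -[(t', s).1]/t' -[(t', s).2]/s => xs aS ps vs.
  have s4 : s < r / 4 by near: s; apply: nbhs_right_lt; rewrite divr_gt0.
  have s0 : 0 < s by near: s; exact: nbhs_right_gt.
  have tt : `|t' - t| < Num.min 1 (r / (4 * (1 + `|v0|))).
    rewrite distrC; near: t'; apply: cvgr_dist_lt; first exact: cvg_id.
    by rewrite lt_min ltr01 divr_gt0.
  move: tt; rewrite lt_min ltr_pdivlMr// => /andP[tt1 ttr].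
  have t2 : `|t'| < 2.
    by move: tt1 t01; rewrite ltr_distl => /andP[? ?] /andP[? ?]; rewrite ltr_norml; lra.
  have [] // := rP x' a' (p' + t' *: v').
  - by rewrite [x]xE; lra.
  - by rewrite aE; lra.
  - rewrite pE (_ : _ - _ = (p' - p0) + t' *: (v' - v0) + (t' - t) *: v0); last by row_ring.
    have n1 := ler_normD (p' - p0 + t' *: (v' - v0)) ((t' - t) *: v0).
    have n2 := ler_normD (p' - p0) (t' *: (v' - v0)).
    have n3 : `|t' *: (v' - v0)| <= 2 * s by rewrite normrZ ler_pM// ltW.
    have n4 : `|(t' - t) *: v0| <= r / 4.
      rewrite normrZ (@le_trans _ _ (`|t' - t| * (1 + `|v0|)))//; last by lra.
      by rewrite ler_wpM2l// lerDr.
    lra.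
move=> r /= r0 rP; exists (r / 2); first by rewrite divr_gt0.
move=> x a p v xr ar pr vr t t01.
have r2 : 0 < r / 2 by rewrite divr_gt0.
have b : ball_ Num.Def.normr 0 r (r / 2).
  by rewrite /ball_ /= sub0r normrN gtr0_norm//; lra.
exact: (rP _ b r2 t _ x a p v xr ar pr vr).
Unshelve. all: by end_near.
Qed.

End Jets.

(** * Contact of a perturbed g-affine function *)

(** An expansion up to e h^2 for every e already carries the conditions of a minimum, without
    derivatives of [m]. If a were nonzero, a small h of the opposite sign would make the linear term
    win; with a = 0, any small h gives 0 <= b + e. *)
Lemma second_order_minimum {R : realType} (m : R -> R) (a b : R) :
  (forall e, 0 < e -> \forall h \near (0 : R), `|m h - (h * a + h * h * b)| <= e * (h * h)) ->
  (\forall h \near (0 : R), 0 <= m h) -> a = 0 /\ 0 <= b.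
Proof.
move=> mE m0.
have key e : 0 < e -> exists2 r, 0 < r & forall h, `|h| < r -> 0 <= h * a + h * h * (b + e).
  move=> e0; have /nbhs_normP[r /= r0 rP] : \forall h \near (0 : R),
      `|m h - (h * a + h * h * b)| <= e * (h * h) /\ 0 <= m h.
    by apply: filterI; [exact: mE | exact: m0].
  exists r => // h hr.
  have [] := rP h; first by rewrite /= sub0r normrN.
  by rewrite ler_distl => /andP[h1 h2] h3; lra.
have a0 : a = 0.
  apply/eqP; apply/negPn/negP => an0.
  have [r r0 rP] := key 1 ltr01.
  pose B := 1 + `|b + 1|.
  have B0 : 0 < B by rewrite ltr_pwDl.
  have bB : b + 1 < B by rewrite /B; have := ler_norm (b + 1); lra.
  pose t := Num.min (r / 2) (`|a| / B / 2).
  have t0 : 0 < t by rewrite lt_min !divr_gt0// normr_gt0.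
  have tr : t <= r / 2 by rewrite ge_min lexx.
  have tB : t * B <= `|a| / 2.
    by rewrite -ler_pdivlMr// ge_min mulrAC lexx orbT.
  have [ap|an|az] := ltgtP 0 a.
  - have := rP (- t); rewrite normrN gtr0_norm// => /(_ ltac:(lra)).
    rewrite gtr0_norm// in tB.
    have -> : - t * a + - t * - t * (b + 1) = - (t * (a - t * (b + 1))) by ring.
    rewrite oppr_ge0 pmulr_rle0// subr_le0 => h.
    have : t * (b + 1) < t * B by rewrite ltr_pM2l.
    lra.
  - have := rP t; rewrite gtr0_norm// => /(_ ltac:(lra)).
    rewrite ltr0_norm// in tB.
    have -> : t * a + t * t * (b + 1) = t * (a + t * (b + 1)) by ring.
    rewrite pmulr_rge0// => h.
    have : t * (b + 1) < t * B by rewrite ltr_pM2l.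
    lra.
  - by move: an0; rewrite -az eqxx.
split=> //; apply/ler_addgt0Pr => e e0.
have [r r0 rP] := key e e0.
have h0 : 0 < r / 2 by rewrite divr_gt0.
have := rP (r / 2); rewrite gtr0_norm// => /(_ ltac:(lra)).
by rewrite a0 mulr0 add0r pmulr_rge0// mulr_gt0.
Qed.

(** * Real inequalities of the contact argument *)

Section RealInequalities.
Context {R : realType}.
Implicit Types a b c d e : R.

Lemma taylor_parabola_error (T D qd qv a nq c h E : R) :
  D = h * a - c * h * h * nq -> `|T - D - qd / 2| <= E / 2 ->
  `|qd - h * h * qv| <= E -> `|T - (h * a + h * h * (qv / 2 - c * nq))| <= E.
Proof.
by move=> ->; rewrite !ler_norml => /andP[? ?] /andP[? ?]; apply/andP; split; lra.
Qed.

Lemma convex_difference (t a2 a1 a0 b1 b0 c d : R) : 0 < t ->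
  a2 <= t * a1 + (1 - t) * a0 -> `|a1 - b1| <= c -> `|a0 - b0| <= c -> 2 * c <= d ->
  a2 - a0 <= t * (b1 - b0 + d).
Proof.
move=> t0 h1; rewrite !ler_norml => /andP[h2 h3] /andP[h4 h5] h6.
have m : a1 - a0 <= b1 - b0 + d by lra.
by have := ler_wpM2l (ltW t0) m; lra.
Qed.

(* [C * nn] exceeds [qz / 2] by [c * L / 8], which the errors on the other terms
   cannot compensate. *)
Lemma contact_inequality_false (t QT qt qz L T2 C nq nn d c : R) :
  0 < t -> 0 < c -> 0 < L -> 0 <= QT / 2 - C * nq ->
  QT <= t * (qt + c / 64 * T2) -> T2 <= 4 * L -> `|qt - qz| <= c / 32 * L ->
  `|nq - t * nn| <= d * t -> `|C| * d <= c / 64 * L ->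
  C * nn = (qz + c / 4 * L) / 2 -> False.
Proof.
move=> t0 c0 L0 pos QTle T2le; rewrite ler_norml => /andP[_ qle] nqle Cd Cnn.
have cL : 0 < c * L by rewrite mulr_gt0.
have h1 : - (C * (nq - t * nn)) <= c / 64 * L * t.
  rewrite (le_trans (ler_norm _))// normrN normrM.
  rewrite (le_trans (ler_wpM2l (normr_ge0 C) nqle))// mulrA.
  by rewrite ler_wpM2r// ltW.
have h2 : c / 64 * T2 <= c / 16 * L.
  have := ler_wpM2l (ltW c0) T2le; lra.
have h3 : qt + c / 64 * T2 <= qz + c / 32 * L + c / 16 * L by lra.
have h4 := ler_wpM2l (ltW t0) h3.
have h5 : t * (C * nn) = t * ((qz + c / 4 * L) / 2) by rewrite Cnn.
have : 0 < t * (c * L) by rewrite mulr_gt0.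
lra.
Qed.

(** The descent c L / 2 pays c L / 4 for the slope [be], c L / 16 for the curvature [C] and c L / 16
    for the offset [eta]; c L / 8 remains. *)
Lemma chord_slope (s be C nn q L c zn eta : R) : 0 < s ->
  be * nn = (q + c / 2 * L) / 2 -> zn + q / 2 <= - (c / 2 * L) ->
  - C * nn * s <= c * L / 16 -> eta * nn = s * (c * L) / 16 ->
  s * zn + (be * s - C * s * s + eta) * nn <= - (s * (c * L) / 8).
Proof.
move=> s0 benn h1 h2 etann.
have -> : s * zn + (be * s - C * s * s + eta) * nn =
    s * zn + s * (be * nn) + s * (- C * nn * s) + eta * nn by ring.
rewrite benn etann; have := ler_wpM2l (ltW s0) h1; have := ler_wpM2l (ltW s0) h2; lra.
Qed.

Lemma increment_bounds (u v m d : R) : `|u - v - m| <= d ->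
  v + (m - d) <= u <= v + (m + d).
Proof. by rewrite ler_norml => /andP[? ?]; apply/andP; split; lra. Qed.

Lemma chord_end_absurd (t b N k0 k1 m : R) : 0 < t -> 0 < m ->
  k0 + t * (b * N / 2) <= k1 -> k1 <= 0 -> `|k0| <= m / 64 * t -> m / 16 <= b * N -> False.
Proof.
move=> t0 m0 h1 h2; rewrite ler_norml => /andP[h3 _] h4.
have := ler_wpM2l (ltW t0) h4; have : 0 < t * m by rewrite mulr_gt0.
lra.
Qed.

Lemma chord_top_pos (t k0 k1 k2 a D e : R) : 0 < t -> 0 < D ->
  k1 + t * (D / 2) <= k2 -> k0 + (t * a - t * e) <= k1 -> `|k0| <= D / 64 * t ->
  `|a| + e <= D / 8 -> 0 < k2.
Proof.
move=> t0 D0 h1 h2; rewrite ler_norml => /andP[h3 _] h4.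
have h5 : - (D / 8) <= a - e by have := ler_norm (- a); rewrite normrN; lra.
have := ler_wpM2l (ltW t0) h5; have : 0 < t * D by rewrite mulr_gt0.
lra.
Qed.

Lemma chord_inside_neg (t k0 k1 a e m : R) : 0 < t -> 0 < m ->
  k1 <= k0 + (t * a + t * e) -> `|k0| <= m / 64 * t -> a <= - (m / 8) -> e <= m / 32 -> k1 <= 0.
Proof.
move=> t0 m0 h1; rewrite ler_norml => /andP[_ h3] h4 h5.
have := ler_wpM2l (ltW t0) h4; have := ler_wpM2l (ltW t0) h5; have : 0 < t * m by rewrite mulr_gt0.
lra.
Qed.

Lemma difference_error (g0 g0' g1 g1' a b d q m e N : R) :
  `|g0' - g0 - a| <= e / 4 * N -> `|g1' - g1 - b| <= e / 4 * N ->
  `|q| <= e / 2 * N -> m = q + d -> m = b - a ->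
  `|g1' - g0' - (g1 - g0) - d| <= e * N.
Proof.
rewrite !ler_norml => /andP[? ?] /andP[? ?] /andP[? ?] ? ?.
by apply/andP; split; lra.
Qed.

End RealInequalities.

(** * The perturbation of a g-affine function and its contact with a parabola *)

Section Contact.
Context {R : realType} {n : nat}.
Local Notation point := ('rV[R]_n * 'rV[R]_n * R)%type.
Context (Gamma : set point) (g : point -> R).
Hypothesis Gamma_open : open Gamma.
Hypothesis g_C2 : C2_on Gamma g.
Hypothesis gz_lt0 : forall w, Gamma w -> g_z g w < 0.
Hypothesis g_A1 : A1 Gamma g.
Hypothesis g_A2 : A2 Gamma g.
Hypothesis g_A3w : A3w Gamma g.

Lemma A3w_qform (x v p0 p1 : 'rV[R]_n) (a t : R) :
  segment p0 p1 `<=` calU_fiber Gamma g x a -> dot (p1 - p0) v = 0 -> 0 <= t <= 1 ->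
  qform (A Gamma g x a (t *: p1 + (1 - t) *: p0)) v <=
    t * qform (A Gamma g x a p1) v + (1 - t) * qform (A Gamma g x a p0) v.
Proof.
move=> seg orth /andP[t0 t1]; have := g_A3w seg orth; move: (A Gamma g x a) => M.
have p0s : p0 \in segment p0 p1.
  by rewrite inE; exists 0; rewrite ?lexx ?ler01//; row_ring.
have p1s : p1 \in segment p0 p1.
  by rewrite inE; exists 1; rewrite ?lexx ?ler01//; row_ring.
have conv_le (f : 'rV[R]_n -> R) : convex_function (segment p0 p1) f ->
    f (t *: p1 + (1 - t) *: p0) <= t * f p1 + (1 - t) * f p0.
  by move=> cf; exact: cf (Itv01 t0 t1) _ _ p1s p0s.
have -> : (fun p => dot (v *m (M p)^T) v) = (fun p => qform (M p) v).
  by apply/funext => p; rewrite dot_trmx.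
exact: conv_le.
Qed.

Local Opaque g_x g_xx.

Context (x0 y0 y1 : 'rV[R]_n) (z0 z1 : R).
Let w0 : point := (x0, y0, z0).
Let w1 : point := (x0, y1, z1).
Hypothesis Gw0 : Gamma w0.
Hypothesis Gw1 : Gamma w1.
Hypothesis g01 : g w1 = g w0.
Let nu := g_x g w1 - g_x g w0.
Hypothesis nu0 : nu != 0.
Hypothesis seg_U : segment (g_x g w0) (g_x g w1) `<=` calU_fiber Gamma g x0 (g w0).

(* The direction in which to move [(y0, z0)] so that the gradient at [x0] moves
   towards [g_x g w1] while the value at [x0] is stationary. *)
Let yd := nu *m invmx (E g w0)^T.
Let zd := dot (Q g w0) yd.
Let yt (t : R) := y0 + t *: yd.
Let zt (t : R) := z0 + t * zd.
Let k (t : R) x := g (x, yt t, zt t) - g (x, y0, z0).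
Let q (t : R) x := g_x g (x, yt t, zt t) - g_x g (x, y0, z0).
Let d1 : R := 1 + `|yd| + `|zd|.

Lemma d1_gt0 : 0 < d1.
Proof. by rewrite /d1 -addrA ltr_pwDl// addr_ge0. Qed.

Lemma step_yzE (x : 'rV[R]_n) (t : R) :
  (x, yt t, zt t) - (x, y0, z0) = (0, t *: yd, t * zd) :> point.
Proof.
rewrite -[LHS]/(x - x, yt t - y0, zt t - z0) subrr /yt /zt.
by rewrite [y0 + _]addrC [z0 + _]addrC !addrK.
Qed.

Lemma step_yz_norm (x : 'rV[R]_n) (t : R) : 0 <= t ->
  `|((x, yt t, zt t) : point) - (x, y0, z0)| <= t * d1.
Proof.
move=> t0; rewrite step_yzE /d1; have yd0 : 0 <= `|yd| by []. have zd0 : 0 <= `|zd| by [].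
have h1 : 0 <= t * `|yd| by rewrite mulr_ge0.
have h2 : 0 <= t * `|zd| by rewrite mulr_ge0.
apply: point_norm_le => /=; rewrite ?normr0 ?normrZ ?normrM ?(ger0_norm t0); lra.
Qed.

(** With zd = Q.yd, the rate of change of [g_x] along (0, yd, zd) is yd E^T, and yd was defined as
    the solution of yd E^T = nu. *)
Lemma yz_direction : yd *m (g_xy g w0)^T + zd *: g_xz g w0 = nu.
Proof.
have uE : (E g w0)^T \in unitmx by rewrite unitmx_tr unitmxE unitfE g_A2.
have <- : yd *m (E g w0)^T = nu by rewrite /yd (mulmxKV uE).
rewrite mulmx_trE; congr (_ + _); rewrite -scaleNr; congr (_ *: _).
by rewrite /zd /Q dotNl dotZl [dot yd _]dotC.
Qed.

(** Strict differentiability of [g_x] at [w0] makes the error o(t) uniform in x near [x0], which is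
    needed because the contact point is not known in advance. *)
Lemma q_near (e : R) : 0 < e -> exists2 r, 0 < r & forall x t,
  `|x - x0| < r -> 0 < t < r ->
  [/\ Gamma (x, y0, z0), Gamma (x, yt t, zt t) & `|q t x - t *: nu| <= e * t].
Proof.
move=> e0; have [r r0 rP] := gx_strict Gamma_open g_C2 Gw0 (divr_gt0 e0 d1_gt0).
have [r1 r10 rG] := Gamma_near Gamma_open g_C2 Gw0.
pose s := Num.min r r1 / 2 / d1.
have m0 : 0 < Num.min r r1 by rewrite lt_min r0.
have mr : Num.min r r1 <= r by rewrite ge_min lexx.
have mr1 : Num.min r r1 <= r1 by rewrite ge_min lexx orbT.
have d10 := d1_gt0.
have sd : s * d1 = Num.min r r1 / 2 by rewrite /s divfK ?gt_eqF.
exists (Num.min s (Num.min r r1 / 2)); first by rewrite lt_min !divr_gt0.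
move=> x t; rewrite !lt_min => /andP[_ xm] /and3P[t0 ts _].
have wr : `|((x, y0, z0) : point) - w0| < Num.min r r1 / 2 by rewrite normB_x.
have st := step_yz_norm x (ltW t0).
have td : t * d1 < s * d1 by rewrite ltr_pM2r.
have wr' : `|((x, yt t, zt t) : point) - w0| < Num.min r r1.
  rewrite -(subrK (x, y0, z0) (x, yt t, zt t)) -addrA.
  by rewrite (le_lt_trans (ler_normD _ _))//; lra.
split; [by apply: rG; lra | by apply: rG; lra|].
have := rP (x, y0, z0) (x, yt t, zt t) ltac:(lra) ltac:(lra).
have -> : gx_linear_part g w0 ((x, yt t, zt t) - (x, y0, z0)) = t *: nu.
  rewrite step_yzE /gx_linear_part /= mul0mx add0r -yz_direction -scalemxAl.
  by rewrite scalerDr scalerA.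
move=> /le_trans; apply.
rewrite (@le_trans _ _ (e / d1 * (t * d1)))//.
  by rewrite ler_wpM2l// divr_ge0// ltW.
by rewrite le_eqVlt; apply/orP; left; apply/eqP; field; rewrite gt_eqF.
Qed.

Lemma k_increment (e : R) : 0 < e -> exists2 r, 0 < r & forall x x' t,
  `|x - x0| < r -> `|x' - x0| < r -> 0 < t < r ->
  `|k t x' - k t x - t * dot (x' - x) nu| <= e * t * `|x' - x|.
Proof.
move=> e0; have N0 : 0 < 1 + n%:R :> R by rewrite ltr_pwDl.
have [r r0 rP] := q_near (divr_gt0 e0 N0).
exists r => // x x' t xr xr' tr; set d := x' - x.
have sr s : 0 <= s <= 1 -> `|x + s *: d - x0| < r.
  move=> /andP[s0 s1]; have -> : x + s *: d - x0 = (1 - s) *: (x - x0) + s *: (x' - x0).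
    by rewrite /d; row_ring.
  rewrite (le_lt_trans (ler_normD _ _))// !normrZ !ger0_norm// ?subr_ge0//.
  have [->|s00] := eqVneq s 0; first by rewrite subr0 mul1r mul0r addr0.
  have sp : 0 < s by rewrite lt_neqAle eq_sym s00.
  have h1 : s * `|x' - x0| < s * r by rewrite ltr_pM2l.
  have h2 : (1 - s) * `|x - x0| <= (1 - s) * r by rewrite ler_wpM2l ?subr_ge0// ltW.
  lra.
have line y z s : (x, y, z) + s *: (d, 0, 0) = (x + s *: d, y, z) :> point.
  by rewrite -[LHS]/(_, _, _) /= !scaler0 !addr0.
have gd y z s : Gamma (x + s *: d, y, z) ->
    is_derive s (1 : R) (fun u => g (x + u *: d, y, z)) (dot d (g_x g (x + s *: d, y, z))).
  move=> Gs; have H : derivable g ((x, y, z) + s *: (d, 0, 0)) (d, 0, 0).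
    by rewrite line; apply: (g_C2.1 _).1.
  have := is_derive_line H; rewrite line.
  rewrite (derive_linear_part _ Gamma_open g_C2.1 Gs) /linear_part /= dot0l mul0r !addr0.
  by rewrite (_ : (fun u => g (_ + u *: _)) = (fun u => g (x + u *: d, y, z)))//;
    apply/funext => u; rewrite line.
have := @mean_value_bound R
  (fun s => g (x + s *: d, yt t, zt t) - g (x + s *: d, y0, z0) - (s * (t * dot d nu) + s * s * 0))
  (fun s => dot d (q t (x + s *: d) - t *: nu)) 0 1 (e * t * `|d|) ler01.
rewrite !mulr0 !addr0 mul1r mul0r !scale1r scale0r addr0 !subr0 mulr1.
have xd : x + d = x' by rewrite /d addrC subrK.
rewrite xd => h; rewrite /k addrAC; apply: h.
- move=> s s01; have [G0 Gt qt] := rP _ _ (sr s s01) tr.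
  have Hq := is_derive_quadratic s (t * dot d nu) 0.
  apply: (is_derive_eq (is_deriveB (is_deriveB (gd _ _ _ Gt) (gd _ _ _ G0)) Hq)).
  have qE : dot d (q t (x + s *: d)) = dot d (g_x g (x + s *: d, yt t, zt t)) -
      dot d (g_x g (x + s *: d, y0, z0)) by rewrite /q dotBr.
  by rewrite mulr0 addr0 [in RHS]dotBr dotZr qE.
- move=> s s01; have [G0 Gt qt] := rP _ _ (sr s s01) tr.
  rewrite (le_trans (dot_le _ _))//.
  rewrite (@le_trans _ _ (n%:R * (`|d| * (e / (1 + n%:R) * t))))//.
    by rewrite ler_wpM2l// ler_wpM2l.
  have t0 : 0 <= t by case/andP: tr => /ltW.
  have -> : n%:R * (`|d| * (e / (1 + n%:R) * t)) = (n%:R / (1 + n%:R)) * (e * t * `|d|).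
    by field; rewrite gt_eqF.
  rewrite ler_piMl ?mulr_ge0// ?(ltW e0)//.
  by rewrite ler_pdivrMr// mul1r lerDr.
Qed.

(** At t = 0 the derivative of [k t x] in t is g_y.yd + g_z zd = g_z (Q(x0) - Q(x)).yd, which the
    hypothesis makes zero. The radius depends on x. *)
Lemma k_stationary x (e : R) : Gamma (x, y0, z0) ->
  dot (Q g (x, y0, z0) - Q g w0) yd = 0 -> 0 < e ->
  exists2 r, 0 < r & forall t, 0 < t < r -> `|k t x| <= e * t.
Proof.
move=> Gx Qx e0; set w := (x, y0, z0).
have d10 := d1_gt0.
have [r r0 rP] := g_strict Gamma_open g_C2 Gx (divr_gt0 e0 d10).
exists (r / d1); first exact: divr_gt0.
move=> t /andP[t0]; rewrite ltr_pdivlMr// => td.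
have st := step_yz_norm x (ltW t0).
have := rP w (x, yt t, zt t); rewrite subrr normr0 => /(_ r0 (le_lt_trans st td)).
have -> : linear_part g w ((x, yt t, zt t) - w) = 0.
  have gz0 : g_z g w != 0 by rewrite lt_eqF// gz_lt0.
  have gyE : g_y g w = - (g_z g w *: Q g w).
    by rewrite /Q scalerN opprK scalerA divff// scale1r.
  rewrite step_yzE /linear_part /= dot0l add0r gyE dotNr dotZl dotZr.
  move: Qx; rewrite dotBl -/w => /eqP; rewrite subr_eq0 => /eqP Qx.
  by rewrite /zd -Qx [dot yd _]dotC; ring.
rewrite subr0 => /le_trans; apply.
rewrite (@le_trans _ _ (e / d1 * (t * d1)))//.
  by rewrite ler_wpM2l// divr_ge0// ltW.
by rewrite le_eqVlt; apply/orP; left; apply/eqP; field; rewrite gt_eqF.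
Qed.

Let B := g_xx g w1 - g_xx g w0.
Let dxx (t : R) x := g_xx g (x, yt t, zt t) - g_xx g (x, y0, z0).

(* This is where A3w enters: the gradient at [x] of the perturbed function is
   the point of parameter [t] on a segment starting at [g_x g (x, y0, z0)] and
   ending near [g_x g w1]. *)
Lemma k_hessian (e : R) : 0 < e -> exists2 r, 0 < r & forall x t v,
  `|x - x0| < r -> 0 < t < r -> k t x = 0 -> dot v (q t x) = 0 ->
  qform (dxx t x) v <= t * (qform B v + e * `|v| ^+ 2).
Proof.
move=> e0; have N0 : 0 < 1 + 2 * (n%:R * n%:R) :> R by rewrite ltr_pwDl// !mulr_ge0.
have e10 := divr_gt0 e0 N0.
have ce (v : 'rV[R]_n) :
    2 * (n%:R * n%:R * (e / (1 + 2 * (n%:R * n%:R))) * `|v| ^+ 2) <= e * `|v| ^+ 2.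
  have -> : 2 * (n%:R * n%:R * (e / (1 + 2 * (n%:R * n%:R))) * `|v| ^+ 2) =
      2 * (n%:R * n%:R) / (1 + 2 * (n%:R * n%:R)) * (e * `|v| ^+ 2).
    by field; rewrite gt_eqF.
  rewrite ler_piMl ?mulr_ge0 ?exprn_ge0// ?(ltW e0)//.
  by rewrite ler_pdivrMr// mul1r lerDr.
have [rA rA0 AP] := A_near Gamma_open g_C2 gz_lt0 g_A1 g_A2 Gw1 e10.
have [rS rS0 SP] : exists2 r, 0 < r & forall x a p v, `|x - x0| < r ->
    `|a - g w0| < r -> `|p - g_x g w0| < r -> `|v - nu| < r ->
    forall t, 0 <= t <= 1 -> calU Gamma g (x, a, p + t *: v).
  apply: (segment_near Gamma_open g_C2 gz_lt0 g_A1 g_A2) => t t01.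
  by apply: seg_U; exists t => //; rewrite /nu; row_ring.
pose s := Num.min rA rS / 2.
have s0 : 0 < s by rewrite divr_gt0// lt_min rA0.
have sA : s * 2 <= rA by rewrite divfK// ge_min lexx.
have sS : s * 2 <= rS by rewrite divfK// ge_min lexx orbT.
have sA1 : s < rA by lra.
have sS1 : s < rS by lra.
have [rq rq0 qP] := q_near (divr_gt0 s0 (ltr0Sn R 1)).
have [rg rg0 gP] := gxx_near Gamma_open g_C2 Gw0 e10.
have [C1 [r1 [C10 r10 P1]]] := gx_lipschitz Gamma_open g_C2 Gw0.
have [C2 [r2 [C20 r20 P2]]] := g_lipschitz Gamma_open g_C2 Gw0.
exists (Num.min (Num.min (Num.min 1 rq) (Num.min rg s))
    (Num.min (Num.min r1 r2) (Num.min (s / C1) (s / C2)))).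
  by rewrite !lt_min ltr01 rq0 rg0 s0 r10 r20 (divr_gt0 s0 C10) (divr_gt0 s0 C20).
move=> x t v; rewrite !lt_min => /andP[/andP[/andP[_ xq] /andP[xg xs]]
  /andP[/andP[xr1 xr2] /andP[xC1 xC2]]].
move=> /andP[t0 /andP[/andP[/andP[t1 tq] _] _]] kt vq.
have tq' : 0 < t < rq by rewrite t0.
have [G0 Gt qt] := qP x t xq tq'.
(* [p1] is chosen so that the point of parameter t between [p0] and [p1] is the gradient of the
   moved function. It need not be the gradient of a given function; it is only close to [g_x g w1],
   because q / t is close to nu. *)
pose p0 := g_x g (x, y0, z0); pose dir := t^-1 *: q t x; pose p1 := p0 + dir.
have tn0 : t != 0 by rewrite gt_eqF.
have dirn : `|dir - nu| < s.
  have -> : dir - nu = t^-1 *: (q t x - t *: nu).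
    by rewrite scalerBr scalerA mulVf// scale1r.
  rewrite normrZ gtr0_norm ?invr_gt0// mulrC ltr_pdivrMr//.
  by rewrite (le_lt_trans qt)// ltr_pM2r//; lra.
have w00 (r : R) : 0 < r -> `|w0 - w0| < r by rewrite subrr normr0.
have p0n : `|p0 - g_x g w0| < s.
  rewrite (le_lt_trans (P1 w0 (x, y0, z0) (w00 _ r10) _)) ?normB_x//.
  by rewrite mulrC -ltr_pdivlMr.
have an : `|g (x, y0, z0) - g w0| < s.
  rewrite (le_lt_trans (P2 w0 (x, y0, z0) (w00 _ r20) _)) ?normB_x//.
  by rewrite mulrC -ltr_pdivlMr.
have p1n : `|p1 - g_x g w1| < s * 2.
  have -> : p1 - g_x g w1 = (p0 - g_x g w0) + (dir - nu) by rewrite /p1 /nu; row_ring.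
  by rewrite mulr2n mulrDr mulr1 (le_lt_trans (ler_normD _ _))// ltrD.
have [Up1 Ap1] : calU Gamma g (x, g (x, y0, z0), p1) /\
    forall i j, `|(A Gamma g x (g (x, y0, z0)) p1 - g_xx g w1) i j| <= e / (1 + 2 * (n%:R * n%:R)).
  apply: AP; rewrite ?g01; [exact: lt_trans sA1|exact: lt_trans sA1|exact: lt_le_trans sA].
have seg : segment p0 p1 `<=` calU_fiber Gamma g x (g (x, y0, z0)).
  move=> p [u u01 ->].
  have -> : (1 - u) *: p0 + u *: p1 = p0 + u *: dir by rewrite /p1; row_ring.
  by apply: SP => //; exact: lt_trans sS1.
have orth : dot (p1 - p0) v = 0.
  have -> : p1 - p0 = t^-1 *: q t x by rewrite /p1 /dir; row_ring.
  by rewrite dotZl dotC vq mulr0.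
have t01 : 0 <= t <= 1 by rewrite !ltW.
have := A3w_qform seg orth t01.
(* As [k t x = 0], both functions have the value g(x, y0, z0) at x. Hence [A] at the parameters 0
   and t is exactly [g_xx] at (x, y0, z0) and (x, yt, zt); only at [p1] is it replaced by a nearby
   value. *)
have -> : t *: p1 + (1 - t) *: p0 = g_x g (x, yt t, zt t).
  have -> : t *: p1 + (1 - t) *: p0 = p0 + (t * t^-1) *: q t x by rewrite /p1 /dir; row_ring.
  by rewrite divff// scale1r /p0 /q addrC subrK.
have Ap0 : A Gamma g x (g (x, y0, z0)) p0 = g_xx g (x, y0, z0).
  exact: A_jet g_A1 _ _ _ G0.
have gE : g (x, y0, z0) = g (x, yt t, zt t).
  by move/eqP: kt; rewrite /k subr_eq0 => /eqP.
have -> : A Gamma g x (g (x, y0, z0)) (g_x g (x, yt t, zt t)) = g_xx g (x, yt t, zt t).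
  rewrite gE; exact: A_jet g_A1 _ _ _ Gt.
rewrite Ap0 => h.
have e1n : 0 <= e / (1 + 2 * (n%:R * n%:R)) := ltW e10.
have wg : `|((x, y0, z0) : point) - w0| < rg by rewrite normB_x.
have hA := qform_sub_le v e1n Ap1.
have hB := qform_sub_le v e1n (gP _ wg).
have E1 := qformB (g_xx g (x, yt t, zt t)) (g_xx g (x, y0, z0)) v.
have E2 := qformB (g_xx g w1) (g_xx g w0) v.
have fin := convex_difference t0 h hA hB (ce v).
exact: (eq_ind_r (fun u => u <= _) (eq_ind_r (fun u => _ <= t * (u + _)) fin E2) E1).
Qed.

(** These are the first and second order conditions along the curve h v - c h^2 nu. The first one is
    the orthogonality that A3w requires. *)
Lemma parabola_contact x t v c : Gamma (x, y0, z0) -> Gamma (x, yt t, zt t) ->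
  k t x = 0 ->
  (\forall h \near (0 : R), 0 <= k t (x + (h *: v - (c * h * h) *: nu))) ->
  dot v (q t x) = 0 /\ 0 <= qform (dxx t x) v / 2 - c * dot nu (q t x).
Proof.
move=> G0 Gt kt pos.
apply: (second_order_minimum _ pos) => e e0.
have [b b0 bP] := qform_bounded (dxx t x).
pose W : R := `|c| * `|nu|; pose S : R := `|v| + W.
have W0 : 0 <= W by rewrite mulr_ge0.
have v0 : 0 <= `|v| by [].
have S0 : 0 <= S by rewrite addr_ge0.
have S1 : 0 < 1 + S by rewrite ltr_pwDl.
have e10 : 0 < e / (2 * (1 + S) ^+ 2) by rewrite divr_gt0// mulr_gt0// exprn_gt0.
have [r r0 rP] := taylor_x_sub Gamma_open g_C2 Gt G0 e10.
have bSW : 0 < 1 + b * S * W by rewrite ltr_pwDl// !mulr_ge0// ltW.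
have hr : \forall h \near (0 : R), `|h| < Num.min 1 (Num.min (r / (1 + S)) (e / (1 + b * S * W))).
  have m0 : 0 < Num.min 1 (Num.min (r / (1 + S)) (e / (1 + b * S * W))).
    by rewrite !lt_min ltr01 (divr_gt0 r0 S1) (divr_gt0 e0 bSW).
  by apply/nbhs_normP; exists (Num.min 1 (Num.min (r / (1 + S)) (e / (1 + b * S * W)))) => //= h /=;
    rewrite sub0r normrN.
near=> h.
have : `|h| < Num.min 1 (Num.min (r / (1 + S)) (e / (1 + b * S * W))) by near: h.
rewrite !lt_min => /and3P[h1 hrS heb].
rewrite ltr_pdivlMr// in hrS; rewrite ltr_pdivlMr// in heb.
have h0 : 0 <= `|h| by [].
pose w := - ((c * h * h) *: nu).
have wn : `|w| = `|h| * `|h| * W.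
  by rewrite /w normrN normrZ !normrM /W; ring.
have hvn : `|h *: v| = `|h| * `|v| by rewrite normrZ.
have hh1 : `|h| * `|h| <= `|h| by rewrite ler_piMl// ltW.
have wn' : `|w| <= `|h| * W by rewrite wn ler_wpM2r.
have dn : `|h *: v + w| <= `|h| * S.
  by rewrite (le_trans (ler_normD _ _))// hvn mulrDr lerD2l.
have dr : `|h *: v + w| < r.
  by rewrite (le_lt_trans dn)// (le_lt_trans _ hrS)// ler_wpM2l// lerDr.
have := rP _ dr; rewrite -/(k t x) kt subr0 -/(q t x) -/(dxx t x) -/(k t (x + (h *: v + w))).
have hhE : h * h = `|h| * `|h| by rewrite -normrM ger0_norm// -expr2 sqr_ge0.
have E1 : e / (2 * (1 + S) ^+ 2) * `|h *: v + w| ^+ 2 <= e * (h * h) / 2.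
  have le1 : `|h *: v + w| <= `|h| * (1 + S).
    by apply: (le_trans dn); rewrite ler_wpM2l// lerDr ler01.
  have -> : e * (h * h) / 2 = e / (2 * (1 + S) ^+ 2) * (`|h| * (1 + S)) ^+ 2.
    by rewrite hhE; field; rewrite gt_eqF.
  by rewrite ler_wpM2l ?(ltW e10)// !expr2 ler_pM.
move=> /le_trans/(_ E1) T1.
have := bP (h *: v) w; rewrite qformZ.
have E2 : b * (`|h *: v| + `|w|) * `|w| <= e * (h * h).
  rewrite (@le_trans _ _ (b * (`|h| * S) * (`|h| * `|h| * W)))//.
    rewrite ler_pM ?mulr_ge0 ?addr_ge0 ?(ltW b0)// ?wn//.
    by rewrite ler_wpM2l ?(ltW b0)// hvn -wn mulrDr lerD2l.
  rewrite hhE (_ : b * _ * _ = `|h| * (b * S * W) * (`|h| * `|h|)); last by ring.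
  rewrite ler_wpM2r ?mulr_ge0// ltW// (le_lt_trans _ heb)// ler_wpM2l// lerDr.
  exact: ler01.
move=> /le_trans/(_ E2) T2.
have D : dot (h *: v + w) (q t x) = h * dot v (q t x) - c * h * h * dot nu (q t x).
  by rewrite dotDl /w dotNl !dotZl.
exact: taylor_parabola_error D T1 T2.
Unshelve. all: by end_near.
Qed.

Let nn := dot nu nu.

(* In the plane through [x0] spanned by [z] and [nu], the zero set of
   [g(., y1, z1) - g(., y0, z0)] is, to second order, a graph
   [s *: z + (a * s - par 0 z * s ^+ 2) *: nu]; positive values of the first
   argument increase the curvature. *)
Let par (a : R) (z : 'rV[R]_n) : R := (qform B z + a * `|z| ^+ 2) / (2 * nn).

Lemma nn_gt0 : 0 < nn.
Proof. exact: dot_gt0. Qed.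

Lemma nu_norm_gt0 : 0 < `|nu|.
Proof. by rewrite normr_gt0. Qed.

Lemma par_nn a z : par a z * nn = (qform B z + a * `|z| ^+ 2) / 2.
Proof. by rewrite /par; field; rewrite gt_eqF// nn_gt0. Qed.

Lemma par_bounded c : 0 < c -> exists2 K, 0 < K & forall a z, 0 <= a <= c ->
  `|par a z| <= K * `|z| ^+ 2.
Proof.
move=> c0; have [b b0 bP] := qform_bounded B; have nn0 := nn_gt0.
exists ((b + c) / (2 * nn)); first by rewrite divr_gt0 ?addr_gt0// mulr_gt0.
move=> a z /andP[a0 ac]; rewrite /par normrM (@ger0_norm _ (2 * nn)^-1); last first.
  by rewrite invr_ge0 mulr_ge0// ltW.
rewrite mulrAC ler_wpM2r ?invr_ge0 ?mulr_ge0// ?(ltW nn0)//.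
have qB0 : qform B 0 = 0 by rewrite qformE mul0mx dot0l.
have := bP 0 z; rewrite add0r qB0 subr0 normr0 add0r -mulrA -expr2 => h.
rewrite (le_trans (ler_normD _ _))// mulrDl lerD// normrM (ger0_norm a0).
by rewrite ger0_norm ?exprn_ge0// ler_wpM2r// exprn_ge0.
Qed.

(** With C = par (c / 4) z, contact forces the Hessian of [k t] in the direction z + w to be at
    least 2 C nu.q, which is about t (qform B z + c / 4 |z|^2), while [k_hessian] bounds it by t
    (qform B (z + w) + c / 64 |z + w|^2). As w is a multiple of nu of size O(|z|^2), replacing z + w
    by z in B costs only o(|z|^2). *)
Lemma contact_contradiction c : 0 < c -> exists2 r, 0 < r & forall z x t s,
  z != 0 -> `|z| < r -> `|x - x0| < r -> 0 < t < r -> 0 <= s <= 1 -> k t x = 0 ->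
  ~ (\forall h \near (0 : R), 0 <= k t (x +
     (h *: (z + (par (c / 2) z - 2 * par (c / 4) z * s) *: nu)
       - (par (c / 4) z * h * h) *: nu))).
Proof.
move=> c0; have nn0 := nn_gt0; have V0 := nu_norm_gt0.
have [K K0 KP] := par_bounded c0.
have [b b0 bP] := qform_bounded B.
set V : R := `|nu| in V0.
have c64 : 0 < c / 64 by rewrite divr_gt0.
have c4 : 0 <= c / 4 <= c by apply/andP; split; lra.
have c2 : 0 <= c / 2 <= c by apply/andP; split; lra.
pose D := K * (n%:R * V) + 1.
have D0 : 0 < D by rewrite ltr_wpDl// !mulr_ge0// ltW.
pose e3 := c / 64 / D.
have e30 : 0 < e3 by rewrite divr_gt0.
have [r1 r10 P1] := k_hessian c64.
have [r2 r20 P2] := q_near e30.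
have KV : 0 < 3 * K * V by rewrite !mulr_gt0.
have bKV : 0 < 192 * b * K * V by rewrite !mulr_gt0.
(* The bound 1 / (3 K V) ensures |w| <= |z|; the bound c / (192 b K V) keeps qform B (z + w) within
   c / 32 |z|^2 of qform B z. *)
exists (Num.min (Num.min r1 r2) (Num.min (1 / (3 * K * V)) (c / (192 * b * K * V)))).
  by rewrite !lt_min r10 r20 (divr_gt0 ltr01 KV) (divr_gt0 c0 bKV).
move=> z x t s zn0; rewrite !lt_min => /andP[_ /andP[zK zb]] /andP[/andP[xr1 xr2] _].
move=> /andP[t0 /andP[/andP[t1 t2] _]] /andP[s0 s1] kt near0.
have [G0 Gt qt] := P2 x t xr2 (introT andP (conj t0 t2)).
move: near0; set C := par (c / 4) z; set be := par (c / 2) z.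
set w := (be - 2 * C * s) *: nu => near0.
have L0 : 0 < `|z| ^+ 2 by rewrite exprn_gt0// normr_gt0.
have zn : 0 < `|z| by rewrite normr_gt0.
have CK : `|C| <= K * `|z| ^+ 2 by apply: KP.
have beK : `|be| <= K * `|z| ^+ 2 by apply: KP.
have Cnn : C * nn = (qform B z + c / 4 * `|z| ^+ 2) / 2.
  exact: par_nn.
clearbody C be.
have wn : `|w| <= 3 * K * V * `|z| ^+ 2.
  rewrite normrZ -/V (_ : 3 * K * V * _ = 3 * (K * `|z| ^+ 2) * V); last by ring.
  rewrite ler_wpM2r ?(ltW V0)// (le_trans (ler_normB _ _))//.
  rewrite !normrM (ger0_norm s0) (@ger0_norm _ 2)//.
  have -> : 3 * (K * `|z| ^+ 2) = K * `|z| ^+ 2 + 2 * (K * `|z| ^+ 2) by ring.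
  by rewrite lerD// -mulrA ler_wpM2l// (le_trans _ CK)// ler_piMr.
have wz : `|w| <= `|z|.
  rewrite (le_trans wn)// expr2 mulrA -[leRHS]mul1r ler_wpM2r//.
  by move: zK; rewrite ltr_pdivlMr// mulrC => /ltW.
have [vq pos] := parabola_contact G0 Gt kt near0.
have H := P1 x t _ xr1 (introT andP (conj t0 t1)) kt vq.
apply: (contact_inequality_false t0 c0 L0 pos H (qz := qform B z)
  (d := n%:R * (V * e3)) (nn := nn)).
- rewrite (@le_trans _ _ ((`|z| + `|z|) ^+ 2))//.
    rewrite !expr2 ler_pM// (le_trans (ler_normD _ _))// lerD2l//.
  rewrite le_eqVlt; apply/orP; left; apply/eqP; ring.
- rewrite (le_trans (bP z w))//.
  rewrite (@le_trans _ _ (b * (`|z| + `|z|) * (3 * K * V * `|z| ^+ 2)))//.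
    by rewrite ler_pM ?mulr_ge0 ?addr_ge0 ?(ltW b0)// ler_wpM2l ?(ltW b0)// lerD2l.
  rewrite (_ : b * _ * _ = `|z| * (192 * b * K * V) / 32 * `|z| ^+ 2); last by field.
  rewrite ler_wpM2r ?(ltW L0)// ler_wpM2r ?invr_ge0//.
  by move: zb; rewrite ltr_pdivlMr// => /ltW.
- rewrite -[nn]/(dot nu nu) -dotZr -dotBr (le_trans (dot_le _ _))//.
  have -> : n%:R * (V * e3) * t = n%:R * (V * (e3 * t)) by rewrite -[LHS]mulrA -[V * e3 * t]mulrA.
  by rewrite ler_wpM2l// ler_wpM2l.
- rewrite (le_trans (ler_wpM2r _ CK))//.
    exact: mulr_ge0 (ler0n _ _) (mulr_ge0 (ltW V0) (ltW e30)).
  rewrite (_ : K * _ * _ = (K * (n%:R * V)) / D * (c / 64 * `|z| ^+ 2)); last first.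
    by rewrite /e3; field; rewrite gt_eqF.
  rewrite ler_piMl//; first exact: mulr_ge0 (ltW c64) (ltW L0).
  by rewrite ler_pdivrMr// mul1r lerDl ler01.
- exact: Cnn.
Qed.

(* In the plane through [x0] spanned by [z] and [nu], the zero set of [k t] passes
   near [x0] and near [x0 + z], and above the chord in between because of the
   slope that the last hypothesis forces on it at [x0]: a parabola of curvature
   [par (c / 4) z] then touches it at an interior point. *)
Lemma contact_exists c r : 0 < c -> 0 < r -> exists2 rho, 0 < rho & forall z,
  z != 0 -> `|z| < rho -> dot (Q g (x0 + z, y0, z0) - Q g w0) yd = 0 ->
  dot z nu + qform B z / 2 <= - (c / 2 * `|z| ^+ 2) ->
  exists x t s, [/\ `|x - x0| < r, 0 < t < r, 0 <= s <= 1, k t x = 0 &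
    \forall h \near (0 : R), 0 <= k t (x + (h *: (z + (par (c / 2) z - 2 * par (c / 4) z * s) *: nu)
       - (par (c / 4) z * h * h) *: nu))].
Proof.
move=> c0 r0; have nn0 := nn_gt0; have V0 := nu_norm_gt0.
have [K K0 KP] := par_bounded c0.
have c4 : 0 <= c / 4 <= c by apply/andP; split; lra.
have c2 : 0 <= c / 2 <= c by apply/andP; split; lra.
set V : R := `|nu| in V0.
pose e5 := nn / (2 * V).
have e50 : 0 < e5 by rewrite divr_gt0// mulr_gt0.
have [r5 r50 P5] := k_increment e50.
have [rq rq0 Pq] := q_near ltr01.
pose R0 := Num.min r (Num.min r5 rq).
have R00 : 0 < R0 by rewrite !lt_min r0 r50 rq0.
have R0r : R0 <= r by rewrite !ge_min lexx.
have R05 : R0 <= r5 by rewrite !ge_min lexx ?orbT.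
have R0q : R0 <= rq by rewrite !ge_min lexx ?orbT.
pose rp := R0 / (2 * (1 + V)).
have V1 : 0 < 1 + V by rewrite addr_gt0.
have rp0 : 0 < rp by rewrite divr_gt0// mulr_gt0.
have rpV : rp * V < R0 / 2.
  rewrite (@lt_le_trans _ _ (rp * (1 + V)))//; first by rewrite ltr_pM2l// ltrDr.
  by rewrite le_eqVlt /rp; apply/orP; left; apply/eqP; field; rewrite gt_eqF.
clearbody R0 rp.
pose NV := n%:R * V + e5.
have NV0 : 0 < NV by rewrite ltr_wpDl// mulr_ge0// ltW.
exists (Num.min (Num.min 1 (R0 / 2)) (Num.min (rp * nn / (8 * NV))
  (Num.min (rp * nn / c) (rp / (4 * K))))).
  rewrite !lt_min ltr01 (divr_gt0 R00)// (divr_gt0 (mulr_gt0 rp0 nn0) (mulr_gt0 _ NV0))//.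
  by rewrite (divr_gt0 (mulr_gt0 rp0 nn0) c0) (divr_gt0 rp0 (mulr_gt0 _ K0)).
move=> z zn0; rewrite !lt_min => /andP[/andP[zle1 zR] /and3P[zNV zc zK]] Qz z_descent.
have zp : 0 < `|z| by rewrite normr_gt0.
set L := `|z| ^+ 2 in z_descent *.
have L0 : 0 < L by rewrite exprn_gt0.
have Lz : L <= `|z| by rewrite /L expr2 ler_piMl// ltW.
set C := par (c / 4) z; set be := par (c / 2) z.
have CK : `|C| <= K * L by apply: KP.
have beK : `|be| <= K * L by apply: KP.
have Cnn : C * nn = (qform B z + c / 4 * L) / 2 by exact: par_nn.
have benn : be * nn = (qform B z + c / 2 * L) / 2 by exact: par_nn.
have KL : 0 < K * L by rewrite mulr_gt0.
have cL : 0 < c * L by rewrite mulr_gt0.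
clearbody C be.
pose M := 2 * (K * L) + c * L / nn.
have M0 : 0 < M by rewrite addr_gt0 ?mulr_gt0 ?invr_gt0.
pose zM := `|z| + M * V.
have zM0 : 0 < zM by rewrite addr_gt0// mulr_gt0.
have e40 : 0 < c * L / 32 / zM by rewrite !divr_gt0.
have [r4 r40 P4] := k_increment e40.
(* Besides [s2] <= 1, these bounds make the curvature contribution C nn s2 at most c L / 16 in size,
   keep the point (s2, b2) below within [r4] of x0, and keep |b2| <= rp. *)
pose s2 := Num.min (Num.min 1 (c * L / (16 * (K * L * nn))))
   (Num.min (r4 / (2 * zM)) (rp / M)).
have KLn : 0 < 16 * (K * L * nn) by rewrite !mulr_gt0.
have s20 : 0 < s2.
  by rewrite !lt_min ltr01 (divr_gt0 cL KLn) (divr_gt0 r40 (mulr_gt0 _ zM0))// (divr_gt0 rp0 M0).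
have s21 : s2 <= 1 by rewrite !ge_min lexx.
have s2c : s2 * (16 * (K * L * nn)) <= c * L by rewrite -ler_pdivlMr// !ge_min lexx ?orbT.
have s2r : s2 * (2 * zM) <= r4 by rewrite -ler_pdivlMr ?mulr_gt0// !ge_min lexx ?orbT.
have s2M : s2 * M <= rp by rewrite -ler_pdivlMr// !ge_min lexx ?orbT.
clearbody s2.
pose e := s2 * (c * L) / 64.
have e0 : 0 < e by rewrite divr_gt0// mulr_gt0.
have zx : x0 + z - x0 = z by rewrite addrC addKr.
have xx : `|x0 - x0| = 0 by rewrite subrr normr0.
have zRq : `|z| < rq by lra.
have [G00 _ _] := Pq x0 (rq / 2) ltac:(by rewrite xx) ltac:(lra).
have [Gz _ _] := Pq (x0 + z) (rq / 2) ltac:(by rewrite zx) ltac:(lra).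
have Q00 : dot (Q g w0 - Q g w0) yd = 0 by rewrite subrr dot0l.
have [r6 r60 P6] := k_stationary G00 Q00 e0.
have [r7 r70 P7] := k_stationary Gz Qz e0.
(* [t] comes last: [r6] and [r7] depend on z and, through [e], on [s2]. At both ends of the chord |k
   t| is then at most t s2 c L / 64, negligible against the descent t s2 c L / 8 gained at [s2]. *)
pose t := Num.min (Num.min R0 r4) (Num.min r6 r7) / 2.
have m0 : 0 < Num.min (Num.min R0 r4) (Num.min r6 r7) by rewrite !lt_min R00 r40 r60 r70.
have t0 : 0 < t by rewrite divr_gt0.
have tm : t < Num.min (Num.min R0 r4) (Num.min r6 r7) by rewrite ltr_pdivrMr// ltr_pMr// ltr1n.
move: tm; rewrite !lt_min => /andP[/andP[tR t4] /andP[t6 t7]].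
clearbody t.
have F0 := P6 t (introT andP (conj t0 t6)).
have F1 := P7 t (introT andP (conj t0 t7)).
pose xsb (s b : R) := x0 + s *: z + b *: nu.
have xsbB s b : xsb s b - x0 = s *: z + b *: nu by rewrite /xsb; row_ring.
have ball s b : 0 <= s <= 1 -> `|b| <= rp -> `|xsb s b - x0| < R0.
  move=> /andP[s0 s1] brp; rewrite xsbB (le_lt_trans (ler_normD _ _))//.
  rewrite !normrZ (ger0_norm s0) [R0]splitr ltr_leD//.
    by rewrite (le_lt_trans _ zR)// ler_piMl.
  by rewrite (le_trans _ (ltW rpV))// ler_wpM2r// ltW.
have ball5 s b : 0 <= s <= 1 -> `|b| <= rp -> `|xsb s b - x0| < r5.
  by move=> ss bb; exact: lt_le_trans (ball s b ss bb) R05.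
have t5 : 0 < t < r5 by rewrite t0 (lt_le_trans tR).
have rpn : `|rp| <= rp by rewrite gtr0_norm.
have rp00 : `|0 : R| <= rp by rewrite normr0 ltW.
have up s b : 0 <= s <= 1 -> 0 <= b <= rp ->
    k t (xsb s 0) + t * (b * nn / 2) <= k t (xsb s b).
  move=> ss /andP[b0 brp].
  have bb : `|b| <= rp by rewrite ger0_norm.
  have := P5 _ _ t (ball5 _ _ ss rp00) (ball5 _ _ ss bb) t5.
  have -> : xsb s b - xsb s 0 = b *: nu by rewrite /xsb; row_ring.
  rewrite dotZl normrZ (ger0_norm b0) -/nn.
  have -> : e5 * t * (b * `|nu|) = t * (b * nn / 2).
    by rewrite /e5 -/V; field; rewrite gt_eqF.
  move=> /increment_bounds/andP[h _].
  by rewrite (_ : _ * (b * nn / 2) = t * (b * nn) - t * (b * nn / 2))//; field.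
pose eta := s2 * (c * L) / (16 * nn).
have etann : eta * nn = s2 * (c * L) / 16 by rewrite /eta; field; rewrite gt_eqF.
have m0' : 0 < s2 * (c * L) by rewrite mulr_gt0.
have eta0 : 0 < eta by rewrite divr_gt0// mulr_gt0.
have x00 : xsb 0 0 = x0 by rewrite /xsb; row_ring.
have x10 : xsb 1 0 = x0 + z by rewrite /xsb; row_ring.
have p01 : 0 <= (0 : R) <= 1 by rewrite lexx ler01.
have p11 : 0 <= (1 : R) <= 1 by rewrite lexx ler01.
have pK s : 0 <= s <= 1 -> `|be * s - C * s * s| <= 2 * (K * L) * s.
  move=> /andP[s0 s1]; rewrite (le_trans (ler_normB _ _))// !normrM (ger0_norm s0).
  have h1 : `|be| * s <= K * L * s by rewrite ler_wpM2r.
  have h2 : `|C| * s * s <= K * L * s.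
    by rewrite -mulrA ler_pM ?mulr_ge0// ler_piMl.
  by rewrite (_ : 2 * (K * L) * s = K * L * s + K * L * s) ?lerD//; ring.
(* A point at height [eta] above the parabola be s - C s^2. It still lies where k <= 0: to first
   order the zero set leaves x0 with slope - (z.nu) / nn, which [z_descent] makes larger than
   [be]. *)
pose b2 := be * s2 - C * s2 * s2 + eta.
have s2in : 0 <= s2 <= 1 by rewrite (ltW s20).
have b2M : `|b2| <= s2 * M.
  rewrite (le_trans (ler_normD _ _))// (gtr0_norm eta0).
  have -> : s2 * M = 2 * (K * L) * s2 + eta * 16.
    by rewrite /M /eta; field; rewrite gt_eqF.
  by rewrite lerD ?pK// ler_peMr ?(ltW eta0)// ler1n.
have b2rp : `|b2| <= rp by exact: le_trans b2M s2M.
have b2n : `|s2 *: z + b2 *: nu| <= s2 * zM.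
  rewrite (le_trans (ler_normD _ _))// !normrZ (gtr0_norm s20) /zM mulrDr lerD2l.
  by rewrite mulrA ler_wpM2r// ltW.
have inside : k t (xsb s2 b2) <= 0.
  have n4 : `|xsb s2 b2 - x0| < r4.
    rewrite xsbB (le_lt_trans b2n)// (lt_le_trans _ s2r)// ltr_pM2l//.
    by rewrite ltr_pMl// ltr1n.
  have x04 : `|x0 - x0| < r4 by rewrite xx.
  have := P4 x0 (xsb s2 b2) t x04 n4 (introT andP (conj t0 t4)).
  rewrite xsbB dotDl !dotZl.
  move=> /increment_bounds/andP[_ h].
  have h' : k t (xsb s2 b2) <= k t x0 + (t * (s2 * dot z nu + b2 * nn)
      + t * (c * L / 32 / zM * `|s2 *: z + b2 *: nu|)).
    by rewrite [t * (c * L / 32 / zM * _)]mulrCA mulrA.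
  apply: (chord_inside_neg t0 m0' h').
  - exact: F0.
  - rewrite /b2; apply: (chord_slope (q := qform B z)) => //.
    rewrite (le_trans (ler_norm _))// !normrM normrN (gtr0_norm nn0) (gtr0_norm s20).
    rewrite (@le_trans _ _ (K * L * nn * s2))//.
      by rewrite ler_wpM2r ?(ltW s20)// ler_wpM2r// ltW.
    by rewrite ler_pdivlMr//; rewrite (le_trans _ s2c)// le_eqVlt; apply/orP; left; apply/eqP; ring.
  - rewrite (le_trans (ler_wpM2l (ltW e40) b2n))// le_eqVlt; apply/orP; left; apply/eqP.
    by field; rewrite gt_eqF.
have cont s b : 0 <= s <= 1 -> `|b| <= rp ->
    {for (s, b), continuous (fun sb => k t (xsb sb.1 sb.2))}.
  move=> ss bb; have xq : `|xsb s b - x0| < rq by exact: lt_le_trans (ball s b ss bb) R0q.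
  have [G0 Gt _] := Pq _ t xq (introT andP (conj t0 (lt_le_trans tR R0q))).
  have cx : {for (s, b), continuous (fun sb : R * R => xsb sb.1 sb.2)}.
    apply: cvgD; last by apply: cvgZr_tmp; exact: cvg_snd.
    by apply: cvgD; [exact: cvg_cst | apply: cvgZr_tmp; exact: cvg_fst].
  exact: continuousB (g_continuous_comp Gamma_open g_C2 cx Gt)
    (g_continuous_comp Gamma_open g_C2 cx G0).
have cp : continuous (fun s : R => be * s - C * s * s).
  move=> s; apply: cvgB; first by apply: cvgMl_tmp; exact: cvg_id.
  by apply: cvgM; [apply: cvgMl_tmp; exact: cvg_id | exact: cvg_id].
have left b : `|b| <= rp -> k t (xsb 0 b) <= 0 -> b - (be * 0 - C * 0 * 0) < eta.
  move=> bb kb; rewrite !mulr0 subr0 subr0 ltNge; apply/negP => etab.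
  have b0 : 0 <= b := le_trans (ltW eta0) etab.
  have h := up 0 b p01 (introT andP (conj b0 (le_trans (ler_norm b) bb))).
  rewrite x00 in h.
  apply: (chord_end_absurd t0 m0' h kb F0).
  by rewrite -etann ler_wpM2r// ltW.
have right b : `|b| <= rp -> k t (xsb 1 b) <= 0 -> b - (be * 1 - C * 1 * 1) < eta.
  move=> bb kb; rewrite !mulr1 ltNge; apply/negP => etab.
  (* At s = 1 the parabola has height be - C = c L / (8 nn), so its far end is above the chord; this
     is why [be] is built with c / 2 and [C] with the smaller c / 4. *)
  have bC : 0 <= (be - C) * nn.
    rewrite mulrBl benn Cnn.
    have -> : (qform B z + c / 2 * L) / 2 - (qform B z + c / 4 * L) / 2 = c * L / 8 by field.
    by rewrite ltW// divr_gt0.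
  have bC0 : 0 <= be - C by rewrite pmulr_lge0 in bC.
  have b1 : eta <= b by rewrite (le_trans etab)// lerBlDr lerDl.
  have b0 : 0 <= b := le_trans (ltW eta0) b1.
  have h := up 1 b p11 (introT andP (conj b0 (le_trans (ler_norm b) bb))).
  rewrite x10 in h.
  apply: (chord_end_absurd t0 m0' h kb F1).
  by rewrite -etann ler_wpM2r// ltW.
have top s : 0 <= s <= 1 -> 0 < k t (xsb s rp).
  move=> ss; have D0 : 0 < rp * nn by rewrite mulr_gt0.
  have rpp : 0 <= rp <= rp by rewrite ltW/=.
  have h := up s rp ss rpp.
  have h0 := P5 _ _ t (ball5 0 0 p01 rp00) (ball5 s 0 ss rp00) t5.
  have xsb0 : xsb s 0 - xsb 0 0 = s *: z by rewrite /xsb; row_ring.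
  rewrite xsb0 x00 dotZl normrZ in h0.
  have /andP[s0 s1] := ss; rewrite (ger0_norm s0) in h0.
  have /andP[h1 _] := increment_bounds h0.
  rewrite (_ : e5 * t * (s * `|z|) = t * (e5 * (s * `|z|))) in h1; last by ring.
  apply: (chord_top_pos t0 D0 h h1).
    rewrite (le_trans F0)// ler_wpM2r ?(ltW t0)// ler_wpM2r// /e.
    rewrite ltr_pdivlMr// in zc.
    rewrite (@le_trans _ _ (c * L))// ?ler_piMl ?(ltW cL)//.
    by rewrite (le_trans _ (ltW zc))// mulrC ler_wpM2r// ltW.
  rewrite ltr_pdivlMr ?mulr_gt0// in zNV.
  rewrite normrM (ger0_norm s0).
  have dz : s * `|dot z nu| <= s * (n%:R * (`|z| * V)) by rewrite ler_wpM2l// dot_le.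
  have E1 : s * (n%:R * (`|z| * V)) + e5 * (s * `|z|) = s * (`|z| * NV) by rewrite /NV; ring.
  have s3 : s * (`|z| * NV) <= `|z| * NV by rewrite ler_piMl// mulr_ge0// ltW.
  rewrite (le_trans (lerD dz (lexx _)))// E1 (le_trans s3)// ler_pdivlMr//.
  by rewrite -mulrA [NV * 8]mulrC ltW.
have bottom s : 0 <= s <= 1 -> - rp - (be * s - C * s * s) < eta.
  move=> ss; have /andP[s0 s1] := ss.
  rewrite ltr_pdivlMr ?mulr_gt0// in zK.
  have : `|be * s - C * s * s| < rp.
    rewrite (le_lt_trans (pK s ss))// (@le_lt_trans _ _ (2 * (K * L)))//.
      by rewrite ler_piMr// mulr_ge0// ltW.
    rewrite (le_lt_trans _ zK)// (_ : `|z| * (4 * K) = 4 * (K * `|z|)); last by ring.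
    by rewrite ler_pM ?(ltW KL) ?ler_nat// ler_wpM2l// ltW.
  rewrite ltr_norml => /andP[h _].
  by rewrite (lt_trans _ eta0)// ltrBlDr add0r.
have start : exists s b, [/\ 0 <= s <= 1, `|b| <= rp, k t (xsb s b) <= 0 &
    eta <= b - (be * s - C * s * s)].
  by exists s2, b2; split=> //; rewrite /b2 addrAC subrr add0r.
have [s [b [/andP[s0 s1] brp kb touch]]] :=
  touching_graph (k := fun sb => k t (xsb sb.1 sb.2)) ltr01 rp0 cp cont start left right top bottom.
have ss : 0 <= s <= 1 by rewrite !ltW.
exists (xsb s b), t, s; split=> //.
- exact: lt_le_trans (ball s b ss (ltW brp)) R0r.
- by rewrite t0 (lt_le_trans tR).
rewrite (near_shift 0 s) in touch; apply: filterS touch => h; rewrite /= subr0.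
have -> : xsb (h + s) (b + (be * (h + s) - C * (h + s) * (h + s)) - (be * s - C * s * s)) =
    xsb s b + (h *: (z + (be - 2 * C * s) *: nu) - (C * h * h) *: nu).
  by rewrite /xsb; row_ring.
by [].
Qed.

(** Taylor expansion at [x0] spends c / 2 of the descent c, leaving the slope condition of
    [contact_exists]. All radii are fixed before z, so one small z meets the requirements of both
    contact lemmas. *)
Lemma no_tangential_descent c : 0 < c ->
  ~ (forall rho, 0 < rho -> exists z, [/\ z != 0, `|z| < rho,
      dot (Q g (x0 + z, y0, z0) - Q g w0) yd = 0 &
      g (x0 + z, y1, z1) - g (x0 + z, y0, z0) <= - (c * `|z| ^+ 2)]).
Proof.
move=> c0 descent; have c20 : 0 < c / 2 by rewrite divr_gt0.
have [r r0 rP] := contact_contradiction c0.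
have [rho rho0 rhoP] := contact_exists c0 r0.
have [r1 r10 r1P] := taylor_x_sub Gamma_open g_C2 Gw1 Gw0 c20.
have m0 : 0 < Num.min r (Num.min rho r1) by rewrite !lt_min r0 rho0.
have [z [zn0 + Qz gz]] := descent _ m0.
rewrite !lt_min => /and3P[zr zrho zr1].
have T := r1P z zr1.
have z_descent : dot z nu + qform B z / 2 <= - (c / 2 * `|z| ^+ 2).
  move: T; rewrite -/w0 -/w1 g01 subrr subr0 -/nu -/B ler_norml => /andP[h _].
  by move: h gz; lra.
have [x [t [s [xr tr ss kt near0]]]] := rhoP z zn0 zrho Qz z_descent.
exact: rP zn0 zr xr tr ss kt near0.
Qed.

End Contact.

(* The zero set of [F] is touched by a parabola; the tangent line at the point of
   contact is the one sought. *)
Lemma quadratic_crest {R : realType} {n : nat} (F : 'rV[R]_n -> R)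
    (X0 V l : 'rV[R]_n) (r0 d0 : R) :
  (forall e, 0 < e -> exists2 r, 0 < r & forall X X', `|X - X0| < r ->
     `|X' - X0| < r -> `|F X' - F X - dot (X' - X) l| <= e * `|X' - X|) ->
  l != 0 -> 0 < r0 -> 0 < d0 -> F X0 = 0 ->
  (forall t, `|t| <= d0 -> F (X0 + t *: V) <= 0) ->
  (forall t, 0 < t <= d0 -> F (X0 + t *: V) < 0) ->
  exists X V' c, [/\ `|X - X0| < r0, 0 < c, F X = 0 &
    \forall s \near (0 : R), F (X + s *: V') <= - (c * s ^+ 2)].
Proof.
move=> strict l0 r00 d00 FX0 Fle Flt.
have ll : 0 < dot l l := dot_gt0 l0.
(* The differential of F at X0 takes the value 1 on [e], so nearby F grows along [e] at a rate
   between 1/2 and 2. *)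
pose e := (dot l l)^-1 *: l.
have el : dot e l = 1 by rewrite /e dotZl mulVf// gt_eqF.
clearbody e.
have e1 : 0 < 1 + `|e| by rewrite ltr_pwDl.
have V1 : 0 < 1 + `|V| by rewrite ltr_pwDl.
have e10 : 0 < 1 / (2 * (1 + `|e|)) by rewrite divr_gt0// mulr_gt0.
have [r r_gt0 rP] := strict _ e10.
pose rr := Num.min r r0.
have rr0 : 0 < rr by rewrite lt_min r_gt0.
have rrr : rr <= r by rewrite ge_min lexx.
have rr00 : rr <= r0 by rewrite ge_min lexx orbT.
clearbody rr.
have mono X b : 0 <= b -> `|X - X0| < rr -> `|X + b *: e - X0| < rr ->
    F X + b / 2 <= F (X + b *: e) <= F X + 2 * b.
  move=> b0 Xr Xr'; have := rP X (X + b *: e) (lt_le_trans Xr rrr) (lt_le_trans Xr' rrr).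
  have -> : X + b *: e - X = b *: e by row_ring.
  rewrite dotZl el normrZ (ger0_norm b0) mulr1.
  have h : 1 / (2 * (1 + `|e|)) * (b * `|e|) <= b / 2.
    have -> : 1 / (2 * (1 + `|e|)) * (b * `|e|) = (`|e| / (1 + `|e|)) * (b / 2).
      by field; rewrite gt_eqF.
    by rewrite ler_piMl ?divr_ge0// ler_pdivrMr// mul1r lerDr ler01.
  move=> /le_trans/(_ h); rewrite ler_norml => /andP[h1 h2]; apply/andP; split; lra.
have cont X : `|X - X0| < rr -> {for X, continuous F}.
  move=> Xr; pose C := n%:R * `|l| + 1 / (2 * (1 + `|e|)).
  have C0 : 0 < C by rewrite ltr_wpDl// mulr_ge0.
  have rX : 0 < rr - `|X - X0| by rewrite subr_gt0.
  apply: (lipschitz_at_continuous rX C0) => X'; rewrite ltrBrDr => h.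
  have Xr' : `|X' - X0| < rr.
    by rewrite -(subrK X X') -addrA (le_lt_trans (ler_normD _ _)).
  have h1 := rP X X' (lt_le_trans Xr rrr) (lt_le_trans Xr' rrr).
  rewrite -(subrK (dot (X' - X) l) (F X' - F X)) (le_trans (ler_normD _ _))//.
  rewrite /C mulrDl addrC lerD// (le_trans (dot_le _ _))//.
  by rewrite -mulrA [`|l| * _]mulrC.
pose rho := rr / (4 * (1 + `|e|)).
have rho0 : 0 < rho by rewrite divr_gt0// mulr_gt0.
pose d := Num.min d0 (rr / (4 * (1 + `|V|))).
have d_gt0 : 0 < d by rewrite lt_min d00 divr_gt0// mulr_gt0.
have dd0 : d <= d0 by rewrite ge_min lexx.
have dV : d * `|V| <= rr / 4.
  rewrite (@le_trans _ _ (d * (1 + `|V|)))// ?ler_wpM2l ?lerDr// ?(ltW d_gt0)//.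
  rewrite -ler_pdivlMr// /d (_ : rr / 4 / (1 + `|V|) = rr / (4 * (1 + `|V|))).
    by rewrite ge_min lexx orbT.
  by field; rewrite gt_eqF.
have rhoe : rho * `|e| <= rr / 4.
  rewrite (@le_trans _ _ (rho * (1 + `|e|)))// ?ler_wpM2l ?lerDr// ?(ltW rho0)//.
  by rewrite le_eqVlt /rho; apply/orP; left; apply/eqP; field; rewrite gt_eqF.
clearbody rho d.
(* The minus sign makes [- F (X t b)] increase with b, as [touching_graph] expects; its region k <=
   0 is then F >= 0. *)
pose X (t b : R) := X0 + t *: V - b *: e.
have Xball t b : `|t| <= d -> `|b| <= rho -> `|X t b - X0| < rr.
  move=> td brho; have -> : X t b - X0 = t *: V - b *: e by rewrite /X; row_ring.
  rewrite (le_lt_trans (ler_normB _ _))// !normrZ.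
  have h1 : `|t| * `|V| <= rr / 4 by rewrite (le_trans _ dV)// ler_wpM2r.
  have h2 : `|b| * `|e| <= rr / 4 by rewrite (le_trans _ rhoe)// ler_wpM2r.
  by rewrite (le_lt_trans (lerD h1 h2))//; lra.
have X_0 t : X t 0 = X0 + t *: V by rewrite /X; row_ring.
have XD t b b' : X t b + b' *: e = X t (b - b') by rewrite /X; row_ring.
have n0 : `|0 : R| <= rho by rewrite normr0 ltW.
have monoX t b b' : `|t| <= d -> `|b| <= rho -> `|b'| <= rho -> b <= b' ->
    F (X t b') + (b' - b) / 2 <= F (X t b) <= F (X t b') + 2 * (b' - b).
  move=> td b1 b2 bb'; have := mono (X t b') (b' - b).
  rewrite XD subKr subr_ge0; apply=> //; exact: Xball.
have dabs t : - d <= t <= d -> `|t| <= d by rewrite ler_norml.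
have dd : `|d| <= d by rewrite gtr0_norm.
have dN : `|- d| <= d by rewrite normrN gtr0_norm.
pose mu := - F (X d 0).
have mu0 : 0 < mu by rewrite oppr_gt0 X_0; apply: Flt; rewrite d_gt0.
pose m := Num.min mu rho.
have m0 : 0 < m by rewrite lt_min mu0.
have mmu : m <= mu by rewrite ge_min lexx.
have mrho : m <= rho by rewrite ge_min lexx orbT.
pose ep := m / (8 * d ^+ 2).
have dd2 : 0 < 8 * d ^+ 2 by rewrite mulr_gt0// exprn_gt0.
have ep0 : 0 < ep by rewrite divr_gt0.
have epd : 8 * (ep * d ^+ 2) = m by rewrite /ep; field; rewrite gt_eqF.
have muE : F (X d 0) = - mu by rewrite /mu opprK.
clearbody mu m ep.
(* p vanishes at 0, where X0 itself gives b - p = 0. At -d, p is positive while F >= 0 forces b <=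
   0; at d, p is - 3/8 m while F >= 0 forces b <= - mu / 2. So the maximum of b - p is attained at
   neither end. *)
pose p t := - (2 * ep * d * t + ep * t * t).
have cp : continuous p.
  move=> t; apply: cvgN; apply: cvgD; first by apply: cvgMl_tmp; exact: cvg_id.
  by apply: cvgM; [apply: cvgMl_tmp; exact: cvg_id | exact: cvg_id].
have pd : p d = - (3 / 8 * m) by rewrite /p -epd; field.
have pNd : 0 < p (- d).
  by rewrite (_ : p (- d) = ep * d ^+ 2) ?mulr_gt0 ?exprn_gt0// /p; ring.
have ple t : - d <= t <= d -> - (3 / 8 * m) <= p t.
  move=> /andP[t1 t2]; rewrite -pd /p lerN2 lerD//.
    by rewrite ler_wpM2l// mulr_ge0 ?(ltW d_gt0)// mulr_ge0// ltW.
  rewrite -!mulrA ler_wpM2l ?(ltW ep0)// (le_trans (ler_norm _))// normrM.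
  by rewrite ler_pM// ler_norml t1.
have ck s b : - d <= s <= d -> `|b| <= rho ->
    {for (s, b), continuous (fun sb => - F (X sb.1 sb.2))}.
  move=> /dabs sd brho; apply: continuousN.
  apply: (continuous_comp (f := fun sb : R * R => X sb.1 sb.2) (g := F)); last first.
    exact: cont (Xball _ _ sd brho).
  apply: cvgB; last by apply: cvgZr_tmp; exact: cvg_snd.
  by apply: cvgD; [exact: cvg_cst | apply: cvgZr_tmp; exact: cvg_fst].
have start : exists s b, [/\ - d <= s <= d, `|b| <= rho, - F (X s b) <= 0 & 0 <= b - p s].
  exists 0, 0; split=> //.
  - by rewrite oppr_le0 (ltW d_gt0).
  - by rewrite X_0 scale0r addr0 FX0 oppr0.
  - by rewrite /p !mulr0 addr0 oppr0 subr0.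
have FXle s : - d <= s <= d -> F (X s 0) <= 0.
  by move=> /dabs sd; rewrite X_0 Fle// (le_trans sd).
have left b : `|b| <= rho -> - F (X (- d) b) <= 0 -> b - p (- d) < 0.
  move=> brho; rewrite oppr_le0 => Fb; rewrite subr_lt0 (le_lt_trans _ pNd)// leNgt.
  apply/negP => b0; have /andP[h _] := monoX _ 0 b dN n0 brho (ltW b0).
  have h2 := FXle (- d); rewrite lexx ge0_cp ?(ltW d_gt0)// in h2.
  by have := h2 isT; rewrite subr0 in h; lra.
have right b : `|b| <= rho -> - F (X d b) <= 0 -> b - p d < 0.
  move=> brho; rewrite oppr_le0 => Fb; rewrite pd opprK.
  have [b0|b0] := leP 0 b.
    by have /andP[h _] := monoX _ 0 b dd n0 brho b0; rewrite muE subr0 in h; lra.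
  by have /andP[_ h] := monoX _ b 0 dd brho n0 (ltW b0); rewrite muE sub0r in h; lra.
have top s : - d <= s <= d -> 0 < - F (X s rho).
  move=> sd; have := FXle s sd; have rhoN : `|rho| <= rho by rewrite gtr0_norm.
  have /andP[h _] := monoX _ 0 rho (dabs s sd) n0 rhoN (ltW rho0).
  by rewrite subr0 in h; lra.
have bottom s : - d <= s <= d -> - rho - p s < 0 by move=> /ple; lra.
have dNd : - d < d by lra.
have [s [b [/andP[s0 s1] brho Fb touch]]] :=
  touching_graph (k := fun sb => - F (X sb.1 sb.2)) dNd rho0 cp ck start left right top bottom.
have sd : `|s| < d by rewrite ltr_norml s0.
have Xsb := Xball s b (ltW sd) (ltW brho).
exists (X s b), (V + (2 * ep * d + 2 * ep * s) *: e), (ep / 2); split.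
- exact: lt_le_trans Xsb rr00.
- by rewrite divr_gt0.
- by move/eqP: Fb; rewrite oppr_eq0 => /eqP.
rewrite (near_shift 0 s) in touch.
set ka := 2 * ep * d + 2 * ep * s.
have ka0 : 0 < 1 + `|ka| + ep by rewrite ltr_wpDl.
have near0 : \forall h \near (0 : R),
    `|h| < Num.min 1 (Num.min (d - `|s|) ((rho - `|b|) / (1 + `|ka| + ep))).
  apply/nbhs_normP; exists (Num.min 1 (Num.min (d - `|s|) ((rho - `|b|) / (1 + `|ka| + ep)))).
    by rewrite /= !lt_min ltr01 subr_gt0 sd divr_gt0// subr_gt0.
  by move=> h /=; rewrite sub0r normrN.
apply: filterS2 touch near0 => h; rewrite /= subr0 oppr_ge0 !lt_min ltr_pdivlMr//.
move=> Fh /and3P[h1 hd hrho].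
have hsd : `|h + s| <= d by rewrite (le_trans (ler_normD _ _))// -lerBrDr ltW.
have E1 : X s b + h *: (V + ka *: e) = X (h + s) (b - ka * h) by rewrite /X; row_ring.
have E2 : b + p (h + s) - p s = b - ka * h - ep * h ^+ 2 by rewrite /p /ka; ring.
have hh : `|ka * h| + `|ep * h ^+ 2| <= `|h| * (1 + `|ka| + ep).
  rewrite !normrM !mulrDr mulr1 -addrA ler_wpDl// [`|h| * `|ka|]mulrC lerD2l.
  by rewrite (gtr0_norm ep0) mulrC ler_wpM2r ?(ltW ep0)// ler_piMl// ltW.
have h20 : 0 <= ep * h ^+ 2 by rewrite mulr_ge0 ?sqr_ge0// ltW.
have b1 : `|b - ka * h| <= rho.
  rewrite (le_trans (ler_normB _ _))// -lerBrDl (le_trans _ (ltW hrho))//.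
  by rewrite (le_trans _ hh)// lerDl.
have b2 : `|b - ka * h - ep * h ^+ 2| <= rho.
  rewrite -addrA -opprD (le_trans (ler_normB _ _))// -lerBrDl (le_trans _ (ltW hrho))//.
  by rewrite (le_trans _ hh)// ler_normD.
rewrite E2 in Fh; rewrite E1.
(* The tangent line exceeds the parabola by ep h^2 in b, and F falls with b at a rate of at least
   1/2: hence the constant [ep / 2]. *)
have b3 : b - ka * h - ep * h ^+ 2 <= b - ka * h by rewrite gerBl.
have /andP[h3 _] := monoX _ _ _ hsd b2 b1 b3.
by rewrite subKr in h3; move: Fh h3; lra.
Qed.

(** * Level sets in the coordinates Q *)

Section LevelSets.
Context {R : realType} {n : nat}.
Local Notation point := ('rV[R]_n * 'rV[R]_n * R)%type.
Context (Gamma : set point) (g : point -> R).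
Hypothesis Gamma_open : open Gamma.
Hypothesis g_C2 : C2_on Gamma g.
Hypothesis gz_lt0 : forall w, Gamma w -> g_z g w < 0.
Hypothesis g_A1 : A1 Gamma g.
Hypothesis g_A2 : A2 Gamma g.
Hypothesis g_A3w : A3w Gamma g.
Local Opaque g_x g_xx.

Let level_dir (x0 y0 y1 : 'rV[R]_n) (z0 z1 : R) : 'rV[R]_n :=
  (g_x g (x0, y1, z1) - g_x g (x0, y0, z0)) *m invmx (E g (x0, y0, z0))^T.

(* The gradient at [x0] of [g(., y1, z1) - g(., y0, z0)] in the coordinates
   [Q(., y0, z0)]. *)
Definition level_grad x0 y0 y1 z0 z1 : 'rV[R]_n :=
  - g_z g (x0, y0, z0) *: level_dir x0 y0 y1 z0 z1.

(** Chain rule through [Q_inverse_strict]: an increment D of Q moves x by about - g_z D E^-1, hence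
    the difference of the two functions by D.[level_grad]. It has to be strict, as [quadratic_crest]
    compares pairs of points near X0. *)
Lemma Q_level_strict (x0 y0 y1 : 'rV[R]_n) (z0 z1 e : R) :
  Gamma (x0, y0, z0) -> Gamma (x0, y1, z1) -> 0 < e ->
  exists2 r, 0 < r & forall x x', `|x - x0| < r -> `|x' - x0| < r ->
    `|Q g (x, y0, z0) - Q g (x0, y0, z0)| < r ->
    `|g (x', y1, z1) - g (x', y0, z0) - (g (x, y1, z1) - g (x, y0, z0))
      - dot (Q g (x', y0, z0) - Q g (x, y0, z0)) (level_grad x0 y0 y1 z0 z1)|
    <= e * `|Q g (x', y0, z0) - Q g (x, y0, z0)|.
Proof.
move=> G0 G1 e0; set w0 : point := (x0, y0, z0); set w1 : point := (x0, y1, z1).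
set nu := g_x g w1 - g_x g w0; set iE := invmx (E g w0).
have [K K0 KP] := mulmx_bounded iE.
pose L := 1 + `|g_z g w0| * K.
have L0 : 0 < L by rewrite ltr_pwDl// mulr_ge0// ltW.
have N0 : 0 < 1 + n%:R * `|nu| by rewrite ltr_pwDl// mulr_ge0.
have e10 : 0 < e / (4 * L) by rewrite divr_gt0// mulr_gt0.
pose e2 := Num.min 1 (e / (2 * (1 + n%:R * `|nu|))).
have e20 : 0 < e2 by rewrite lt_min ltr01 divr_gt0// mulr_gt0.
have e21 : e2 <= 1 by rewrite ge_min lexx.
have e22 : n%:R * `|nu| * e2 <= e / 2.
  rewrite (@le_trans _ _ ((1 + n%:R * `|nu|) * e2))//.
    by rewrite ler_wpM2r ?(ltW e20)// lerDr ler01.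
  by rewrite mulrC -ler_pdivlMr// -mulrA -invfM ge_min lexx orbT.
clearbody e2.
have [r0 r00 P0] := g_strict Gamma_open g_C2 G0 e10.
have [r1 r10 P1] := g_strict Gamma_open g_C2 G1 e10.
have [r2 r20 P2] := Q_inverse_strict Gamma_open g_C2 gz_lt0 G0 (g_A2 G0) e20.
exists (Num.min r0 (Num.min r1 r2)); first by rewrite !lt_min r00 r10.
move=> x x'; rewrite !lt_min => /and3P[xr0 xr1 xr2] /and3P[x'r0 x'r1 x'r2] /and3P[_ _ Qr2].
have line y z : linear_part g (x0, y, z) ((x', y, z) - (x, y, z)) =
    dot (x' - x) (g_x g (x0, y, z)).
  rewrite -[(x', y, z) - _]/(x' - x, y - y, z - z) !subrr.
  by rewrite /linear_part /= dot0l mul0r !addr0.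
have := P0 (x, y0, z0) (x', y0, z0); rewrite !normB_x line => /(_ xr0 x'r0) T0.
have := P1 (x, y1, z1) (x', y1, z1); rewrite !normB_x line => /(_ xr1 x'r1) T1.
have T2 := P2 x x' xr2 x'r2 Qr2.
set D := Q g (x', y0, z0) - Q g (x, y0, z0) in T2 *.
have dE : dot (x' - x) nu = dot (x' - x + g_z g w0 *: (D *m iE)) nu
    + dot D (level_grad x0 y0 y1 z0 z1).
  have lgE : dot D (level_grad x0 y0 y1 z0 z1) = - g_z g w0 * dot (D *m iE) nu.
    rewrite dotZr; congr (_ * _).
    by rewrite /level_dir -/nu -trmx_inv dotC dot_trmx.
  by rewrite lgE (dotDl (x' - x)) (dotZl _ (D *m iE)) mulNr addrK.
have xx' : `|x' - x| <= L * `|D|.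
  rewrite -(addrK (g_z g w0 *: (D *m iE)) (x' - x)) (le_trans (ler_normB _ _))//.
  rewrite /L mulrDl mul1r lerD//.
    by rewrite (le_trans T2)// ler_piMl.
  by rewrite normrZ -mulrA ler_wpM2l.
have T3 : `|dot (x' - x + g_z g w0 *: (D *m iE)) nu| <= e / 2 * `|D|.
  rewrite (le_trans (dot_le _ _))//.
  rewrite (@le_trans _ _ (n%:R * (e2 * `|D| * `|nu|)))//; first by rewrite ler_wpM2l// ler_wpM2r.
  by rewrite (_ : n%:R * _ = n%:R * `|nu| * e2 * `|D|); [rewrite ler_wpM2r | ring].
have T4 : e / (4 * L) * `|x' - x| <= e / 4 * `|D|.
  rewrite (le_trans (ler_wpM2l (ltW e10) xx'))// le_eqVlt; apply/orP; left; apply/eqP.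
  by field; rewrite gt_eqF.
have dnu : dot (x' - x) nu = dot (x' - x) (g_x g w1) - dot (x' - x) (g_x g w0).
  exact: dotBr.
exact: difference_error (le_trans T0 T4) (le_trans T1 T4) T3 dE dnu.
Qed.

(** [Q_solve] realises each small s by a point x. Tangency of [eta] makes the perturbation
    stationary at x, and |x - x0| <= L s for s > 0 turns - c s^2 into - (c / L^2) |x - x0|^2, as
    [no_tangential_descent] requires. *)
Lemma level_crest_absurd (x0 y0 y1 eta : 'rV[R]_n) (z0 z1 c d : R) :
  Gamma (x0, y0, z0) -> Gamma (x0, y1, z1) -> g (x0, y1, z1) = g (x0, y0, z0) ->
  g_x g (x0, y1, z1) - g_x g (x0, y0, z0) != 0 ->
  segment (g_x g (x0, y0, z0)) (g_x g (x0, y1, z1)) `<=`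
    calU_fiber Gamma g x0 (g (x0, y0, z0)) ->
  0 < c -> 0 < d ->
  ~ (forall s x, `|s| < d -> `|x - x0| < d -> Gamma (x, y0, z0) ->
      Q g (x, y0, z0) = Q g (x0, y0, z0) + s *: eta ->
      g (x, y1, z1) - g (x, y0, z0) <= - (c * s ^+ 2)).
Proof.
move=> G0 G1 g01 nu0 seg c0 d0 crest.
set w0 : point := (x0, y0, z0) in G0 g01 nu0 seg crest.
set yd := level_dir x0 y0 y1 z0 z1.
have gz0 : g_z g w0 != 0 by rewrite lt_eqF// gz_lt0.
have solve e : 0 < e -> exists2 r, 0 < r & forall s, `|s| < r -> exists x,
    [/\ `|s| < d, `|x - x0| < e, g (x, y1, z1) - g (x, y0, z0) <= - (c * s ^+ 2) &
        Q g (x, y0, z0) = Q g w0 + s *: eta].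
  move=> e0; have m0 : 0 < Num.min e d by rewrite lt_min e0.
  have [r r0 rP] := Q_solve Gamma_open g_C2 gz_lt0 G0 (g_A2 G0) m0.
  have n0 : 0 < 1 + `|eta| by rewrite ltr_pwDl.
  exists (Num.min d (r / (1 + `|eta|))); first by rewrite lt_min d0 divr_gt0.
  move=> s; rewrite lt_min ltr_pdivlMr// => /andP[sd sr].
  have [|x [+ Gx Qx]] := rP (Q g w0 + s *: eta).
    rewrite addrC addKr normrZ (le_lt_trans _ sr)// ler_wpM2l// lerDr.
    exact: ler01.
  by rewrite lt_min => /andP[xe xd]; exists x; split=> //; exact: crest.
have near x s : Q g (x, y0, z0) = Q g w0 + s *: eta ->
    Q g (x, y0, z0) - Q g w0 = s *: eta by move=> ->; rewrite addrC addKr.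
(* The difference vanishes at s = 0 and is nonpositive for both signs of s, so its first order term
   is zero; that term is a nonzero multiple of eta.yd. *)
have orth : dot eta yd = 0.
  have : dot eta (level_grad x0 y0 y1 z0 z1) = 0; last first.
    by rewrite /level_grad dotZr => /eqP; rewrite mulf_eq0 oppr_eq0 (negPf gz0)/= => /eqP.
  apply/eqP; rewrite -normr_le0; apply/ler_addgt0Pr => e e0; rewrite add0r.
  have n0 : 0 < 1 + `|eta| by rewrite ltr_pwDl.
  have [r r0 rP] := Q_level_strict G0 G1 (divr_gt0 e0 n0).
  have [r1 r10 r1P] := solve _ r0.
  have half s : 0 < `|s| < r1 -> s * dot eta (level_grad x0 y0 y1 z0 z1) <= e * `|s|.
    move=> /andP[s0 sr1]; have [x [_ xr Fx Qx]] := r1P s sr1.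
    have := rP x0 x; rewrite (subrr x0) (subrr (Q g _)) !normr0 => /(_ r0 xr r0).
    rewrite g01 subrr subr0 -/w0 (near _ _ Qx) dotZl normrZ => h.
    have h2 : e / (1 + `|eta|) * (`|s| * `|eta|) <= e * `|s|.
      rewrite (_ : e / _ * _ = `|eta| / (1 + `|eta|) * (e * `|s|)); last first.
        by field; rewrite gt_eqF.
      rewrite ler_piMl ?mulr_ge0 ?(ltW e0)// ler_pdivrMr// mul1r lerDr.
      exact: ler01.
    have s2 : 0 <= c * s ^+ 2 by rewrite mulr_ge0 ?sqr_ge0// ltW.
    by move: (le_trans h h2); rewrite ler_norml => /andP[h3 _]; move: h3 Fx s2; lra.
  have p0 : 0 < r1 / 2 by rewrite divr_gt0.
  have p1 : r1 / 2 < r1 by rewrite ltr_pdivrMr// ltr_pMr// ltr1n.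
  have := half (r1 / 2); have := half (- (r1 / 2)).
  rewrite normrN (gtr0_norm p0) p0 p1 mulNr [e * _]mulrC -mulrN !ler_pM2l//.
  move=> /(_ isT) h1 /(_ isT) h2.
  by rewrite ler_norml h2 andbT lerNl.
have [K K0 KP] := mulmx_bounded (invmx (E g w0)).
have [r2 r20 P2] := Q_inverse_strict Gamma_open g_C2 gz_lt0 G0 (g_A2 G0) ltr01.
pose L := (1 + `|g_z g w0| * K) * (1 + `|eta|).
have L0 : 0 < L by rewrite mulr_gt0// ltr_pwDl// mulr_ge0// ltW.
have cL0 : 0 < c / L ^+ 2 by rewrite divr_gt0// exprn_gt0.
apply: (no_tangential_descent Gamma_open g_C2 gz_lt0 g_A1 g_A2 g_A3w G0 G1 g01 nu0 seg cL0).
move=> rho rho0; have m0 : 0 < Num.min rho r2 by rewrite lt_min rho0.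
have [r r0 rP] := solve _ m0.
pose s := r / 2; have s0 : 0 < s by rewrite divr_gt0.
have sr : s < r by rewrite ltr_pdivrMr// ltr_pMr// ltr1n.
have [] := rP s; first by rewrite gtr0_norm.
move=> x [_ + Fx Qx]; rewrite lt_min => /andP[xrho xr2].
have cs : 0 < c * s ^+ 2 by rewrite mulr_gt0// exprn_gt0.
exists (x - x0); rewrite [x0 + _]addrC subrK; split=> //.
- apply/eqP => /eqP; rewrite subr_eq0 => /eqP xx0.
  by move: Fx; rewrite xx0 g01 subrr; move: cs; lra.
- by rewrite (near _ _ Qx) dotZl orth mulr0.
rewrite (le_trans Fx)// lerN2.
have := P2 x0 x; rewrite (subrr x0) (subrr (Q g _)) !normr0 => /(_ r20 xr2 r20).
rewrite (near _ _ Qx) mul1r => h.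
have h2 : `|x - x0| <= L * s.
  rewrite -(addrK (g_z g w0 *: (s *: eta *m invmx (E g w0))) (x - x0)).
  rewrite (le_trans (ler_normB _ _))//.
  rewrite (@le_trans _ _ ((1 + `|g_z g w0| * K) * (s * `|eta|)))//.
    have se : `|s *: eta| = s * `|eta| by rewrite normrZ gtr0_norm.
    rewrite mulrDl mul1r lerD//; first by rewrite -se.
    by rewrite normrZ -mulrA ler_wpM2l// -se.
  rewrite /L -[leRHS]mulrA [(1 + `|eta|) * s]mulrC.
  rewrite ler_wpM2l ?addr_ge0 ?mulr_ge0 ?(ltW K0)//.
  by rewrite ler_wpM2l ?(ltW s0)// lerDr ler01.
rewrite -mulrA ler_wpM2l ?(ltW c0)// ler_pdivrMl ?exprn_gt0// -exprMn.
by rewrite !expr2 ler_pM.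
Qed.

End LevelSets.

(** * Quasi-convexity *)

Lemma last_maximum {R : realType} (m : R -> R) (a b : R) : a <= b ->
  (forall t e, a <= t <= b -> 0 < e -> exists2 r, 0 < r & forall t',
     a <= t' <= b -> `|t' - t| < r -> `|m t' - m t| < e) ->
  exists t0, [/\ a <= t0 <= b, forall t, a <= t <= b -> m t <= m t0 &
    forall t, t0 < t <= b -> m t < m t0].
Proof.
move=> ab cont.
have mc : {within `[a, b], continuous m}.
  apply/subspace_continuousP => t /=; rewrite in_itv/= => tab.
  apply/cvgrPdist_lt => e e0; have [r r0 rP] := cont t e tab e0.
  have tr : \forall t' \near t, `|t - t'| < r by apply/nbhs_normP; exists r.
  rewrite near_withinE; apply: filterS tr => t' t'r /=; rewrite in_itv/= => t'ab.
  by rewrite distrC rP// distrC.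
have [c + cmax] := EVT_max ab mc; rewrite in_itv/= => cab.
have {}cmax t : a <= t <= b -> m t <= m c by move=> tab; apply: cmax; rewrite in_itv.
pose S := [set t | a <= t <= b /\ m t = m c].
have Sc : S c by [].
have Sb : ubound S b by move=> t [/andP[]].
have hS : has_sup S by split; [exists c | exists b].
have supS t : S t -> t <= sup S by apply: ub_le_sup; exists b.
have sab : a <= sup S <= b.
  by rewrite (le_trans _ (supS c Sc)) ?ge_sup//; [exists c | case/andP: cab].
have supE : m (sup S) = m c.
  apply/eqP; rewrite eq_le cmax// leNgt; apply/negP => lt.
  have d0 : 0 < m c - m (sup S) by rewrite subr_gt0.
  have [r r0 rP] := cont _ _ sab d0.
  have [t St tr] := sup_adherent r0 hS; have [tab tc] := St.
  have tS : `|t - sup S| < r.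
    by rewrite distrC ger0_norm ?subr_ge0 ?supS// ltrBlDr -ltrBlDl.
  have hlt := rP t tab tS; rewrite tc in hlt.
  by have := lt_le_trans hlt (ler_norm (m c - m (sup S))); rewrite ltxx.
exists (sup S); rewrite supE; split=> // t /andP[st tb].
have tab : a <= t <= b by rewrite tb (le_trans _ (ltW st))//; case/andP: sab.
rewrite lt_neqAle cmax// andbT; apply/eqP => tc.
by move: st; rewrite ltNge supS.
Qed.

Section QuasiConvexity.
Context {R : realType} {n : nat}.
Local Notation point := ('rV[R]_n * 'rV[R]_n * R)%type.
Context (Gamma : set point) (g : point -> R).
Hypothesis Gamma_open : open Gamma.
Hypothesis g_C2 : C2_on Gamma g.
Hypothesis fiber_itv : forall x y, is_interval (I_fiber Gamma x y).
Hypothesis gz_lt0 : forall w, Gamma w -> g_z g w < 0.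
Hypothesis g_A1 : A1 Gamma g.
Hypothesis g_A2 : A2 Gamma g.
Hypothesis g_A1star : A1star Gamma g.
Hypothesis g_A3w : A3w Gamma g.
Local Opaque g_x g_xx.

Context (Omega : set 'rV[R]_n) (y0 y1 : 'rV[R]_n) (z0 : R).
Hypothesis Omega_open : open Omega.
Hypothesis Omega_Gamma : forall x, Omega x -> Gamma (x, y0, z0).
Hypothesis Omega_convex : forall a b t, Omega a -> Omega b -> 0 <= t <= 1 ->
  exists2 x, Omega x & Q g (x, y0, z0) = (1 - t) *: Q g (a, y0, z0) + t *: Q g (b, y0, z0).
Let h x := gstar Gamma g x y1 (g (x, y0, z0)).
Hypothesis Omega_Gstar : forall x, Omega x -> Gstar Gamma g (x, y1, g (x, y0, z0)).
Hypothesis Omega_segment : forall x, Omega x ->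
  segment (g_x g (x, y0, z0)) (g_x g (x, y1, h x)) `<=` calU_fiber Gamma g x (g (x, y0, z0)).
Implicit Types (x a b X V : 'rV[R]_n).

(** By A1*, the inverse of Q(., y0, z0) on [Omega], meaningful only on the image of [Omega]. *)
Let xi X := xget 0 [set x | Omega x /\ Q g (x, y0, z0) = X].

Lemma level_spec x : Omega x -> Gamma (x, y1, h x) /\ g (x, y1, h x) = g (x, y0, z0).
Proof. by move=> /Omega_Gstar/gstarP. Qed.

Lemma xi_spec x X : Omega x -> Q g (x, y0, z0) = X -> xi X = x.
Proof.
move=> Ox Qx; have : [set x | Omega x /\ Q g (x, y0, z0) = X] (xi X).
  by rewrite /xi; apply: xgetPex; exists x.
move=> [Oxi Qxi]; apply: (g_A1star (y := y0) (z := z0)).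
- by rewrite inE; exact: Omega_Gamma.
- by rewrite inE; exact: Omega_Gamma.
- by rewrite /= Qxi Qx.
Qed.

Lemma Omega_near x : Omega x -> exists2 r, 0 < r & forall x', `|x' - x| < r -> Omega x'.
Proof.
move=> Ox; have /nbhs_normP[r /= r0 rP] := open_nbhs_nbhs (conj Omega_open Ox).
by exists r => // x' x'r; apply: rP; rewrite /= distrC.
Qed.

Lemma xi_near x e : Omega x -> 0 < e -> exists2 r, 0 < r & forall X,
  `|X - Q g (x, y0, z0)| < r ->
  [/\ Omega (xi X), Q g (xi X, y0, z0) = X & `|xi X - x| < e].
Proof.
move=> Ox e0; have [r r0 rP] := Omega_near Ox.
have m0 : 0 < Num.min e r by rewrite lt_min e0.
have Gx := Omega_Gamma Ox.
have [r1 r10 r1P] := Q_solve Gamma_open g_C2 gz_lt0 Gx (g_A2 Gx) m0.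
exists r1 => // X Xr; have [x' [+ Gx' Qx']] := r1P X Xr.
rewrite lt_min => /andP[x'e x'r]; have Ox' := rP _ x'r.
by rewrite (xi_spec Ox' Qx').
Qed.

Lemma g_near x y z e : Gamma (x, y, z) -> 0 < e -> exists2 r, 0 < r & forall x',
  `|x' - x| < r -> `|g (x', y, z) - g (x, y, z)| < e.
Proof.
move=> Gx e0; have [C [r [C0 r0 rP]]] := g_lipschitz Gamma_open g_C2 Gx.
exists (Num.min r (e / C)); first by rewrite lt_min r0 divr_gt0.
move=> x'; rewrite lt_min ltr_pdivlMr// => /andP[xr xe].
have h1 : `|((x', y, z) : point) - (x, y, z)| < r by rewrite normB_x.
have h2 : `|((x, y, z) : point) - (x, y, z)| < r by rewrite subrr normr0.
by rewrite (le_lt_trans (rP _ _ h2 h1))// normB_x mulrC.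
Qed.

(** At x, g(., y1, h x + d) - g(., y0, z0) is negative and g(., y1, h x - d) - g(., y0, z0) is
    positive. Both signs persist nearby, and as g decreases in z they trap h x' between h x - d and
    h x + d. *)
Lemma h_near x e : Omega x -> 0 < e -> exists2 r, 0 < r & forall x',
  Omega x' -> `|x' - x| < r -> `|h x' - h x| < e.
Proof.
move=> Ox e0; have [Gh gh] := level_spec Ox.
have [r r0 rP] := Gamma_near Gamma_open g_C2 Gh.
pose d := Num.min (e / 2) (r / 2).
have d0 : 0 < d by rewrite lt_min !divr_gt0.
have de : d < e by rewrite gt_min ltr_pdivrMr// ltr_pMr// ltr1n.
have dr : d < r by rewrite gt_min [r / 2 < r]ltr_pdivrMr// ltr_pMr// ltr1n orbT.
have Gd a s : `|a - x| < r -> `|s| <= d -> Gamma (a, y1, h x + s).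
  move=> ar sd; apply: rP.
  rewrite -[_ - _]/(a - x, y1 - y1, h x + s - h x) subrr [h x + s]addrC addrK.
  by apply: point_norm_lt => //=; rewrite ?normr0// (le_lt_trans sd).
have dd : `|d| <= d by rewrite gtr0_norm.
have dN : `|- d| <= d by rewrite normrN gtr0_norm.
have xr : `|x - x| < r by rewrite subrr normr0.
have lt1 : g (x, y1, h x + d) - g (x, y0, z0) < 0.
  by rewrite -gh subr_lt0 (g_decreasing g_C2 fiber_itv gz_lt0)// ?ltrDl//; exact: Gd.
have lt2 : 0 < g (x, y1, h x + - d) - g (x, y0, z0).
  rewrite -gh subr_gt0 (g_decreasing g_C2 fiber_itv gz_lt0)//; first exact: Gd.
  by rewrite gtrDl oppr_lt0.
have near s e1 : `|s| <= d -> 0 < e1 -> exists2 r1, 0 < r1 & forall x', `|x' - x| < r1 ->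
    `|g (x', y1, h x + s) - g (x', y0, z0) - (g (x, y1, h x + s) - g (x, y0, z0))| < e1.
  move=> sd e10; have e11 : 0 < e1 / 2 by rewrite divr_gt0.
  have [r1 r10 r1P] := g_near (Gd x s xr sd) e11.
  have [r2 r20 r2P] := g_near (Omega_Gamma Ox) e11.
  exists (Num.min r1 r2); first by rewrite lt_min r10.
  move=> x'; rewrite lt_min => /andP[x1 x2].
  have := r1P _ x1; have := r2P _ x2.
  by rewrite !ltr_norml => /andP[? ?] /andP[? ?]; apply/andP; split; lra.
have gap1 : 0 < - (g (x, y1, h x + d) - g (x, y0, z0)) by rewrite oppr_gt0.
have [r1 r10 r1P] := near _ _ dd gap1.
have [r2 r20 r2P] := near _ _ dN lt2.
exists (Num.min r (Num.min r1 r2)); first by rewrite !lt_min r0 r10.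
move=> x' Ox'; rewrite !lt_min => /and3P[x'r x'1 x'2].
have [Gh' gh'] := level_spec Ox'.
have h1 : g (x', y1, h x + d) < g (x', y1, h x').
  by have := r1P x' x'1; rewrite gh' ltr_norml => /andP[_ ?]; lra.
have h2 : g (x', y1, h x') < g (x', y1, h x + - d).
  by have := r2P x' x'2; rewrite gh' ltr_norml => /andP[? _]; lra.
rewrite (g_ltE g_C2 fiber_itv gz_lt0)// in h1; last exact: Gd.
rewrite (g_ltE g_C2 fiber_itv gz_lt0)// in h2; last exact: Gd.
by rewrite ltr_norml; apply/andP; split; lra.
Qed.

(** If the gradients agreed, (y0, z0) and (y1, z) would be two preimages of one jet, against A1. *)
Lemma grad_neq x z : y1 != y0 -> Gamma (x, y0, z0) -> Gamma (x, y1, z) ->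
  g (x, y1, z) = g (x, y0, z0) -> g_x g (x, y1, z) - g_x g (x, y0, z0) != 0.
Proof.
move=> y10 G0 G1 g01; apply/eqP => /eqP; rewrite subr_eq0 => /eqP gx01.
have [yz [_ uniq]] : exists! yz, jet_preimage Gamma g x (g (x, y0, z0)) (g_x g (x, y0, z0)) yz.
  by apply: g_A1; exists (x, y0, z0).
have e0 : yz = (y0, z0) by apply: uniq.
have e1 : yz = (y1, z) by apply: uniq.
by move/eqP: y10; apply; move: e1; rewrite e0 => -[].
Qed.

Lemma level_grad_neq0 x z : Gamma (x, y0, z0) ->
  g_x g (x, y1, z) - g_x g (x, y0, z0) != 0 -> level_grad g x y0 y1 z0 z != 0.
Proof.
move=> Gx nu0; have gz0 : g_z g (x, y0, z0) != 0 by rewrite lt_eqF// gz_lt0.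
have uE : (E g (x, y0, z0))^T \in unitmx by rewrite unitmx_tr unitmxE unitfE g_A2.
apply: contra nu0; rewrite /level_grad scaler_eq0 oppr_eq0 (negPf gz0)/= => /eqP yd0.
by rewrite -(mulmxKV uE (_ - _)) yd0 mul0mx.
Qed.

Lemma quasi_convex a b x t : Omega a -> Omega b -> Omega x -> 0 <= t <= 1 ->
  Q g (x, y0, z0) = (1 - t) *: Q g (a, y0, z0) + t *: Q g (b, y0, z0) ->
  h x <= h a \/ h x <= h b.
Proof.
move=> Oa Ob Ox t01 Qx.
(* For y1 = y0 the function h is the constant z0, and the two gradients compared below would
   coincide. *)
have [y10|y10] := eqVneq y1 y0.
  have hz0 x' : Omega x' -> h x' = z0.
    by move=> Ox'; rewrite /h y10 (gstarK g_C2 fiber_itv gz_lt0)//; exact: Omega_Gamma.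
  by left; rewrite !hz0.
apply: contrapT => /not_orP[/negP ha /negP hb].
rewrite -ltNge in ha; rewrite -ltNge in hb.
pose X s := (1 - s) *: Q g (a, y0, z0) + s *: Q g (b, y0, z0).
pose V := Q g (b, y0, z0) - Q g (a, y0, z0).
have XD s s' : X (s + s') = X s + s' *: V by rewrite /X /V; row_ring.
have xiX s : 0 <= s <= 1 -> Omega (xi (X s)) /\ Q g (xi (X s), y0, z0) = X s.
  by move=> s01; have [x' Ox' Qx'] := Omega_convex Oa Ob s01; rewrite (xi_spec Ox' Qx').
pose m s := h (xi (X s)).
have V1 : 0 < 1 + `|V| by rewrite ltr_pwDl.
have near_X s r : 0 < r -> exists2 d, 0 < d & forall s', `|s' - s| < d -> `|X s' - X s| < r.
  move=> r0; exists (r / (1 + `|V|)); first by rewrite divr_gt0.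
  move=> s'; rewrite ltr_pdivlMr// => h1.
  have -> : X s' - X s = (s' - s) *: V by rewrite /X /V; row_ring.
  by rewrite normrZ (le_lt_trans _ h1)// ler_wpM2l// lerDr ler01.
have mcont s e : 0 <= s <= 1 -> 0 < e -> exists2 r, 0 < r & forall s',
    0 <= s' <= 1 -> `|s' - s| < r -> `|m s' - m s| < e.
  move=> s01 e0; have [Oxs Qxs] := xiX s s01.
  have [r r0 rP] := h_near Oxs e0; have [r1 r10 r1P] := xi_near Oxs r0.
  have [d d0 dP] := near_X s r1 r10; exists d => // s' s'01 s'd.
  have [|O' _ n'] := r1P (X s'); first by rewrite Qxs dP.
  exact: rP.
(* The maximum is interior because h x exceeds both end values. Taking the last one gives the strict
   descent on its right that [quadratic_crest] needs. *)
have [s0 [s001 mle mlt]] := last_maximum ler01 mcont.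
have [Ox0 Qx0] := xiX s0 s001.
set x0 := xi (X s0) in Ox0 Qx0; pose M := h x0.
have MmE : m s0 = M by [].
have hxM : h x <= M.
  by have := mle t t01; rewrite MmE /m (xi_spec Ox).
have X0 : X 0 = Q g (a, y0, z0) by rewrite /X; row_ring.
have X1 : X 1 = Q g (b, y0, z0) by rewrite /X; row_ring.
have /andP[s00 s01] := s001.
have s0_gt0 : 0 < s0.
  rewrite lt_neqAle s00 andbT; apply/eqP => s0E; move: ha.
  by rewrite -(xi_spec Oa (esym X0)) s0E ltNge -/x0 hxM.
have s0_lt1 : s0 < 1.
  rewrite lt_neqAle s01 andbT; apply/eqP => s0E; move: hb.
  by rewrite -(xi_spec Ob (esym X1)) -s0E ltNge -/x0 hxM.
have [GM gM] := level_spec Ox0; rewrite -/M in GM gM.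
have G0 := Omega_Gamma Ox0.
have nu0 := grad_neq y10 G0 GM gM.
(* With M frozen, h <= M becomes FF <= 0, since g decreases in z. [FF] is strictly differentiable at
   X s0, whereas for h only continuity has been established. *)
pose FF Y := g (xi Y, y1, M) - g (xi Y, y0, z0).
have [rG rG0 GP] := Gamma_near Gamma_open g_C2 GM.
have [r0 r00 r0P] := xi_near Ox0 rG0; rewrite Qx0 in r0P.
have [dX dX0 dXP] := near_X s0 r0 r00.
have FF_strict e : 0 < e -> exists2 r, 0 < r & forall Y Y', `|Y - X s0| < r ->
    `|Y' - X s0| < r ->
    `|FF Y' - FF Y - dot (Y' - Y) (level_grad g x0 y0 y1 z0 M)| <= e * `|Y' - Y|.
  move=> e0; have [r r_gt0 rP] := Q_level_strict Gamma_open g_C2 gz_lt0 g_A2 G0 GM e0.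
  have [r1 r10 r1P] := xi_near Ox0 r_gt0; rewrite Qx0 in r1P.
  exists (Num.min r r1); first by rewrite lt_min r_gt0.
  move=> Y Y'; rewrite !lt_min => /andP[Yr Yr1] /andP[_ Y'r1].
  have [_ QY Yx] := r1P Y Yr1; have [_ QY' Y'x] := r1P Y' Y'r1.
  by have := rP (xi Y) (xi Y') Yx Y'x; rewrite QY QY' Qx0; exact.
have FF0 : FF (X s0) = 0 by rewrite /FF -/x0 gM subrr.
pose d0 := Num.min (dX / 2) (Num.min s0 (1 - s0)).
have d00 : 0 < d0 by rewrite !lt_min divr_gt0// s0_gt0 subr_gt0.
have on_seg s : `|s| <= d0 -> [/\ 0 <= s0 + s <= 1, Gamma (xi (X (s0 + s)), y1, M) &
    Omega (xi (X (s0 + s)))].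
  rewrite !le_min !ler_norml => /and3P[/andP[a1 a2] /andP[a3 _] /andP[_ a4]].
  have s1 : 0 <= s0 + s <= 1 by apply/andP; split; lra.
  have [|O' _ n'] := r0P (X (s0 + s)).
    by apply: dXP; rewrite addrC addKr ltr_norml; apply/andP; split; lra.
  by split=> //; apply: GP; rewrite normB_x.
have FFle s : `|s| <= d0 -> FF (X s0 + s *: V) <= 0.
  move=> /on_seg[s1 G1 O1]; rewrite -XD /FF subr_le0; have [G2 <-] := level_spec O1.
  by rewrite leNgt (g_ltE g_C2 fiber_itv gz_lt0)// -leNgt; exact: mle.
have FFlt s : 0 < s <= d0 -> FF (X s0 + s *: V) < 0.
  move=> /andP[s_gt0 sd]; have [|/andP[s1 s2] G1 O1] := on_seg s; first by rewrite gtr0_norm.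
  rewrite -XD /FF subr_lt0; have [G2 <-] := level_spec O1.
  by rewrite (g_ltE g_C2 fiber_itv gz_lt0)//; apply: mlt; rewrite ltrDl s_gt0.
have [Xh [V' [c [Xhr c0 FXh crest]]]] := quadratic_crest FF_strict
  (level_grad_neq0 G0 nu0) r00 d00 FF0 FFle FFlt.
have [Oh Qh xhx0] := r0P Xh Xhr; set xh := xi Xh in Oh Qh xhx0.
have Gh0 := Omega_Gamma Oh.
have GhM : Gamma (xh, y1, M) by apply: GP; rewrite normB_x.
have gh : g (xh, y1, M) = g (xh, y0, z0) by move/eqP: FXh; rewrite subr_eq0 => /eqP.
have seg := Omega_segment Oh.
(* [FXh] says that h xh = M, so the segment given by the hypothesis at [xh] ends at the gradient of
   g(., y1, M). *)
rewrite /h -gh (gstarK g_C2 fiber_itv gz_lt0 GhM) gh in seg.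
have [r1 r10 r1P] := Omega_near Oh.
have /nbhs_normP[r2 /= r20 r2P] := crest.
have d1 : 0 < Num.min r1 r2 by rewrite lt_min r10.
apply: (level_crest_absurd (eta := V') Gamma_open g_C2 gz_lt0 g_A1 g_A2 g_A3w
  Gh0 GhM gh (grad_neq y10 Gh0 GhM gh) seg c0 d1).
move=> s x'; rewrite !lt_min => /andP[_ sr2] /andP[x'r1 _] G' Q'.
have := r2P s; rewrite /= sub0r normrN => /(_ sr2).
by rewrite /FF -Qh -Q' (xi_spec (r1P _ x'r1) erefl).
Qed.

End QuasiConvexity.

(** * From quasi-convexity to the sections *)

Lemma convex_setP {R : realType} {n : nat} (A : set 'rV[R]_n) :
  convex_set A <-> forall a b t, A a -> A b -> 0 <= t <= 1 -> A ((1 - t) *: a + t *: b).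
Proof.
split=> [cA a b t Aa Ab /andP[t0 t1]|cA a b t].
  have := cA b a (Itv01 t0 t1); rewrite !inE => /(_ Ab Aa).
  by rewrite /conv/= [t *: b + _]addrC.
rewrite !inE => Aa Ab; rewrite /conv/= [X in A X]addrC; apply: cA => //.
by apply/andP; split.
Qed.

Unset Implicit Arguments.
Set Strict Implicit.

Theorem theorem3p1 (R : realType) (n : nat)
    (Gamma : set ('rV[R]_n * 'rV[R]_n * R)) (g : 'rV[R]_n * 'rV[R]_n * R -> R)
    (Omega : set 'rV[R]_n) (u g0 : 'rV[R]_n -> R)
    (y0 : 'rV[R]_n) (z0 : R)
    (hg : generating_function Gamma g)
    (hA1 : A1 Gamma g) (hA2 : A2 Gamma g) (hA1star : A1star Gamma g)
    (hA3w : A3w Gamma g)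
    (hOmega : domain Omega)
    (hu_cont : {within Omega, continuous u})
    (hu_conv : g_convex_function Gamma g Omega u)
    (hg0 : g_affine Gamma g Omega y0 z0 g0)
    (h_i : g_convex_set Gamma g Omega y0 z0)
    (h_ii : forall y x, g_normal_image Gamma g Omega u y -> Omega x ->
      Gstar Gamma g (x, y, g0 x) /\
      [set x] `*` [set g0 x] `*`
        segment (grad g0 x) (g_x g (x, y, gstar Gamma g x y (g0 x)))
        `<=` calU Gamma g) :
  g_convex_set Gamma g (strict_section Omega u g0) y0 z0 /\
  g_convex_set Gamma g (weak_section Omega u g0) y0 z0.
Proof.
have [[Gamma_open _] fibers g_C2 gz_lt0] := hg.
have fiber_itv x y : is_interval (I_fiber Gamma x y) by have [] := fibers x y.
have [oOmega _] := hOmega.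
have [g0E _] := hg0; have [OG /convex_setP cQ] := h_i.
have Omega_Gamma x : Omega x -> Gamma (x, y0, z0) by move=> Ox; apply: OG.
have Omega_convex a b t : Omega a -> Omega b -> 0 <= t <= 1 ->
    exists2 x, Omega x &
      Q g (x, y0, z0) = (1 - t) *: Q g (a, y0, z0) + t *: Q g (b, y0, z0).
  by move=> Oa Ob t01; apply: cQ => //; [exists a | exists b].
(* The support is taken at the very point x whose membership is to be shown, so that u x = g (x, y,
   z); its y lies in the normal image, hence (ii) applies to it. *)
have supporting x : Omega x -> exists y z, [/\ u x = g (x, y, z),
    forall x', Omega x' -> Gamma (x', y, z) /\ g (x', y, z) <= u x',
    forall x', Omega x' -> Gamma (x', y, gstar Gamma g x' y (g0 x')) /\
      g (x', y, gstar Gamma g x' y (g0 x')) = g0 x' &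
    forall a b t, Omega a -> Omega b -> 0 <= t <= 1 ->
      Q g (x, y0, z0) = (1 - t) *: Q g (a, y0, z0) + t *: Q g (b, y0, z0) ->
      gstar Gamma g x y (g0 x) <= gstar Gamma g a y (g0 a) \/
      gstar Gamma g x y (g0 x) <= gstar Gamma g b y (g0 b)].
  move=> Ox; have [y [z [Gyz uE ule]]] := hu_conv x Ox.
  have Gy x' : Omega x' -> Gamma (x', y, z) by move=> Ox'; apply: Gyz.
  have Ty : g_normal_image Gamma g Omega u y.
    exists x => //; split; first by exists (x, y, z); [exact: Gy | rewrite /= uE].
    by rewrite /= uE (gstarK g_C2 fiber_itv gz_lt0 (Gy x Ox)).
  have gst x' : Omega x' -> Gstar Gamma g (x', y, g0 x') by move=> Ox'; have [] := h_ii y x' Ty Ox'.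
  exists y, z; split=> // [x' Ox'|x' Ox'|a b t Oa Ob t01 Qx].
  - by split; [exact: Gy | exact: ule].
  - exact/gstarP/gst.
  rewrite g0E; apply: (quasi_convex Gamma_open g_C2 fiber_itv gz_lt0 hA1 hA2 hA1star
    hA3w oOmega Omega_Gamma Omega_convex _ _ Oa Ob Ox t01 Qx).
    by move=> x' Ox'; have := gst x' Ox'; rewrite g0E.
  move=> x' Ox' p pseg; have [_] := h_ii y x' Ty Ox'; apply.
  split; first by split=> //=; rewrite g0E.
  by rewrite /= g0E grad_slice.
have sub S : S `<=` Omega -> S `*` [set y0] `*` [set z0] `<=` Gamma.
  by move=> SO [[x y] z] [[/= /SO Ox ->] ->]; exact: Omega_Gamma.
split; (split; first by apply: sub => x []).
- apply/convex_setP => _ _ t [a [Oa ua] <-] [b [Ob ub] <-] t01.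
  have [x Ox Qx] := Omega_convex a b t Oa Ob t01; exists x => //; split=> //.
  have [y [z [uE yz gst hle]]] := supporting x Ox.
  have [Gx _] := yz x Ox; have [Ghx ghx] := gst x Ox.
  rewrite uE -ghx (g_ltE g_C2 fiber_itv gz_lt0 Ghx Gx).
  (* From g (c, y, z) <= u c < g0 c, monotonicity in z gives [gstar Gamma g c y (g0 c) < z]. At x,
     where u x equals g (x, y, z), the implication can be reversed. *)
  have below c : Omega c -> u c < g0 c -> gstar Gamma g c y (g0 c) < z.
    move=> Oc uc; have [Gc gc] := yz c Oc; have [Ghc ghc] := gst c Oc.
    by rewrite -(g_ltE g_C2 fiber_itv gz_lt0 Ghc Gc) ghc (le_lt_trans gc).
  by have [hx|hx] := hle a b t Oa Ob t01 Qx; rewrite (le_lt_trans hx)// below.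
- apply/convex_setP => _ _ t [a [Oa ua] <-] [b [Ob ub] <-] t01.
  have [x Ox Qx] := Omega_convex a b t Oa Ob t01; exists x => //; split=> //.
  have [y [z [uE yz gst hle]]] := supporting x Ox.
  have [Gx _] := yz x Ox; have [Ghx ghx] := gst x Ox.
  rewrite uE -ghx leNgt (g_ltE g_C2 fiber_itv gz_lt0 Gx Ghx) -leNgt.
  have below c : Omega c -> u c <= g0 c -> gstar Gamma g c y (g0 c) <= z.
    move=> Oc uc; have [Gc gc] := yz c Oc; have [Ghc ghc] := gst c Oc.
    by rewrite leNgt -(g_ltE g_C2 fiber_itv gz_lt0 Gc Ghc) ghc -leNgt (le_trans gc).
  by have [hx|hx] := hle a b t Oa Ob t01 Qx; rewrite (le_trans hx)// below.
Qed.
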